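(* Let $y>0$. An investment process $\hat\nu\in\mathcal S_o$ is optimal for the problem $V(0,y)=\sup_{\nu\in\mathcal S_o}\mathcal J_{0,y}(\nu)$ if and only if the following two first-order conditions hold: $$\nabla_\nu\mathcal J_{0,y}(\hat\nu)(\tau)\le 0\quad \mathbb P\text{-a.s., for all }\tau\in\mathcal T,$$ $$\mathbb E\Big\{\int_{[0,T)}\nabla_\nu\mathcal J_{0,y}(\hat\nu)(t)\,d\hat\nu(t)\Big\}=0.$$
   Context: Setting. $T\in(0,\infty)$; $(\Omega,\mathcal F,\mathbb P)$ is a complete probability space carrying a one-dimensional Brownian motion $W$ on $[0,T]$, and $\{\mathcal F_t\}_{t\in[0,T]}$ is the usual augmentation of the filtration generated by $W$. $\mathcal T$ is the set of $\{\mathcal F_t\}$-stopping times with values in $[0,T]$ a.s. The processes $\mu_C,\sigma_C,f_C,\mu_F$ are progressively measurable and uniformly bounded in $(\omega,t)$, with $\mu_C\ge0$, $\mu_F\ge 0$, and $f_C$ continuous with $0<k_f\le f_C(t)\le\kappa_f$ for constants $k_f,\kappa_f$. The production function $R$ is nonnegative, measurable, strictly increasing and strictly concave in $C>0$, with continuous derivative $R_c$ satisfying $\lim_{C\to0}R_c(C)=\infty$ and $\lim_{C\to\infty}R_c(C)=0$. $\mathcal S_o$ is the set of nondecreasing, left-continuous, adapted processes $\nu:\Omega\times[0,T]\to\mathbb R_+$ with $\nu(0)=0$ a.s. For $\nu\in\mathcal S_o$ the capacity $C^{y,\nu}$ satisfies $dC^{y,\nu}(t)=C^{y,\nu}(t)[-\mu_C(t)dt+\sigma_C(t)dW(t)]+f_C(t)d\nu(t)$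 on $[0,T)$, $C^{y,\nu}(0)=y$; explicitly, $C^{y,\nu}(t)=C^0(t)\big[y+\int_{[0,t)}\frac{f_C(s)}{C^0(s)}d\nu(s)\big]$ with $C^0(t)=\exp\big(-\int_0^t(\mu_C(s)+\tfrac12\sigma_C^2(s))ds+\int_0^t\sigma_C(s)dW(s)\big)$. The expected total net profit is $$\mathcal J_{0,y}(\nu)=\mathbb E\Big\{\int_0^Te^{-\int_0^t\mu_F(s)ds}R(C^{y,\nu}(t))dt-\int_{[0,T)}e^{-\int_0^t\mu_F(s)ds}d\nu(t)\Big\},$$ and its supremum $V(0,y)$ over $\mathcal S_o$ is finite. The supergradient $\nabla_\nu\mathcal J_{0,y}(\nu)$ is the optional process (the optional projection, unique up to indistinguishability) such that for every $\tau\in\mathcal T$ $$\nabla_\nu\mathcal J_{0,y}(\nu)(\tau)=\mathbb E\Big\{\int_\tau^Te^{-\int_0^s\mu_F(u)du}C^0(s)\frac{f_C(\tau)}{C^0(\tau)}R_c(C^{y,\nu}(s))ds\,\Big|\,\mathcal F_\tau\Big\}-e^{-\int_0^\tau\mu_F(u)du}\mathbf 1_{\{\tau<T\}}.$$ *)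

(* Defs.v *)
From HB Require Import structures.
From mathcomp Require Import all_boot all_order all_algebra.
From mathcomp Require Import all_classical all_reals all_analysis.
From mathcomp Require Import measurable_realfun.

Set Implicit Arguments.
Unset Strict Implicit.
Unset Printing Implicit Defensive.

Import Order.TTheory GRing.Theory Num.Theory.
Import numFieldNormedType.Exports.

Local Open Scope classical_set_scope.
Local Open Scope ring_scope.

(* Processes indexed by [0, T] are functions R -> Omega -> R (time first); their
   values at times outside [0, T] are irrelevant. *)

(** * Stieltjes measure of a left-continuous nondecreasing path *)

Section stieltjes.
Context {R : realType}.
Variables (T : R) (g : R -> R).

(* For g nondecreasing on [0, T] this is the right limit g(t+) for t in [0, T[,
   the constant g 0 for t < 0 and the constant g T for t >= T. Hence, if g is
   also left-continuous, its Lebesgue-Stieltjes measure gives g b - g a to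
   [a, b[ for 0 <= a <= b <= T, and no mass outside [0, T[; a jump of g at 0+
   is an atom at 0. The maximum with g 0 makes this a cumulative function for
   arbitrary g. *)
Definition right_limit (t : R) : R :=
  inf [set Num.max (g 0) (g (Num.min (Num.max 0 s) T)) | s in `]t, +oo[].

Let img t := [set Num.max (g 0) (g (Num.min (Num.max 0 s) T)) | s in `]t, +oo[].

Let img_has_inf t : has_inf (img t).
Proof.
split; last by exists (g 0) => _ [s _ <-]; rewrite le_max lexx.
exists (Num.max (g 0) (g (Num.min (Num.max 0 (t + 1)) T))), (t + 1) => //=.
by rewrite in_itv/= andbT ltrDl.
Qed.

Lemma right_limit_nd : {homo right_limit : x y / x <= y}.
Proof.
move=> x y xy; apply: lb_le_inf; first exact: (img_has_inf y).1.
move=> _ [s /= ys <-]; apply: ge_inf; first exact: (img_has_inf x).2.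
exists s => //=; move: ys; rewrite !in_itv/= !andbT; exact: le_lt_trans.
Qed.

Lemma right_limit_rc : right_continuous right_limit.
Proof.
move=> x; apply/cvgrPdist_lt => e e0.
have [_ [s /= xs <-] lts] := inf_adherent e0 (img_has_inf x).
move: xs; rewrite in_itv/= andbT => xs.
near=> z.
have xz : x < z by near: z; exact: nbhs_right_gt.
have zs : z < s by near: z; exact: nbhs_right_lt.
rewrite ler0_norm ?subr_le0; last by apply: right_limit_nd; exact: ltW.
rewrite opprB ltrBlDr addrC; apply: le_lt_trans lts.
apply: ge_inf; first exact: (img_has_inf z).2.
by exists s => //=; rewrite in_itv/= andbT.
Unshelve. all: end_near. Qed.

HB.instance Definition _ :=
  isCumulative.Build R _ R right_limit right_limit_nd right_limit_rc.

End stieltjes.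

Notation stieltjes T g := (lebesgue_stieltjes_measure (right_limit T g)).

Lemma right_limit_cvg (R : realType) (T : R) (g : R -> R) (t : R) :
  {in `[0, T] &, {homo g : x y / x <= y}} -> 0 <= t -> t < T ->
  g s @[s --> t^'+] --> right_limit T g t.
Proof.
move=> nd t0 tT.
have E s : t < s -> s <= T ->
    Num.max (g 0) (g (Num.min (Num.max 0 s) T)) = g s.
  move=> ts sT; have s0 : 0 <= s by rewrite (le_trans t0)// ltW.
  rewrite (max_idPr s0) (min_idPl sT); apply/max_idPr.
  by apply: nd; rewrite ?in_itv/= ?lexx// ?s0// (le_trans s0).
apply/cvgrPdist_lt => e e0.
set A := [set Num.max (g 0) (g (Num.min (Num.max 0 s) T)) | s in `]t, +oo[].
have hA : has_inf A.
  split; last by exists (g 0) => _ [s _ <-]; rewrite le_max lexx.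
  by exists (Num.max (g 0) (g (Num.min (Num.max 0 T) T))), T => //=; rewrite in_itv/= tT.
have [_ [s /= ts <-] lts] := inf_adherent e0 hA.
move: ts; rewrite in_itv/= andbT => ts.
near=> z.
have tz : t < z by near: z; exact: nbhs_right_gt.
have zs : z < s by near: z; exact: nbhs_right_lt.
have zT : z < T by near: z; exact: nbhs_right_lt.
have z0 : 0 <= z by rewrite (le_trans t0)// ltW.
have lez : right_limit T g t <= g z.
  apply: ge_inf; first exact: hA.2.
  by exists z; [rewrite /= in_itv/= tz|exact: E (ltW zT)].
rewrite ler0_norm ?subr_le0// opprB ltrBlDr addrC; apply: le_lt_trans lts.
rewrite -(E z tz (ltW zT)) ge_max !le_max lexx /=; apply/orP; right.
have T0 : 0 <= T by rewrite (le_trans t0)// ltW.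
rewrite (max_idPr z0) (min_idPl (ltW zT)); apply: nd.
- by rewrite in_itv/= z0 ltW.
- by rewrite in_itv/= le_min le_max lexx T0/= ge_min lexx orbT.
- by rewrite le_min (ltW zT) andbT le_max (ltW zs) orbT.
Unshelve. all: end_near. Qed.

(** * Filtrations, stopping times, classes of processes *)

Section processes.
Context d (Omega : measurableType d) (R : realType).
Variables (P : probability Omega R) (T : R).
Implicit Types (Ft : R -> set (set Omega)) (X : R -> Omega -> R).
Implicit Types (tau : Omega -> R).

Definition cylinders X (t : R) : set (set Omega) :=
  \bigcup_(s in [set s | 0 <= s <= T /\ s <= t])
    preimage_set_system setT (X s) measurable.

Definition natural_filtration X (t : R) : set (set Omega) := <<s cylinders X t >>.

(* The intersection is over all real s > t and cylinders X s is constant for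
   s >= T, so that at t = T only the null sets are added. *)
Definition augmented_filtration X (t : R) : set (set Omega) :=
  \bigcap_(s in [set s | t < s]) <<s cylinders X s `|` P.-negligible >>.

Record brownian_motion (W : R -> Omega -> R) : Prop := BrownianMotion {
  brownian_measurable : forall t : R, t \in `[0, T] -> measurable_fun setT (W t) ;
  brownian0 : {ae P, forall w, W 0 w = 0} ;
  brownian_continuous :
    {ae P, forall w, {within `[0, T], continuous (W ^~ w)}} ;
  brownian_gaussian : forall s t : R, 0 <= s -> s < t -> t <= T ->
    forall B : set R, measurable B ->
    P [set w | B (W t w - W s w)] = normal_prob 0 (Num.sqrt (t - s)) B ;
  brownian_independent : forall s t : R, 0 <= s -> s < t -> t <= T ->
    forall (A : set Omega) (B : set R), natural_filtration W s A -> measurable B ->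
    P (A `&` [set w | B (W t w - W s w)]) =
      (P A * P [set w | B (W t w - W s w)%R])%E }.

Definition adapted Ft X : Prop :=
  forall t : R, t \in `[0, T] ->
  forall B : set R, measurable B -> Ft t (X t @^-1` B).

Definition progressive Ft X : Prop :=
  forall t : R, t \in `[0, T] ->
  measurable_fun [set sw | sw.1 \in `[0, t]]
    (fun sw : measurableTypeR R * g_sigma_algebraType (Ft t) => X sw.1 sw.2).

Definition uniformly_bounded X : Prop :=
  exists K : R, forall (t : R) (w : Omega), t \in `[0, T] -> `|X t w| <= K.

Definition cadlag (x : R -> R) : Prop :=
  (forall t : R, t \in `[0, T[ -> x s @[s --> t^'+] --> x t) /\
  (forall t : R, t \in `]0, T] -> cvg (x s @[s --> t^'-])).

Definition optional_sigma_algebra Ft : set (set (R * Omega)) :=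
  <<s [set sw | sw.1 \in `[0, T]],
      [set E | exists X (B : set R),
        [/\ adapted Ft X, forall w, cadlag (X ^~ w), measurable B &
          E = [set sw | sw.1 \in `[0, T] /\ B (X sw.1 sw.2)]]] >>.

Definition optional Ft (G : R -> Omega -> \bar R) : Prop :=
  forall B : set (\bar R), measurable B ->
  optional_sigma_algebra Ft [set sw | sw.1 \in `[0, T] /\ B (G sw.1 sw.2)].

Definition stopping_time Ft tau : Prop :=
  (forall t : R, t \in `[0, T] -> Ft t [set w | tau w <= t]) /\
  {ae P, forall w, 0 <= tau w <= T}.

Definition stopped_sigma_algebra Ft tau : set (set Omega) :=
  [set A | Ft T A /\
    forall t : R, t \in `[0, T] -> Ft t (A `&` [set w | tau w <= t])].

(* Y is a version of E[X | G], for X with values in [0, +oo] and G a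
   sub-sigma-algebra. *)
Definition cond_expectation (G : set (set Omega)) (X Y : Omega -> \bar R) : Prop :=
  (forall B : set (\bar R), measurable B -> G (Y @^-1` B)) /\
  (forall A, G A -> (\int[P]_(w in A) Y w = \int[P]_(w in A) X w)%E).

(** * Ito integral *)

(* sum_(i < n) xi_i 1_(]t_i, t_(i+1)]) *)
Record simple_process := SimpleProcess {
  simple_size : nat ;
  simple_time : nat -> R ;
  simple_coef : nat -> Omega -> R }.

Definition simple_wf Ft (phi : simple_process) : Prop :=
  forall i, (i < simple_size phi)%N ->
  [/\ 0 <= simple_time phi i, simple_time phi i <= simple_time phi i.+1,
      simple_time phi i.+1 <= T,
      (exists K : R, forall w, `|simple_coef phi i w| <= K) &
      forall B : set R, measurable B ->
        Ft (simple_time phi i) (simple_coef phi i @^-1` B)].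

Definition simple_value (phi : simple_process) (t : R) (w : Omega) : R :=
  \sum_(i < simple_size phi)
    simple_coef phi i w * (simple_time phi i < t <= simple_time phi i.+1)%R%:R.

Definition simple_integral (W : R -> Omega -> R) (phi : simple_process)
    (t : R) (w : Omega) : R :=
  \sum_(i < simple_size phi) simple_coef phi i w *
    (W (Num.min (simple_time phi i.+1) t) w - W (Num.min (simple_time phi i) t) w).

(* M is a continuous version of t |-> \int_0^t X dW: the L^2-limit of integrals
   of simple processes that approximate X in L^2(dt x P). *)
Definition ito_integral Ft (W X M : R -> Omega -> R) : Prop :=
  [/\ adapted Ft M,
      {ae P, forall w, {within `[0, T], continuous (M ^~ w)}} &
      exists phi : nat -> simple_process,
      [/\ forall k, simple_wf Ft (phi k),
          (fun k => (\int[P]_w \int[lebesgue_measure]_(t in `[0%R, T])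
             ((simple_value (phi k) t w - X t w) ^+ 2)%:E)%E) @ \oo --> 0%E &
          forall t : R, t \in `[0, T] ->
          (fun k => (\int[P]_w
             ((simple_integral W (phi k) t w - M t w) ^+ 2)%:E)%E) @ \oo --> 0%E]].

End processes.

(** * The irreversible investment problem *)

Record production_function (R : realType) (F : R -> R) : Prop :=
  ProductionFunction {
  production_ge0 : forall c : R, 0 < c -> 0 <= F c ;
  production_measurable : measurable_fun [set c : R | 0 < c] F ;
  production_increasing : forall a b : R, 0 < a -> a < b -> F a < F b ;
  production_strictly_concave : forall a b t : R, 0 < a -> 0 < b -> a != b ->
    0 < t -> t < 1 -> t * F a + (1 - t) * F b < F (t * a + (1 - t) * b) ;
  production_derivable : forall c : R, 0 < c -> derivable F c 1 ;
  production_derive_continuous : forall c : R, 0 < c -> {for c, continuous (derive1 F)} ;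
  production_derive_at0 : derive1 F c @[c --> 0^'+] --> +oo ;
  production_derive_atoo : derive1 F c @[c --> +oo] --> (0 : R) }.

Section investment.
Context d (Omega : measurableType d) (R : realType).
Variables (P : probability Omega R) (T : R) (Ft : R -> set (set Omega)).
(* M stands for the stochastic integral \int_0^. sigmaC dW *)
Variables (muC sigmaC fC muF M : R -> Omega -> R) (F : R -> R) (y : R).
Implicit Types nu : R -> Omega -> R.

Record admissible nu : Prop := Admissible {
  admissible_ge0 : forall (t : R) (w : Omega), t \in `[0, T] -> 0 <= nu t w ;
  admissible_nd : forall w, {in `[0, T] &, {homo nu ^~ w : s t / s <= t}} ;
  admissible_left_continuous : forall (w : Omega) (t : R), t \in `]0, T] ->
    nu s w @[s --> t^'-] --> nu t w ;
  admissible_adapted : adapted T Ft nu ;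
  admissible0 : {ae P, forall w, nu 0 w = 0} }.

Definition discount (t : R) (w : Omega) : R :=
  expR (- \int[lebesgue_measure]_(s in `[0, t]) muF s w).

Definition unit_capacity (t : R) (w : Omega) : R :=
  expR (M t w -
        \int[lebesgue_measure]_(s in `[0, t]) (muC s w + sigmaC s w ^+ 2 / 2)).

Definition capacity nu (t : R) (w : Omega) : R :=
  unit_capacity t w *
  (y + \int[stieltjes T (nu ^~ w)]_(s in `[0, t[) (fC s w / unit_capacity s w)).

Definition revenue nu (w : Omega) : \bar R :=
  (\int[lebesgue_measure]_(t in `[0%R, T])
     (discount t w * F (capacity nu t w))%:E)%E.

Definition cost nu (w : Omega) : \bar R :=
  (\int[stieltjes T (nu ^~ w)]_(t in `[0%R, T[) (discount t w)%:E)%E.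

(* The expectation of revenue - cost, both nonnegative. It is -oo as soon as the
   expected cost is infinite, because +oo - +oo = -oo in \bar R. *)
Definition net_profit nu : \bar R :=
  (\int[P]_w revenue nu w - \int[P]_w cost nu w)%E.

Definition value : \bar R := ereal_sup [set net_profit nu | nu in admissible].

Definition optimal nu : Prop := admissible nu /\ net_profit nu = value.

Definition marginal_revenue nu (tau : Omega -> R) (w : Omega) : \bar R :=
  (\int[lebesgue_measure]_(s in `[tau w, T])
     (discount s w * unit_capacity s w *
      (fC (tau w) w / unit_capacity (tau w) w) * derive1 F (capacity nu s w))%:E)%E.

(* The supergradient is extended-real valued: the conditional expectation of a
   nonnegative variable may be infinite. *)
Definition supergradient nu (G : R -> Omega -> \bar R) : Prop :=
  optional T Ft G /\
  forall tau, stopping_time P T Ft tau ->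
  exists2 Y : Omega -> \bar R,
    cond_expectation P (stopped_sigma_algebra T Ft tau)
      (marginal_revenue nu tau) Y &
    {ae P, forall w,
      G (tau w) w = (Y w - (discount (tau w) w * (tau w < T)%R%:R)%:E)%E}.

End investment.

(* Main.v *)
(* The revenue is concave in the investment plan, because the capacity is affine
   in nu and F is concave; the supergradient is its derivative minus the unit
   cost. The time change tau_u = inf {t : nu(t+) - nu(0) >= u} turns integrals
   against d nu into Lebesgue integrals over u > 0 of values at the stopping
   times tau_u, so that by Tonelli and conditioning on F_(tau_u) the pairing of
   the marginal revenue with d nu is the integral over u of E[Y_(tau_u)], where
   Y is its optional projection.

   Sufficiency: the two conditions give pairing(nu, nu) = cost(nu) and
   pairing(nu, nu') <= cost(nu') for every plan nu', and the tangent inequality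
   for F concludes, provided that cost(nu) is finite. Finiteness follows from
   truncating u <= n: F'(C) times the truncated capacity is at most
   F(c) + e * capacity with e arbitrarily small, and the expected capacity is
   bounded by the investment because E[exp(M_s - M_tau) | F_tau] is bounded
   (M is a stochastic integral with bounded integrand).

   Necessity: perturbing nu by a jump of size e -> 0 at tau restricted to an event
   of F_tau gives the inequality (Fatou). Replacing nu by l * nu with l -> 1- gives
   cost(nu) <= pairing(nu, nu) by dominated convergence; the derivative in the
   direction +nu is not needed. *)

Require Import Defs.
From HB Require Import structures.
From mathcomp Require Import all_boot all_order all_algebra.
From mathcomp Require Import all_classical all_reals all_analysis.
From mathcomp Require Import measurable_realfun.
From mathcomp Require Import lra ring.

Import Order.TTheory GRing.Theory Num.Theory.
Import numFieldNormedType.Exports.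

Local Open Scope classical_set_scope.
Local Open Scope ring_scope.

Set Implicit Arguments.
Unset Strict Implicit.
Unset Printing Implicit Defensive.

(** * Time change of a Stieltjes integral *)

(** The supergradient is tied to conditional expectations at one stopping time at a time, with a
    null set that depends on the time. Three obstacles shape the rest. Revenue, cost and marginal
    revenue may be infinite: inequalities are written additively in [0, +oo], and finiteness is
    drawn from F'(C) (C - C^0 y) <= F(C), which bounds the pairing of a plan with itself by its
    revenue. Necessity takes tangents at the perturbed plan, because optimality makes the revenue
    there finite; derivatives at nu are reached in the limit. Finally, the simple processes that
    define the Ito integral do not inherit the bound K of the integrand, so the compensator of their
    exponential carries a random excess, which vanishes along a subsequence. *)

Section right_limit_theory.
Context {R : realType} (T : R) (T_gt0 : 0 < T) (g : R -> R).
Hypothesis g_nd : {in `[0, T] &, {homo g : x y / x <= y}}.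

Let has_inf_img (t : R) :
  has_inf [set Num.max (g 0) (g (Num.min (Num.max 0 s) T)) | s in `]t, +oo[].
Proof.
split; last by exists (g 0) => _ [s _ <-]; rewrite le_max lexx.
exists (Num.max (g 0) (g (Num.min (Num.max 0 (t + 1)) T))), (t + 1) => //=.
by rewrite in_itv/= andbT ltrDl.
Qed.

Let g0_le (t : R) : 0 <= t <= T -> g 0 <= g t.
Proof.
by move=> /[dup] /andP[t0 _] tT; apply: g_nd => //; rewrite in_itv/= ?lexx ?tT ?ltW.
Qed.

Let clampE (t : R) : 0 <= t -> t <= T -> Num.min (Num.max 0 t) T = t.
Proof. by move=> t0 tT; rewrite (max_idPr t0); apply/min_idPl. Qed.

Lemma right_limit_lt0 (t : R) : t < 0 -> right_limit T g t = g 0.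
Proof.
move=> t0; apply/eqP; rewrite eq_le; apply/andP; split.
  apply: ge_inf; first exact: (has_inf_img t).2.
  exists 0 => /=; first by rewrite in_itv/= t0.
  by rewrite (clampE (lexx 0) (ltW T_gt0)) maxxx.
apply: lb_le_inf; first exact: (has_inf_img t).1.
by move=> _ [s _ <-]; rewrite le_max lexx.
Qed.

Lemma right_limit_ge_init (t : R) : g 0 <= right_limit T g t.
Proof.
apply: lb_le_inf; first exact: (has_inf_img t).1.
by move=> _ [s _ <-]; rewrite le_max lexx.
Qed.

Lemma right_limit_geT (t : R) : T <= t -> right_limit T g t = g T.
Proof.
move=> Tt; rewrite /right_limit.
have -> : [set Num.max (g 0) (g (Num.min (Num.max 0 s) T)) | s in `]t, +oo[]
    = [set g T].
  have E s : t < s -> Num.max (g 0) (g (Num.min (Num.max 0 s) T)) = g T.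
    move=> ts; have sT : T <= s by rewrite (le_trans Tt)// ltW.
    rewrite (max_idPr (le_trans (ltW T_gt0) sT)) (min_idPr sT).
    by apply/max_idPr/g0_le; rewrite lexx ltW.
  apply/seteqP; split => [_ [s /= ts <-]|_ /= ->].
    by apply: E; move: ts; rewrite in_itv/= andbT.
  by exists (t + 1); rewrite ?E//= ?in_itv/= ?andbT ?ltrDl.
exact: inf1.
Qed.

Lemma right_limit_le (s t : R) : 0 <= s -> s < t -> t <= T -> right_limit T g s <= g t.
Proof.
move=> s0 st tT; apply: ge_inf; first exact: (has_inf_img s).2.
exists t; first by rewrite /= in_itv/= st.
have t0 : 0 <= t by rewrite (le_trans s0)// ltW.
by rewrite (clampE t0 tT); apply/max_idPr/g0_le; rewrite t0.
Qed.

Lemma right_limit_ge (t : R) : 0 <= t -> t <= T -> g t <= right_limit T g t.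
Proof.
move=> t0 tT; apply: lb_le_inf; first exact: (has_inf_img t).1.
move=> _ [s /= ts <-]; rewrite le_max; apply/orP; right.
move: ts; rewrite in_itv/= andbT => ts; apply: g_nd.
- by rewrite in_itv/= t0.
- by rewrite in_itv/= le_min le_max lexx (ltW T_gt0)/= ge_min lexx orbT.
- by rewrite le_min tT andbT le_max (ltW ts) orbT.
Qed.

Lemma right_limit_leT (t : R) : right_limit T g t <= g T.
Proof.
have [t0|t0] := ltP t 0; first by rewrite right_limit_lt0// g0_le// lexx ltW.
have [tT|Tt] := ltP t T; first exact: right_limit_le.
by rewrite right_limit_geT.
Qed.

(* The union with [set T] gives the value T to a level u that is not reached. *)
Definition hitting (u : R) : R :=
  inf ([set t | 0 <= t <= T /\ u <= right_limit T g t - g 0] `|` [set T]).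

Let hset (u : R) : set R := [set t | 0 <= t <= T /\ u <= right_limit T g t - g 0] `|` [set T].

Let has_inf_hset (u : R) : has_inf (hset u).
Proof.
split; first by exists T; right.
by exists 0 => _ [[/andP[]]//|->]; exact: ltW.
Qed.

Lemma hitting_itv (u : R) : 0 <= hitting u <= T.
Proof.
apply/andP; split; last by apply: ge_inf; [exact: (has_inf_hset u).2|right].
apply: lb_le_inf; first exact: (has_inf_hset u).1.
by move=> _ [[/andP[]]//|->]; exact: ltW.
Qed.

Lemma hitting_nd : {homo hitting : u v / u <= v}.
Proof.
move=> u v uv; apply: lb_le_inf; first exact: (has_inf_hset v).1.
move=> t [[t0T vt]|->]; apply: ge_inf; first exact: (has_inf_hset u).2.
- by left; split => //; exact: le_trans vt.
- exact: (has_inf_hset u).2.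
- by right.
Qed.

(** Right continuity of [right_limit T g] makes the infimum attained below T, so that [hitting]
    inverts it. At t = T the equivalence may fail, since levels that are never reached have hitting
    time T. *)
Lemma hitting_le (u t : R) : 0 <= t -> t < T ->
  (hitting u <= t) = (u <= right_limit T g t - g 0).
Proof.
move=> t0 tT; apply/idP/idP => [ut|ut]; last first.
  apply: ge_inf; first exact: (has_inf_hset u).2.
  by left; split => //; rewrite t0 ltW.
rewrite leNgt; apply/negP => tu.
have /cvgrPdist_lt rc := @right_limit_rc _ T g t.
have /rc[e /= e0 He] : 0 < u - (right_limit T g t - g 0) by rewrite subr_gt0.
(* A near-minimal element s: the slack [Num.min e (T - t)] puts s within the radius of right
   continuity and below T, which excludes the default element T. *)
have [s [[s0T us]|sT] lts] : exists2 s, hset u s & s < t + Num.min e (T - t).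
  have me0 : 0 < Num.min e (T - t) by rewrite lt_min e0 subr_gt0.
  have [s hs ls] := inf_adherent me0 (has_inf_hset u).
  by exists s => //; apply: (lt_le_trans ls); rewrite lerD2r.
- have [st|ts] := leP s t.
    have := le_trans us (lerB (right_limit_nd T g st) (lexx (g 0))).
    by rewrite leNgt tu.
  have : `|t - s| < e.
    rewrite ltr0_norm ?subr_lt0// opprB ltrBlDl (lt_le_trans lts)// lerD2l.
    by rewrite ge_min lexx.
  move=> /He /(_ ts); rewrite ler0_norm ?subr_le0; last first.
    exact/right_limit_nd/ltW.
  rewrite opprB; move: us; rewrite (lock (right_limit T g s)) (lock (right_limit T g t)).
  by move: tu => _; lra.
- move: lts; rewrite sT => /lt_le_trans => /(_ (t + (T - t))).
  by rewrite lerD2l ge_min lexx orbT subrKC => /(_ isT); rewrite ltxx.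
Qed.

(** Left continuity rules out a jump of the path at T itself, so a level strictly below the total
    increase is reached earlier. The level equal to the total increase may have hitting time T,
    whence the gap between this lemma and [hitting_lt_le]. *)
Lemma hitting_lt (u : R) : u < g T - g 0 -> g x @[x --> T^'-] --> g T -> hitting u < T.
Proof.
move=> uT /cvgrPdist_lt lc.
have [e/= e0 He] := lc _ (eq_ind_r is_true uT (subr_gt0 u (g T - g 0))).
(* Within e of T, as the left limit requires, and still in [0, T[. *)
pose s := Num.max (T / 2) (T - e / 2).
have s0 : 0 <= s by rewrite le_max divr_ge0// ltW.
have sT : s < T by rewrite gt_max; apply/andP; split; move: T_gt0 e0; lra.
have : `|T - s| < e.
  rewrite gtr0_norm ?subr_gt0// ltrBlDr -ltrBlDl lt_max; apply/orP; right.
  by move: e0; lra.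
move=> /He /(_ sT); rewrite ger0_norm ?subr_ge0; last first.
  by apply: g_nd; rewrite ?in_itv/= ?s0 ?lexx ltW.
move=> gs; apply: (le_lt_trans _ sT); rewrite hitting_le//.
have := right_limit_ge s0 (ltW sT); move: gs.
by rewrite (lock (right_limit T g s)); lra.
Qed.

Lemma hitting_lt_le (u : R) : hitting u < T -> u <= g T - g 0.
Proof.
move=> uT; have := lexx (hitting u).
rewrite {1}hitting_le//; last by case/andP: (hitting_itv u).
by move=> /le_trans; apply; rewrite lerD2r right_limit_leT.
Qed.

Lemma measurable_hitting : measurable_fun setT hitting.
Proof. by apply: nondecreasing_measurable => //; exact: hitting_nd. Qed.

End right_limit_theory.

Lemma stieltjes_ocitv (R : realType) (T : R) (g : R -> R) (a b : R) : a <= b ->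
  stieltjes T g `]a, b]%classic = (right_limit T g b - right_limit T g a)%:E.
Proof.
move=> ab; rewrite /lebesgue_stieltjes_measure /measure_extension measurable_mu_extE/=.
  by rewrite wlength_itv_bnd.
exact: is_ocitv.
Qed.

Section time_change.
Context {R : realType} (T : R) (T_gt0 : 0 < T) (g : R -> R).
Hypothesis g_nd : {in `[0, T] &, {homo g : x y / x <= y}}.
Hypothesis g_lc : g x @[x --> T^'-] --> g T.

(** Levels u <= 0 are sent to T, which lies outside every [0, s[ with s <= T, so they do not
    contribute to the image of Lebesgue measure there. *)
Let phi (u : R) : R := if 0 < u then hitting T g u else T.

Let measurable_phi : @measurable_fun _ _ (measurableTypeR R) (measurableTypeR R) setT phi.
Proof.
apply: measurable_fun_ifT; [exact: measurable_fun_ltr|exact: measurable_hitting|by []].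
Qed.

Let U := [set u : R | 0 < u /\ hitting T g u < T].

Let mU : measurable U.
Proof.
rewrite (_ : U = `]0, +oo[ `&` (hitting T g @^-1` `]-oo, T[)).
  by apply: measurableI => //; rewrite -[X in measurable X]setTI; exact: measurable_hitting.
by apply/seteqP; split => u /=; rewrite !in_itv/= andbT.
Qed.

(** At the end levels the hitting time is not controlled, so a set of levels is only squeezed
    between an open interval and its closure, which have the same length. *)
Let lebesgue_itv (A : set R) (a b : R) : a <= b -> `]a, b[ `<=` A -> A `<=` `[a, b] ->
  measurable A -> lebesgue_measure A = (b - a)%:E.
Proof.
move=> ab A1 A2 mA; apply/eqP; rewrite eq_le; apply/andP; split.
  apply: (@le_trans _ _ (lebesgue_measure (`[a, b]%classic : set R))).
    by apply: le_measure; rewrite ?inE.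
  rewrite lebesgue_measure_itv/= lte_fin; case: ifPn => [|]; first by rewrite EFinB.
  by rewrite lee_fin subr_ge0.
apply: (@le_trans _ _ (lebesgue_measure (`]a, b[%classic : set R))).
  rewrite lebesgue_measure_itv/= lte_fin; case: ifPn => [|]; first by rewrite EFinB.
  by rewrite lee_fin subr_le0 -leNgt.
by apply: le_measure; rewrite ?inE.
Qed.

Let rl := right_limit T g.

(** Up to end points, the levels with hitting time in ]a, b] lie between the right limits at a and
    at b, measured from g 0. Intersecting with [U] discards the levels that the default value T
    would add. *)
Let ocitv_image (a b : R) : a <= b ->
  lebesgue_measure ((phi @^-1` `]a, b]) `&` U) = (rl b - rl a)%:E.
Proof.
move=> ab.
have mA : measurable ((phi @^-1` `]a, b]) `&` U).
  by apply: measurableI => //; rewrite -[X in measurable X]setTI; exact: measurable_phi.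
have rl0 t : 0 <= rl t - g 0 by rewrite subr_ge0 right_limit_ge_init.
have -> : rl b - rl a = (rl b - g 0) - (rl a - g 0) by ring.
apply: lebesgue_itv => //.
- by rewrite lerD2r right_limit_nd.
- move=> u /=; rewrite !in_itv/= => /andP[au ub].
  have u0 : 0 < u by exact: le_lt_trans au.
  have uT : hitting T g u < T.
    apply: hitting_lt => //; apply: (lt_le_trans ub).
    by rewrite lerD2r right_limit_leT.
  split => //; rewrite /phi u0; apply/andP; split.
    have [a0|a0] := ltP a 0.
      by rewrite (lt_le_trans a0)//; case/andP: (hitting_itv T_gt0 g u).
    have [aT|Ta] := ltP a T.
      by rewrite ltNge hitting_le// -ltNge.
    by move: au; rewrite /rl right_limit_geT// ltNge hitting_lt_le.
  have [bT|Tb] := ltP b T; last by rewrite (le_trans (ltW uT)).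
  have [b0|b0] := ltP b 0; last by rewrite hitting_le// ltW.
  by move: (lt_trans u0 ub); rewrite /rl right_limit_lt0// subrr ltxx.
- move=> u /= [+ [u0 uT]]; rewrite /phi u0 !in_itv/= => /andP[au ub].
  apply/andP; split.
    have [a0|a0] := ltP a 0; first by rewrite /rl right_limit_lt0// subrr ltW.
    have aT : a < T by exact: lt_trans uT.
    by rewrite leNgt; apply/negP => /ltW; rewrite -hitting_le// leNgt au.
  have [bT|Tb] := ltP b T; last by rewrite /rl right_limit_geT// hitting_lt_le.
  have b0 : 0 <= b by rewrite (le_trans _ ub)//; case/andP: (hitting_itv T_gt0 g u).
  by rewrite -hitting_le.
Qed.

(** Both sides are measures that agree on half-open intervals, and these determine a
    Lebesgue-Stieltjes measure. *)
Let stieltjesE (A : set R) : measurable A ->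
  stieltjes T g A = lebesgue_measure ((phi @^-1` A) `&` U).
Proof.
move=> mA.
pose m : {measure set (measurableTypeR R) -> \bar R} :=
  pushforward (mrestr lebesgue_measure mU) (phi : measurableTypeR R -> measurableTypeR R).
rewrite (@lebesgue_stieltjes_measure_unique _ (right_limit T g) (m measurable_phi))// => X /ocitvP[->|[x ? ->]].
  by rewrite !measure0.
rewrite stieltjes_ocitv; last exact: ltW.
by rewrite -ocitv_image// ltW.
Qed.

(** An image-measure formula: d g is the image of Lebesgue measure under the hitting times. Leaving
    s out of the interval makes the restriction to [U] automatic, because s <= T. *)
Lemma integral_time_change (s : R) (h : R -> \bar R) : s <= T ->
  measurable_fun `[0, s[ h -> (forall t, t \in `[0, s[ -> (0 <= h t)%E) ->
  (\int[stieltjes T g]_(t in `[0%R, s[) h t =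
   \int[lebesgue_measure]_(u in [set u | 0 < u /\ hitting T g u < s]%R) h (hitting T g u))%E.
Proof.
move=> sT mh h0.
pose m : {measure set (measurableTypeR R) -> \bar R} :=
  pushforward lebesgue_measure (phi : measurableTypeR R -> measurableTypeR R).
have E : phi @^-1` `[0, s[ = [set u | 0 < u /\ hitting T g u < s].
  apply/seteqP; split => u /=; rewrite /phi in_itv/=; case: ifPn => // u0.
  - by move=> /andP[].
  - by rewrite ltNge sT andbF.
  - by move=> [_ ->]; rewrite andbT; case/andP: (hitting_itv T_gt0 g u).
  - by case.
rewrite (eq_measure_integral (m measurable_phi)); last first.
  move=> A mA As; rewrite [LHS]stieltjesE// /m /pushforward/=; congr (lebesgue_measure _).
  apply/setIidPl => u /= /As; rewrite -[`[0, s[%classic (phi u)]/((phi @^-1` `[0, s[) u) E.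
  by move=> [u0 us]; split => //; exact: lt_le_trans sT.
rewrite /m ge0_integral_pushforward//; last by move=> t; rewrite inE; exact: h0.
rewrite /= E; apply: eq_integral => u; rewrite inE => -[u0 _].
by rewrite /= /phi u0.
Qed.

End time_change.

(** * Stieltjes measures of sums, multiples and jumps *)

Section stieltjes_operations.
Context {R : realType} (T : R) (T_gt0 : 0 < T).
Implicit Types g : R -> R.

Let nd g := {in `[0, T] &, {homo g : x y / x <= y}}.

Let ndD g1 g2 a : nd g1 -> nd g2 -> 0 <= a -> nd (fun t => g1 t + a * g2 t).
Proof.
by move=> ndg1 ndg2 a0 x y xT yT xy; rewrite lerD ?ndg1// ler_wpM2l// ndg2.
Qed.

(** Inside [0, T[ both sides are the limit from the right of the same function; outside,
    [right_limit] takes the end values of the path, which add up. *)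
Lemma right_limitD g1 g2 (a t : R) : nd g1 -> nd g2 -> 0 <= a ->
  right_limit T (fun t => g1 t + a * g2 t) t =
  right_limit T g1 t + a * right_limit T g2 t.
Proof.
move=> nd1 nd2 a0; have nd12 := ndD nd1 nd2 a0.
have [t0|t0] := ltP t 0; first by rewrite !right_limit_lt0.
have [tT|Tt] := ltP t T; last by rewrite !right_limit_geT.
have A := right_limit_cvg nd12 t0 tT.
have B : g1 s + a * g2 s @[s --> t^'+] --> right_limit T g1 t + a * right_limit T g2 t.
  by apply: cvgD; [|apply: cvgMr]; exact: right_limit_cvg.
exact: (cvg_unique _ A B).
Qed.

Lemma integral_stieltjesD g1 g2 (a : {nonneg R}) (D : set R) (h : R -> \bar R) :
  nd g1 -> nd g2 -> measurable D -> measurable_fun D h ->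
  (forall t, D t -> (0 <= h t)%E) ->
  (\int[stieltjes T (fun t => g1 t + a%:num * g2 t)%R]_(t in D) h t =
   \int[stieltjes T g1]_(t in D) h t + a%:num%:E * \int[stieltjes T g2]_(t in D) h t)%E.
Proof.
move=> nd1 nd2 mD mh h0.
rewrite -[in RHS](ge0_integral_mscale (stieltjes T g2) mD a mh h0).
rewrite -ge0_integral_measure_add//.
apply: eq_measure_integral => A mA _.
apply: (@lebesgue_stieltjes_measure_unique _ _
  (measure_add (stieltjes T g1) (mscale a (stieltjes T g2)))) => // X.
move=> /ocitvP[->|[x /ltW x12 ->]]; first by rewrite !measure0.
apply: (etrans _ (esym (measure_addE _ _ _))).
transitivity (stieltjes T g1 `]x.1, x.2]%classic +
  a%:num%:E * stieltjes T g2 `]x.1, x.2]%classic)%E; last by [].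
rewrite !stieltjes_ocitv// -EFinM -EFinD; congr (_%:E).
by rewrite !right_limitD//; ring.
Qed.

Lemma integral_stieltjesZ g (a : {nonneg R}) (D : set R) (h : R -> \bar R) :
  nd g -> measurable D -> measurable_fun D h ->
  (forall t, D t -> (0 <= h t)%E) ->
  (\int[stieltjes T (fun t => a%:num * g t)%R]_(t in D) h t =
   a%:num%:E * \int[stieltjes T g]_(t in D) h t)%E.
Proof.
move=> ndg mD mh h0.
rewrite -[in RHS](ge0_integral_mscale (stieltjes T g) mD a mh h0).
apply: eq_measure_integral => A mA _.
apply: (@lebesgue_stieltjes_measure_unique _ _ (mscale a (stieltjes T g))) => // X.
move=> /ocitvP[->|[x /ltW x12 ->]]; first by rewrite !measure0.
transitivity (a%:num%:E * stieltjes T g `]x.1, x.2]%classic)%E; last by [].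
rewrite !stieltjes_ocitv// -EFinM; congr (_%:E).
have nd0 : nd (fun=> 0) by [].
have r0 t : right_limit T (fun=> 0) t = 0.
  have [t0|t0] := ltP t 0; first by rewrite right_limit_lt0.
  by apply/eqP; rewrite eq_le (le_trans (right_limit_leT T_gt0 nd0 _))// right_limit_ge_init.
have E t : right_limit T (fun t => a%:num * g t) t = a%:num * right_limit T g t.
  have := right_limitD t nd0 ndg (ge0 a); rewrite r0 add0r => <-.
  by congr right_limit; apply/funext => s; rewrite add0r.
by rewrite !E mulrBr.
Qed.

(** A unit investment at time r. The strict inequality makes it left-continuous; the induced measure
    is the Dirac mass at r when 0 <= r < T, and null when r = T. *)
Definition jump (r t : R) : R := (r < t)%R%:R.

Lemma jump_nd (r : R) : {homo jump r : x y / x <= y}.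
Proof.
move=> x y xy; rewrite /jump; case: ltP => //= rx.
by rewrite (lt_le_trans rx).
Qed.

Lemma right_limit_jump (r t : R) : 0 <= r -> r < T ->
  right_limit T (jump r) t = (r <= t)%R%:R.
Proof.
move=> r0 rT; have ndr : nd (jump r) by move=> x y _ _; exact: jump_nd.
have [t0|t0] := ltP t 0.
  by rewrite right_limit_lt0// /jump ltNge r0 leNgt (lt_le_trans t0).
have [tT|Tt] := ltP t T; last first.
  by rewrite right_limit_geT// /jump rT (le_trans (ltW rT)).
suff B : jump r s @[s --> t^'+] --> ((r <= t)%R%:R : R).
  exact: (cvg_unique _ (right_limit_cvg ndr t0 tT) B).
apply: cvg_near_cst; have [rt|tr] := leP r t.
  by near=> s; rewrite /jump (le_lt_trans rt)//; near: s; exact: nbhs_right_gt.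
near=> s; rewrite /jump ltNge ltW//=; near: s; exact: nbhs_right_lt.
Unshelve. all: end_near. Qed.

Lemma integral_jump (r : R) (h : R -> \bar R) (D : set R) : 0 <= r <= T ->
  measurable D -> measurable_fun D h -> D `<=` `[0, T[ ->
  (\int[stieltjes T (jump r)]_(t in D) h t = (\1_D r)%:E * h r)%E.
Proof.
move=> /andP[r0 rT] mD mh DT; have ndr : nd (jump r) by move=> x y _ _; exact: jump_nd.
have {rT} [rT|<-] : r < T \/ T = r by case: ltgtP rT => // + _; [left|right].
  pose dr := @dirac _ (measurableTypeR R) r R.
  transitivity (\int[dr]_(t in D) h t)%E; last by rewrite integral_dirac.
  apply: (eq_measure_integral dr) => A mA _.
  apply: (@lebesgue_stieltjes_measure_unique _ _ dr) => // X.
  move=> /ocitvP[->|[x /ltW x12 ->]]; first by rewrite !measure0.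
  rewrite stieltjes_ocitv// /dr /= diracE !right_limit_jump//; congr (_%:E).
  rewrite mem_setE in_itv/= ltNge; case: leP => rx2; last first.
    by rewrite leNgt (le_lt_trans x12 rx2) subrr andbF.
  by case: leP => _ /=; rewrite ?subrr ?subr0.
(* Here r = T: [jump T] vanishes on [0, T], so its measure is null, and T is outside D, so the
   right-hand side is 0 too. *)
rewrite indicE memNset ?mul0e; last by move=> /DT/=; rewrite in_itv/= ltxx andbF.
rewrite (eq_measure_integral mzero) ?integral_measure_zero// => A mA _.
apply: (@lebesgue_stieltjes_measure_unique _ _ mzero) => // X.
move=> /ocitvP[->|[x /ltW x12 ->]]; first by rewrite !measure0.
rewrite stieltjes_ocitv//.
have r0' t : right_limit T (jump T) t = 0.
  have ndT : nd (jump T) by move=> x' y' _ _; exact: jump_nd.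
  apply/eqP; rewrite eq_le; apply/andP; split.
    by rewrite (le_trans (right_limit_leT T_gt0 ndT _))// /jump ltxx.
  by rewrite (le_trans _ (right_limit_ge_init _ _ _))// /jump ler0n.
by rewrite !r0' subrr.
Qed.

End stieltjes_operations.

(** * Filtrations and stopping times *)

Section joint_measurability.
Context d (Omega : measurableType d) (R : realType) (T : R).

Definition strip : set (R * Omega) := [set sw | sw.1 \in `[0, T]].

Lemma stripE : strip = `[0, T] `*` setT.
Proof. by apply/seteqP; split => -[s w] //= []. Qed.

Lemma measurable_strip : measurable strip.
Proof. by rewrite stripE; exact: measurableX. Qed.

(** Limit of the processes that read X at the next grid point, to the right of the current time:
    each of them is constant in time on every cell, and right continuity gives the convergence. *)
Lemma measurable_right_continuous (X : R -> Omega -> R) : 0 < T ->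
  (forall t, t \in `[0, T] -> measurable_fun setT (X t)) ->
  (forall w t, t \in `[0, T[ -> X s w @[s --> t^'+] --> X t w) ->
  measurable_fun strip (fun sw => X sw.1 sw.2).
Proof.
move=> T0 mX rcX.
(* The cap keeps the grid inside [0, T], where X is measurable. At time T it returns T itself, so
   nothing is asked of X beyond T. *)
pose grid n k : R := Num.min T (k.+1%:R / n.+1%:R).
pose h n (sw : R * Omega) := X (grid n (Num.truncn (n.+1%:R * sw.1))) sw.2.
have gridP n s : 0 <= s -> s < T -> s < grid n (Num.truncn (n.+1%:R * s)) <= s + n.+1%:R^-1.
  move=> s0 sT; have /truncn_itv/andP[k1 k2] : 0 <= n.+1%:R * s by rewrite mulr_ge0.
  rewrite lt_min sT/= ltr_pdivlMr// (mulrC s) k2/= ge_min; apply/orP; right.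
  by rewrite ler_pdivrMr// mulrDl mulVf// -natr1 lerD2r (mulrC s).
apply: (@measurable_fun_cvg _ _ _ _ h) => [n|[s w] /= sT].
- move=> mD B mB.
  rewrite (_ : _ `&` _ = \bigcup_k ((`[0, T] `&` `[k%:R / n.+1%:R, k.+1%:R / n.+1%:R[) `*`
      (X (grid n k) @^-1` B))); last first.
    apply/seteqP; split => [[s w] /= [sT Bs]|[s w] /= [k _ [/= [sT +] Bs]]].
      exists (Num.truncn (n.+1%:R * s)) => //; split => //; split => //=.
      rewrite in_itv/= ler_pdivrMr// ltr_pdivlMr// (mulrC s).
      by apply: truncn_itv; rewrite mulr_ge0//; move: sT; rewrite /strip/= in_itv/= => /andP[].
    rewrite in_itv/= ler_pdivrMr// ltr_pdivlMr// (mulrC s) => skn; split => //.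
    by rewrite /h /= (@truncn_def _ _ k).
  apply: bigcup_measurable => k _; apply: measurableX; first exact: measurableI.
  rewrite -[X in measurable X]setTI; apply: mX => //.
  by rewrite in_itv/= le_min (ltW T0)/= divr_ge0//= ge_min lexx.
- move: sT; rewrite /strip/= in_itv/= => /andP[s0]; rewrite le_eqVlt => /predU1P[->|sT].
    apply: cvg_near_cst; near=> n.
    rewrite /h /= /grid (min_idPl _)// ler_pdivlMr// mulrC ltW//.
    by have /andP[_] : (Num.truncn (n.+1%:R * T))%:R <= n.+1%:R * T < (Num.truncn (n.+1%:R * T)).+1%:R
      by apply: truncn_itv; rewrite mulr_ge0// ltW.
  apply/cvgrPdist_lt => e e0.
  have /cvgrPdist_lt/(_ e e0)[r /= r0 Hr] : X u w @[u --> s^'+] --> X s w.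
    by apply: rcX; rewrite in_itv/= s0.
  near=> n; rewrite /h /=; apply: Hr => /=; last by case/andP: (gridP n s s0 sT).
  have /andP[g1 g2] := gridP n s s0 sT.
  rewrite ltr0_norm ?subr_lt0// opprB ltrBlDl (le_lt_trans g2)// ltrD2l.
  near: n; exact: near_infty_natSinv_lt (PosNum r0).
Unshelve. all: end_near. Qed.

(** Tonelli for the function equal to X s w on 0 <= s <= t and to 0 elsewhere: integrating s out
    leaves a measurable function of (t, w). *)
Lemma measurable_primitive (a : R) (X : R -> Omega -> R) :
  (forall t w, t \in `[0, a] -> 0 <= X t w) ->
  measurable_fun [set sw : R * Omega | sw.1 \in `[0, a]] (fun sw => X sw.1 sw.2) ->
  measurable_fun [set sw : R * Omega | sw.1 \in `[0, a]]
    (fun sw => \int[lebesgue_measure]_(s in `[0, sw.1]) X s sw.2).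
Proof.
move=> X0 mX.
have mS : measurable [set sw : R * Omega | sw.1 \in `[0, a]].
  rewrite (_ : [set _ | _] = `[0, a] `*` setT); first exact: measurableX.
  by apply/seteqP; split => -[s w] //= [].
pose Y (sw : R * Omega) : R := if sw.1 \in `[0, a] then X sw.1 sw.2 else 0.
have mY : measurable_fun setT Y.
  have -> : Y = (fun sw => X sw.1 sw.2) \_ [set sw : R * Omega | sw.1 \in `[0, a]].
    apply/funext => -[s w]; rewrite /Y /patch/=.
    by case: ifPn => sa; [rewrite mem_set|rewrite memNset//; exact/negP].
  exact/(measurable_restrictT _ mS).
pose f (p : (R * Omega) * measurableTypeR R) : \bar R :=
  (if (0 <= p.2) && (p.2 <= p.1.1) then Y (p.2, p.1.2) else 0)%:E.
have mf : measurable_fun setT f.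
  apply/measurable_EFinP; apply: measurable_fun_ifT.
  - apply: measurable_and; apply: measurable_fun_ler => //.
    by apply: measurableT_comp; exact: measurable_fst.
  - apply: measurableT_comp => //; apply: measurable_fun_pair; first exact: measurable_snd.
    by apply: measurableT_comp; [exact: measurable_snd|exact: measurable_fst].
  - exact: measurable_cst.
have f0 p : (0 <= f p)%E.
  by rewrite /f lee_fin; case: ifPn => // _; rewrite /Y; case: ifPn => // /X0.
have := measurable_fun_fubini_tonelli_F (m2 := lebesgue_measure) f mf f0.
move=> /(measurableT_comp (fine_measurable measurableT)) => mF.
apply: (eq_measurable_fun _ _ (measurable_funS measurableT (@subsetT _ _) mF)) => -[t w].
rewrite inE/= in_itv/= => /andP[t0 ta]; rewrite /fubini_F /Rintegral; congr fine.
rewrite [RHS]integral_mkcond; apply: eq_integral => s _.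
rewrite /f /patch /= mem_setE in_itv/=; case: ifPn => // /andP[s0 st].
by rewrite /Y/= in_itv/= s0 (le_trans st).
Qed.

End joint_measurability.

Section usual.
Context d (Omega : measurableType d) (R : realType).
Variables (P : probability Omega R) (T : R).

(** Right continuity is asked with s in ]t, T] only, because adaptedness gives information at times
    in [0, T] only. *)
Record usual_conditions (Ft : R -> set (set Omega)) : Prop := UsualConditions {
  usual_sigma_algebra : forall t, sigma_algebra setT (Ft t) ;
  usual_mono : forall s t, s <= t -> Ft s `<=` Ft t ;
  usual_measurable : forall t A, Ft t A -> measurable A ;
  usual_right : forall t A, t < T -> (forall s, t < s -> s <= T -> Ft s A) -> Ft t A ;
  usual_null : forall t A, P.-negligible A -> Ft t A }.

Lemma augmented_filtration_usual (X : R -> Omega -> R) :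
  measure_is_complete P ->
  (forall t : R, t \in `[0, T] -> measurable_fun setT (X t)) ->
  usual_conditions (augmented_filtration P T X).
Proof.
move=> Pc mX; split.
- move=> t; split.
  + by move=> s _; have [] := smallest_sigma_algebra setT (cylinders T X s `|` P.-negligible).
  + move=> A FA s ts; have [_ + _] := smallest_sigma_algebra setT (cylinders T X s `|` P.-negligible).
    by apply; exact: FA.
  + move=> A FA s ts; have [_ _] := smallest_sigma_algebra setT (cylinders T X s `|` P.-negligible).
    by apply => i; exact: FA.
- by move=> s t st A FA r tr; apply: FA; exact: le_lt_trans tr.
- move=> t A /(_ (t + 1)); rewrite /= ltrDl => /(_ ltr01).
  apply: smallest_sub; first exact: sigma_algebra_measurable.
  move=> B [[s [sT st]]|]; last exact: Pc.
  by move=> [C mC <-]; exact: mX.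
- move=> t A tT FA s ts.
  (* A time strictly between t and s that does not exceed T, so that the assumption on A applies to
     it; s itself may exceed T. *)
  pose r := Num.min T ((t + s) / 2).
  apply: (FA r _ _ s) => /=.
  + by rewrite lt_min tT/= ltr_pdivlMr// mulrDr mulr1 ltrD2l.
  + by rewrite ge_min lexx.
  + by rewrite gt_min; apply/orP; right; rewrite ltr_pdivrMr// mulrDr mulr1 ltrD2r.
- by move=> t A NA s ts; apply: sub_sigma_algebra; right.
Qed.

Section filtration.
Variables (Ft : R -> set (set Omega)) (T_gt0 : 0 < T).
Hypothesis uFt : usual_conditions Ft.

(** The same points with the smaller sigma-algebra: adaptedness becomes measurability of functions
    on [filtered t]. *)
Definition filtered (t : R) : Type := g_sigma_algebraType (Ft t).
HB.instance Definition _ t := Measurable.on (filtered t).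

Lemma usual_measurableE (t : R) (A : set Omega) :
  measurable (A : set (filtered t)) = Ft t A.
Proof.
rewrite -[RHS](_ : <<s Ft t >> A = _)//; rewrite sigma_algebra_id//.
exact: usual_sigma_algebra.
Qed.

Lemma usual_T (t : R) : Ft t setT.
Proof. by rewrite -usual_measurableE; exact: measurableT. Qed.

Lemma usual_C (t : R) A : Ft t A -> Ft t (~` A).
Proof. by rewrite -!usual_measurableE; exact: measurableC. Qed.

Lemma usual_I (t : R) A B : Ft t A -> Ft t B -> Ft t (A `&` B).
Proof. by rewrite -!usual_measurableE; exact: measurableI. Qed.

Lemma usual_bigcup (t : R) (A : nat -> set Omega) :
  (forall n, Ft t (A n)) -> Ft t (\bigcup_n A n).
Proof.
move=> FA; rewrite -usual_measurableE; apply: bigcup_measurable => n _.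
by rewrite usual_measurableE.
Qed.

Lemma measurable_filtered (s t : R) : s <= t ->
  measurable_fun setT (id : filtered t -> filtered s).
Proof.
move=> st _ A; rewrite setTI => mA.
rewrite [X in measurable X](_ : _ = A)// usual_measurableE.
by apply: (usual_mono uFt st); rewrite -usual_measurableE.
Qed.

Lemma filtered_measurable (t : R) : measurable_fun setT (id : Omega -> filtered t).
Proof.
move=> _ A; rewrite setTI => mA.
by apply: (usual_measurable uFt (t := t)); rewrite -usual_measurableE.
Qed.

Lemma adapted_measurable (X : R -> Omega -> R) (s t : R) : adapted T Ft X ->
  s \in `[0, T] -> s <= t -> measurable_fun setT (X s : filtered t -> R).
Proof.
move=> aX sT st _ B mB; rewrite setTI usual_measurableE.
by apply: (usual_mono uFt st); exact: aX.
Qed.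

Lemma adapted_measurableT (X : R -> Omega -> R) (s : R) : adapted T Ft X ->
  s \in `[0, T] -> measurable_fun setT (X s).
Proof.
move=> aX sT _ B mB; rewrite setTI.
by apply: (usual_measurable uFt (t := s)); exact: aX.
Qed.

Lemma progressive_measurable (X : R -> Omega -> R) : progressive T Ft X ->
  measurable_fun (strip (Omega:=Omega) T) (fun sw => X sw.1 sw.2).
Proof.
move=> pX; have T0 : T \in `[0, T] by rewrite in_itv/= lexx ltW.
have := pX T T0; set f := (fun sw => _) => mf.
pose i (sw : R * Omega) : measurableTypeR R * filtered T := (sw.1, sw.2).
apply: (measurable_comp (F := [set sw | sw.1 \in `[0, T]]) (g := i) _ _ mf).
- rewrite (_ : [set _ | _] = `[0, T] `*` setT); first exact: measurableX.
  by apply/seteqP; split => -[s w] //= [].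
- by move=> _ [sw ? <-].
- apply: measurable_funTS; apply: measurable_fun_pair; first exact: measurable_fst.
  exact (measurableT_comp (@filtered_measurable T)
    (measurable_snd : measurable_fun setT (snd : R * Omega -> Omega))).
Qed.

(** The generators of the optional sigma-algebra come from right-continuous adapted processes, which
    are jointly measurable. Joint measurability is what Tonelli asks of the supergradient. *)
Lemma optional_measurable (G : R -> Omega -> \bar R) : optional T Ft G ->
  measurable_fun (strip (Omega:=Omega) T) (fun sw => G sw.1 sw.2).
Proof.
move=> oG _ B mB; rewrite (_ : _ `&` _ = [set sw | sw.1 \in `[0, T] /\ B (G sw.1 sw.2)])//.
have := oG B mB; apply: smallest_sub.
  split => //; first by move=> A mA; apply: measurableD => //; exact: measurable_strip.
  by move=> A mA; exact: bigcup_measurable.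
move=> _ [X [C [aX cX mC ->]]].
rewrite [X in measurable X](_ : _ = strip (Omega:=Omega) T `&` (fun sw => X sw.1 sw.2) @^-1` C)//.
apply: measurable_right_continuous => //; last exact: measurable_strip.
  by move=> t; exact: adapted_measurableT.
by move=> w t; case: (cX w) => + _; exact.
Qed.

Section hitting_times.
Variable nu : R -> Omega -> R.
Hypothesis nu_nd : forall w, {in `[0, T] &, {homo nu ^~ w : s t / s <= t}}.
Hypothesis nu_adapted : adapted T Ft nu.

Definition hit (u : R) (w : Omega) : R := hitting T (nu ^~ w) u.

(** nu(s+) is the limit of nu along times that decrease to s inside ]s, t], all of them known at
    time t. *)
Lemma measurable_right_limit (s t : R) : 0 <= s -> s < t -> t <= T ->
  measurable_fun setT ((fun w => right_limit T (nu ^~ w) s) : filtered t -> R).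
Proof.
move=> s0 st tT.
pose r n : R := s + (t - s) / n.+1%:R.
have r_itv n : s < r n <= t.
  rewrite ltrDl divr_gt0 ?subr_gt0//= -lerBrDl ler_pdivrMr// ler_peMr ?ler1n//.
  by rewrite subr_ge0 ltW.
apply: (@measurable_fun_cvg _ (filtered t) R setT (fun n w => nu (r n) w)) => [n|w _].
  have /andP[sr rt] := r_itv n; apply: adapted_measurable => //.
  by rewrite in_itv/= (le_trans rt)// andbT (le_trans s0)// ltW.
have := right_limit_cvg (nu_nd w) s0 (lt_le_trans st tT).
move=> /cvgrPdist_lt rc; apply/cvgrPdist_lt => e e0.
have [q /= q0 Hq] := rc e e0.
have qts0 : 0 < q / (t - s) by rewrite divr_gt0// subr_gt0.
near=> n; apply: Hq => /=; last by case/andP: (r_itv n).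
rewrite /r opprD addrA subrr sub0r normrN ger0_norm; last first.
  by rewrite divr_ge0// subr_ge0 ltW.
rewrite mulrC -ltr_pdivlMr ?subr_gt0//.
near: n; exact: near_infty_natSinv_lt (PosNum qts0).
Unshelve. all: end_near. Qed.

Lemma hit_itv u w : 0 <= hit u w <= T.
Proof. exact: hitting_itv. Qed.

Lemma hit_le u w t : 0 <= t -> t < T ->
  (hit u w <= t) = (u <= right_limit T (nu ^~ w) t - nu 0 w).
Proof. exact: hitting_le. Qed.

(** Whether level u is hit by time t depends on nu(t+), which is known only immediately after t;
    right continuity of the filtration brings the event back to time t. At t = T the event is
    everything. *)
Lemma hit_stopping u : stopping_time P T Ft (hit u).
Proof.
split; last by apply: aeW => w; exact: hitting_itv.
move=> t; rewrite in_itv/= => /andP[t0]; rewrite le_eqVlt => /predU1P[->|tT].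
  rewrite (_ : [set _ | _] = setT); first exact: usual_T.
  by apply/seteqP; split => // w _ /=; case/andP: (hit_itv u w).
apply: (usual_right uFt) => // s ts sT.
rewrite -usual_measurableE (_ : [set _ | _] = setT `&`
    (fun w => right_limit T (nu ^~ w) t - nu 0 w) @^-1` `[u, +oo[); last first.
  by apply/seteqP; split => w /=; rewrite hit_le// in_itv/= andbT // => -[].
have m : measurable_fun setT ((fun w => right_limit T (nu ^~ w) t - nu 0 w) : filtered s -> R).
  apply: measurable_funB; first exact: measurable_right_limit.
  apply: adapted_measurable => //; last by rewrite (le_trans t0)// ltW.
  by rewrite in_itv/= lexx ltW.
exact: m.
Qed.

(** By [hit_le], hitting after t means that the level u exceeds a random variable, a measurable
    condition on the pair (u, w). *)
Lemma measurable_hit : measurable_fun setT (fun uw : R * Omega => hit uw.1 uw.2).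
Proof.
apply: (measurability (@RGenOInfty.G R)) => [|/= _ [_] [t] -> <-].
  exact: RGenOInfty.measurableE.
have [t0|t0] := ltP t 0.
  rewrite (_ : _ `&` _ = setT)//; apply/seteqP; split => // -[u w] _; split => //=.
  by rewrite in_itv/= andbT (lt_le_trans t0)//; case/andP: (hit_itv u w).
have [tT|Tt] := ltP t T; last first.
  rewrite (_ : _ `&` _ = set0)//; apply/seteqP; split => // -[u w] [_ /=].
  rewrite in_itv/= andbT ltNge; case/andP: (hit_itv u w) => _ uT.
  by rewrite (le_trans uT).
rewrite (_ : _ `&` _ = setT `&`
  (fun uw : R * Omega => right_limit T (nu ^~ uw.2) t - nu 0 uw.2 < uw.1) @^-1` [set true]).
  have m : measurable_fun setT
      (fun uw : R * Omega => right_limit T (nu ^~ uw.2) t - nu 0 uw.2 < uw.1).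
    apply: measurable_fun_ltr => //.
    apply: (measurableT_comp (f := fun w => right_limit T (nu ^~ w) t - nu 0 w)) => //.
    apply: measurable_funB; last by apply: adapted_measurableT; rewrite // in_itv/= lexx ltW.
    have := measurable_right_limit t0 tT (lexx T).
    by move=> /measurableT_comp /(_ (@filtered_measurable T)).
  exact: m.
apply/seteqP; split => -[u w] /= [_].
  by rewrite in_itv/= andbT ltNge hit_le// -ltNge.
by rewrite ltNge -hit_le// -ltNge in_itv/= andbT.
Qed.

End hitting_times.

Section stopped.
Variable tau : Omega -> R.
Hypothesis tau_st : stopping_time P T Ft tau.

Lemma stopping_lt (t : R) : 0 <= t <= T -> (forall w, 0 <= tau w) ->
  Ft t [set w | tau w < t].
Proof.
move=> /andP[t0 tT] tau0; have [->|tn0] := eqVneq t 0.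
  rewrite (_ : [set _ | _] = set0) -?usual_measurableE//.
  by apply/seteqP; split => // w /=; rewrite ltNge tau0.
have {tn0}t0' : 0 < t by rewrite lt_neqAle eq_sym tn0.
rewrite (_ : [set _ | _] = \bigcup_n [set w | tau w <= t - t / n.+1%:R]); last first.
  apply/seteqP; split => [w /= wt|w [n _ /=]]; last first.
    by move=> wt; rewrite (le_lt_trans wt)// ltrBlDr ltrDl divr_gt0.
  have e0 : 0 < (t - tau w) / t by rewrite divr_gt0// subr_gt0.
  have [n _ /(_ n (leqnn n))] := near_infty_natSinv_lt (PosNum e0).
  rewrite /= ltr_pdivlMr// mulrC => nt; exists n => //=.
  by rewrite lerBrDl -lerBrDr ltW// opprK addrC.
apply: usual_bigcup => n; apply: (usual_mono uFt (s := t - t / n.+1%:R)).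
  by rewrite lerBlDr lerDl divr_ge0.
apply: tau_st.1; rewrite in_itv/= subr_ge0 ler_pdivrMr// ler_peMr ?ler1n//=.
by rewrite lerBlDr (le_trans tT)// lerDl divr_ge0.
Qed.

Lemma stopping_measurable : (forall w, 0 <= tau w <= T) -> measurable_fun setT tau.
Proof.
move=> tau0T; apply: (measurability (@RGenOInfty.G R)) => [|/= _ [_] [t] -> <-].
  exact: RGenOInfty.measurableE.
rewrite setTI; have [t0|t0] := ltP t 0.
  rewrite (_ : _ @^-1` _ = setT)//; apply/seteqP; split => // w _ /=.
  by rewrite in_itv/= andbT (lt_le_trans t0)//; case/andP: (tau0T w).
have [tT|Tt] := ltP t T; last first.
  rewrite (_ : _ @^-1` _ = set0)//; apply/seteqP; split => // w /=.
  by rewrite in_itv/= andbT ltNge; case/andP: (tau0T w) => _ /le_trans ->.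
rewrite (_ : _ @^-1` _ = ~` [set w | tau w <= t]); last first.
  by apply/seteqP; split => w /=; rewrite in_itv/= andbT ltNge => /negP.
apply: measurableC; apply: (usual_measurable uFt (t := t)); apply: tau_st.1.
by rewrite in_itv/= t0 ltW.
Qed.

Lemma stopped_ltT : (forall w, 0 <= tau w <= T) ->
  stopped_sigma_algebra T Ft tau [set w | tau w < T].
Proof.
move=> tau0T; have FT : Ft T [set w | tau w < T].
  by apply: stopping_lt; [rewrite lexx ltW|move=> w; case/andP: (tau0T w)].
split => // t; rewrite in_itv/= => /andP[t0]; rewrite le_eqVlt => /predU1P[->|tT].
  rewrite setIidl// => w _ /=; by case/andP: (tau0T w).
rewrite setIidr; first by apply: tau_st.1; rewrite in_itv/= t0 ltW.
by move=> w /= /le_lt_trans; exact.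
Qed.

Lemma stopped_sub (A : set Omega) : stopped_sigma_algebra T Ft tau A -> measurable A.
Proof. by case=> /(usual_measurable uFt). Qed.

Lemma stopped_C (A : set Omega) : stopped_sigma_algebra T Ft tau A ->
  stopped_sigma_algebra T Ft tau (~` A).
Proof.
move=> [FA sA]; split; first exact: usual_C.
move=> t tT; rewrite (_ : _ `&` _ = [set w | tau w <= t] `&` ~` (A `&` [set w | tau w <= t])).
  by apply: usual_I; [exact: tau_st.1|apply: usual_C; exact: sA].
by rewrite setCI setIUr setICr setU0 setIC.
Qed.

Lemma stopped_I (A B : set Omega) : stopped_sigma_algebra T Ft tau A ->
  stopped_sigma_algebra T Ft tau B -> stopped_sigma_algebra T Ft tau (A `&` B).
Proof.
move=> [FA sA] [FB sB]; split; first exact: usual_I.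
by move=> t tT; rewrite setIIl; apply: usual_I; [exact: sA|exact: sB].
Qed.

(** The device for testing an inequality on an event: off A the time is T, where an investment has
    neither revenue nor cost. *)
Definition restrict_time (A : set Omega) (w : Omega) : R :=
  if w \in A then tau w else T.

Lemma stopping_restrict (A : set Omega) : (forall w, 0 <= tau w <= T) ->
  stopped_sigma_algebra T Ft tau A -> stopping_time P T Ft (restrict_time A).
Proof.
move=> tau0T [FA sA]; split; last first.
  by apply: aeW => w; rewrite /restrict_time; case: ifP => // _; rewrite lexx ltW.
move=> t; rewrite in_itv/= => /andP[t0]; rewrite le_eqVlt => /predU1P[->|tT].
  rewrite (_ : [set _ | _] = setT); first exact: usual_T.
  apply/seteqP; split => // w _ /=; rewrite /restrict_time; case: ifP => // _.
  by case/andP: (tau0T w).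
rewrite (_ : [set _ | _] = A `&` [set w | tau w <= t]).
  by apply: sA; rewrite in_itv/= t0 ltW.
apply/seteqP; split => w /=; rewrite /restrict_time.
  by case: ifPn => [/set_mem//|_]; rewrite leNgt tT.
by move=> [/mem_set ->].
Qed.

End stopped.

(** A stopping time lies in [0, T] only almost surely. Clipping changes it on a null set and gives
    the bounds at every w; for 0 <= t < T the event tau <= t is unchanged. *)
Lemma stopping_clip (tau : Omega -> R) : stopping_time P T Ft tau ->
  stopping_time P T Ft (fun w => Num.max 0 (Num.min (tau w) T)).
Proof.
move=> [st _]; split; last first.
  by apply: aeW => w; rewrite le_max lexx/= ge_max (ltW T_gt0)/= ge_min lexx orbT.
move=> t; rewrite in_itv/= => /andP[t0]; rewrite le_eqVlt => /predU1P[->|tT].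
  rewrite (_ : [set _ | _] = setT); first exact: usual_T.
  by apply/seteqP; split => // w _ /=; rewrite ge_max (ltW T_gt0)/= ge_min lexx orbT.
rewrite (_ : [set _ | _] = [set w | tau w <= t]); first by apply: st; rewrite in_itv/= t0 ltW.
by apply/seteqP; split => w /=; rewrite ge_max t0/= ge_min (leNgt T) tT orbF.
Qed.

End filtration.

End usual.

(** * Exponential moments of the stochastic integral *)

Section integral_complements.
Context d (X : measurableType d) (R : realType).
Variables (mu : {measure set X -> \bar R}).
Local Open Scope ereal_scope.

(** Fatou's lemma for a pointwise limit: a uniform bound on the integrals survives, without a
    dominating function. *)
Lemma integral_cvg_le (D : set X) (f : nat -> X -> \bar R) (g : X -> \bar R) (c : \bar R) :
  measurable D -> (forall n, measurable_fun D (f n)) ->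
  (forall n x, D x -> 0 <= f n x) -> (forall x, D x -> f n x @[n --> \oo] --> g x) ->
  (forall n, \int[mu]_(x in D) f n x <= c) -> \int[mu]_(x in D) g x <= c.
Proof.
move=> mD mf f0 fg fc.
have -> : \int[mu]_(x in D) g x = \int[mu]_(x in D) limn_einf (f ^~ x).
  apply: eq_integral => x /set_mem Dx; rewrite is_cvg_limn_einfE.
    by apply/esym/cvg_lim => //; exact: fg.
  by apply/cvg_ex; exists (g x); exact: fg.
apply: le_trans (fatou mu mD mf f0) _; rewrite limn_einf_lim.
apply: lime_le; first exact: is_cvg_einfs.
apply: nearW => n; apply: ge_ereal_inf; exists (\int[mu]_(x in D) f n x); last exact: fc.
by exists n => //=.
Qed.

(** The limit holds only almost everywhere, so g is first replaced by the lower limit, which is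
    measurable and equals g off a null set. *)
Lemma integral_ae_cvg_le (D : set X) (f : nat -> X -> \bar R) (g : X -> \bar R) (c : \bar R) :
  measurable D -> (forall n, measurable_fun D (f n)) -> measurable_fun D g ->
  (forall n x, D x -> 0 <= f n x) -> (forall x, D x -> 0 <= g x) ->
  {ae mu, forall x, D x -> f n x @[n --> \oo] --> g x} ->
  (forall n, \int[mu]_(x in D) f n x <= c) -> \int[mu]_(x in D) g x <= c.
Proof.
move=> mD mf mg f0 g0 fg fc.
pose l x := limn_einf (f ^~ x).
have ml : measurable_fun D l.
  rewrite (_ : l = (fun x => - limn_esup ((fun n y => - f n y) ^~ x))); last first.
    by apply/funext => x; rewrite /l -limn_einfN; congr limn_einf; apply/funext => n /=; rewrite oppeK.
  by apply: measurableT_comp => //; apply: measurable_fun_limn_esup => n; exact: measurableT_comp.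
have -> : \int[mu]_(x in D) g x = \int[mu]_(x in D) l x.
  apply: ge0_ae_eq_integral => //.
    move=> x Dx; rewrite /l limn_einf_lim; apply: lime_ge; first exact: is_cvg_einfs.
    by apply: nearW => n; apply: le_ereal_inf_tmp => _ [m _ <-]; exact: f0.
  move: fg; apply: filterS => x fg Dx; rewrite /l is_cvg_limn_einfE.
    by apply/esym/cvg_lim => //; exact: fg.
  by apply/cvg_ex; exists (g x); exact: fg.
apply: le_trans (fatou mu mD mf f0) _; rewrite limn_einf_lim.
apply: lime_le; first exact: is_cvg_einfs.
apply: nearW => n; apply: ge_ereal_inf; exists (\int[mu]_(x in D) f n x); last exact: fc.
by exists n => //=.
Qed.

Import HBNNSimple.

(** From indicators to simple functions by linearity, then to f by monotone convergence. It turns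
    Gaussian expectations into Lebesgue integrals. *)
Lemma integral_density (m : {measure set X -> \bar R}) (g : X -> R) :
  measurable_fun setT g -> (forall x, (0 <= g x)%R) ->
  (forall A, measurable A -> m A = \int[mu]_(x in A) (g x)%:E) ->
  forall f : X -> \bar R, measurable_fun setT f -> (forall x, 0 <= f x) ->
  \int[m]_x f x = \int[mu]_x (f x * (g x)%:E).
Proof.
move=> mg g0 mE f mf f0.
have mgE : measurable_fun setT (EFin \o g) by exact/measurable_EFinP.
have g0E x : 0 <= (g x)%:E by rewrite lee_fin.
have indic A : measurable A -> \int[m]_x (\1_A x)%:E = \int[mu]_x ((\1_A x)%:E * (g x)%:E).
  move=> mA; rewrite integral_indic// setIT mE// integral_mkcond.
  apply: eq_integral => x _; rewrite /patch indicE; case: ifPn => xA.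
    by rewrite mul1e.
  by rewrite mul0e.
have simple (h : {nnsfun X >-> R}) : \int[m]_x (h x)%:E = \int[mu]_x ((h x)%:E * (g x)%:E).
  under [LHS]eq_integral do rewrite fimfunE -fsumEFin//.
  rewrite [LHS]ge0_integral_fsum//; last 2 first.
  - by move=> r; exact/measurable_EFinP/measurableT_comp.
  - by move=> n x _; rewrite EFinM nnfun_muleindic_ge0.
  under [RHS]eq_integral.
    move=> x xD; rewrite fimfunE -fsumEFin// muleC ge0_mule_fsumr; last first.
      by move=> r; rewrite EFinM nnfun_muleindic_ge0.
    over.
  rewrite [RHS]ge0_integral_fsum//; last 2 first.
  - move=> r; apply: emeasurable_funM => //.
    by apply/measurable_EFinP; apply: measurable_funM => //.
  - by move=> n x _; rewrite mule_ge0// EFinM nnfun_muleindic_ge0.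
  apply: eq_fsbigr => r; rewrite inE => -[y _ yr].
  have r0 : (0 <= r)%R by rewrite -yr.
  transitivity (r%:E * \int[m]_x (\1_(h @^-1` [set r]) x)%:E).
    rewrite -ge0_integralZl//; first exact/measurable_EFinP.
  rewrite indic// -ge0_integralZl//.
  - by apply: eq_integral => x _; rewrite EFinM muleA [LHS]muleC.
  - by apply: emeasurable_funM => //; exact/measurable_EFinP.
  - by move=> x _; rewrite mule_ge0// lee_fin.
pose f_ := nnsfun_approx measurableT mf.
transitivity (limn (fun n => \int[m]_x (f_ n x)%:E)).
  rewrite -monotone_convergence//=.
  - apply: eq_integral => x _; apply/esym/cvg_lim => //=.
    exact: cvg_nnsfun_approx.
  - by move=> n; exact/measurable_EFinP/measurable_funTS.
  - by move=> n ? _; rewrite lee_fin.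
  - by move=> ? _ ? ? mn; rewrite lee_fin; exact/lefP/nd_nnsfun_approx.
transitivity (limn (fun n => \int[mu]_x ((f_ n x)%:E * (g x)%:E))).
  by congr (limn _); apply/funext => n; exact: simple.
rewrite -monotone_convergence//=.
- apply: eq_integral => x _; apply/cvg_lim => //=.
  under eq_fun do rewrite muleC.
  rewrite muleC; apply: cvgeZl => //; exact: cvg_nnsfun_approx.
- move=> n; apply: emeasurable_funM => //; exact/measurable_EFinP/measurable_funTS.
- by move=> n x _; rewrite mule_ge0// lee_fin.
- by move=> x _ a b ab; rewrite lee_wpmul2r// lee_fin; exact/lefP/nd_nnsfun_approx.
Qed.

End integral_complements.

Section gaussian.
Context {R : realType}.

(** Completing the square: the factor exp(c x - c^2 h / 2) turns the density of N(0, h) into that of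
    N(c h, h). *)
Lemma normal_exponential (h c : R) : 0 < h ->
  (\int[normal_prob 0 (Num.sqrt h)]_x (expR (c * x - c ^+ 2 * h / 2))%:E = 1)%E.
Proof.
move=> h0; have s0 : Num.sqrt h != 0 by rewrite gt_eqF// sqrtr_gt0.
rewrite (@integral_density _ _ _ lebesgue_measure _ (normal_pdf 0 (Num.sqrt h))) //=.
- rewrite -(integral_normal_pdf (c * h) (Num.sqrt h)).
  apply: eq_integral => x _; rewrite -EFinM; congr (_%:E).
  rewrite !normal_pdfE// mulrCA; congr (_ * _); rewrite /normal_fun -expRD; congr expR.
  have -> : Num.sqrt h ^+ 2 = h by rewrite sqr_sqrtr// ltW.
  have hn0 : h != 0 by rewrite gt_eqF.
  by rewrite subr0 mulr2n; field.
- exact: measurable_normal_pdf.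
- by move=> x; exact: normal_pdf_ge0.
- apply/measurable_EFinP; apply: measurableT_comp => //.
  by apply: measurable_funB => //; exact: measurable_funM.
Qed.

End gaussian.

Lemma within_continuous_right (R : realType) (T : R) (f : R -> R) (t : R) :
  {within `[0, T], continuous f} -> 0 <= t -> t < T -> f x @[x --> t^'+] --> f t.
Proof.
move=> cf t0 tT; have T0 : 0 < T by exact: le_lt_trans tT.
have /(continuous_within_itvP _ T0)[ci c0 _] := cf.
move: t0; rewrite le_eqVlt => /predU1P[<-//|t0].
by apply: cvg_at_right_filter; apply: ci; rewrite in_itv/= t0.
Qed.

(** * Brownian increments and integrals of simple processes *)

Section brownian.
Context d (Omega : measurableType d) (R : realType).
Variables (P : probability Omega R) (T : R) (W : R -> Omega -> R).
Hypothesis T_gt0 : 0 < T.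
Hypothesis P_complete : measure_is_complete P.
Hypothesis W_brownian : brownian_motion P T W.

Let Ft := augmented_filtration P T W.

Let uFt : usual_conditions P T Ft.
Proof.
apply: augmented_filtration_usual => // t tT; exact: brownian_measurable W_brownian _ _.
Qed.

Let F (t : R) := filtered Ft t.

Let symdiff (A B : set Omega) := (A `\` B) `|` (B `\` A).

(** The sets that differ from a natural event by a null set form a sigma-algebra, which contains the
    cylinders and the null sets. *)
Lemma augmented_natural (t : R) (A : set Omega) :
  <<s cylinders T W t `|` P.-negligible >> A ->
  exists2 B, natural_filtration T W t B & P.-negligible (symdiff A B).
Proof.
have sN : sigma_algebra setT (natural_filtration T W t) by exact: smallest_sigma_algebra.
apply: (smallest_sub (X := fun A => exists2 B, natural_filtration T W t B & P.-negligible (symdiff A B))).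
- split.
  + by exists set0; [case: sN|rewrite /symdiff !setD0 setU0; exact: negligible_set0].
  + move=> B [C NC nBC]; exists (~` C); first by case: sN => _ + _; rewrite -setTD; exact.
    rewrite setTD; apply: negligibleS nBC => w [[/= h1 h2]|[/= h1 h2]].
      by right; split => //; exact: contrapT.
    by left; split => //; exact: contrapT.
  + move=> B /(_ _)/cid2 HB.
    exists (\bigcup_i s2val (HB i)); first by case: sN => _ _; apply => i; exact: s2valP.
    apply: (negligibleS _ (negligible_bigcup (F := fun i => symdiff (B i) (s2val (HB i))) _)).
      move=> w [[[i _ Bi] nC]|[[i _ Ci] nB]].
        by exists i => //; left; split => // Ci; apply: nC; exists i.
      by exists i => //; right; split => // Bi; apply: nB; exists i.
    by move=> i; exact: (s2valP' (HB i)).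
- move=> B [cB|nB].
    exists B; first exact: sub_sigma_algebra.
    by rewrite /symdiff setDv setU0; exact: negligible_set0.
  by exists set0; [case: sN|rewrite /symdiff setD0 set0D setU0].
Qed.

Lemma negligible_symdiff_eq (A B : set Omega) : measurable A -> measurable B ->
  P.-negligible (symdiff A B) -> P A = P B.
Proof.
move=> mA mB nAB.
have h C D : measurable C -> measurable D -> P.-negligible (symdiff C D) -> (P C <= P D)%E.
  move=> mC mD nCD; rewrite (measureDI P mC mD) [X in (X + _)%E](_ : _ = 0%E).
    by rewrite add0e; apply: le_measure; rewrite ?inE//; exact: measurableI.
  apply/negligibleP; first exact: measurableD.
  by apply: negligibleS nCD; exact: subsetUl.
apply/eqP; rewrite eq_le !h//; apply: negligibleS nAB.
by rewrite /symdiff setUC.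
Qed.

(** By definition [Ft u] lies in the completed history at any s > u, whose events are natural ones
    up to null sets and hence independent of W v - W s. The gap between u and s is closed later, by
    letting s decrease to u. *)
Lemma increment_independent (u s v : R) (A : set Omega) (B : set R) :
  0 <= u -> u < s -> s < v -> v <= T -> Ft u A -> measurable B ->
  P (A `&` [set w | B (W v w - W s w)]) =
  (P A * P [set w | B (W v w - W s w)%R])%E.
Proof.
move=> u0 us sv vT FA mB.
have sT : s <= T by rewrite (le_trans (ltW sv)).
have s0 : 0 <= s by rewrite (le_trans u0)// ltW.
have mW t : 0 <= t -> t <= T -> measurable_fun setT (W t).
  by move=> t0 tT; apply: brownian_measurable W_brownian _ _; rewrite in_itv/= t0.
have mE : measurable [set w | B (W v w - W s w)].
  rewrite -[X in measurable X]setTI.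
  have m : measurable_fun setT (fun w => W v w - W s w).
    by apply: measurable_funB; apply: mW => //; rewrite (le_trans s0)// ltW.
  exact: m.
have [C NC nAC] := augmented_natural (FA s us).
have mA : measurable A by exact: (usual_measurable uFt FA).
have mC : measurable C.
  move: C NC {nAC}; apply: smallest_sub; first exact: sigma_algebra_measurable.
  by move=> D [r [/andP[r0 rT] rs]] [E mE' <-]; exact: mW.
rewrite (negligible_symdiff_eq mA mC nAC).
rewrite -(brownian_independent W_brownian s0 sv vT NC mB).
apply: negligible_symdiff_eq; [exact: measurableI..|].
apply: negligibleS nAC => w [[[Aw Bw] nC]|[[Cw Bw] nA]].
  by left; split => // Cw; exact: nC.
by right; split => // Aw; exact: nA.
Qed.

(** By independence, the state in [F u] and the increment have a product law. Tonelli integrates the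
    Gaussian variable first, with c frozen, and [normal_exponential] gives the factor 1. *)
Lemma exponential_step (u s v : R) (xi c : F u -> R) :
  0 <= u -> u < s -> s < v -> v <= T ->
  measurable_fun setT xi -> measurable_fun setT c -> (forall w, 0 <= xi w) ->
  (\int[P]_w (xi w * expR (c w * (W v w - W s w) - c w ^+ 2 * (v - s) / 2))%:E =
   \int[P]_w (xi w)%:E)%E.
Proof.
move=> u0 us sv vT mxi mc xi0.
have s0 : 0 <= s by rewrite (le_trans u0)// ltW.
have mD : measurable_fun setT (fun w => W v w - W s w : measurableTypeR R).
  apply: measurable_funB; apply: brownian_measurable W_brownian _ _; rewrite in_itv/=.
    by rewrite vT andbT (le_trans s0)// ltW.
  by rewrite s0 (le_trans (ltW sv)).
have mi := filtered_measurable uFt (t := u).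
have mp : measurable_fun setT (fun w : Omega => ((w : F u), (W v w - W s w : measurableTypeR R))).
  exact: measurable_fun_pair.
(* The identity into the smaller sigma-algebra; its law [m1] is the restriction of P to [Ft u]. *)
pose X : {mfun Omega >-> F u} := HB.pack (id : Omega -> F u) (isMeasurableFun.Build _ _ _ _ _ mi).
pose Y : {mfun Omega >-> (F u * measurableTypeR R)%type} :=
  HB.pack (fun w : Omega => ((w : F u), (W v w - W s w : measurableTypeR R)))
    (isMeasurableFun.Build _ _ _ _ _ mp).
pose m1 : probability (F u) R := distribution P X.
pose m2 : probability (measurableTypeR R) R := normal_prob 0 (Num.sqrt (v - s)).
have E : forall A, measurable A -> (m1 \x m2)%E A = distribution P Y A.
  apply: product_measure_unique => A B mA mB.
  rewrite /= /distribution /pushforward/=.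
  rewrite [LHS](_ : _ = P (A `&` [set w | B (W v w - W s w)])); last by congr (P _).
  rewrite (increment_independent u0 us sv vT)//; last first.
    by rewrite -(usual_measurableE uFt).
  by rewrite (brownian_gaussian W_brownian).
pose f (p : F u * measurableTypeR R) : \bar R :=
  (xi p.1 * expR (c p.1 * p.2 - c p.1 ^+ 2 * (v - s) / 2))%:E.
have m_fst (g : F u -> R) : measurable_fun setT g ->
    measurable_fun setT (fun p : F u * measurableTypeR R => g p.1).
  by move=> mg; exact: (measurableT_comp mg measurable_fst).
have mf : measurable_fun setT f.
  apply/measurable_EFinP; apply: measurable_funM; first exact: m_fst.
  apply: measurableT_comp => //; apply: measurable_funB.
    by apply: measurable_funM; [exact: m_fst|exact: measurable_snd].
  apply: measurable_funM => //; apply: measurable_funM => //.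
  by apply: measurable_funX; exact: m_fst.
have f0 p : (0 <= f p)%E by rewrite lee_fin mulr_ge0// expR_ge0.
transitivity (\int[distribution P Y]_p f p)%E.
  by rewrite ge0_integral_pushforward.
rewrite -(eq_measure_integral _ (fun A mA _ => E A mA)) fubini_tonelli1//.
transitivity (\int[m1]_w (xi w)%:E)%E; last first.
  rewrite ge0_integral_pushforward//; first exact/measurable_EFinP.
  by move=> w _; rewrite lee_fin.
apply: eq_integral => w _; rewrite /fubini_F /f /=.
under eq_integral do rewrite EFinM.
rewrite ge0_integralZl//.
- by rewrite normal_exponential ?mule1// subr_gt0.
- apply/measurable_EFinP; apply: measurableT_comp => //; apply: measurable_funB => //.
- by rewrite lee_fin.
Qed.

(** [exponential_step] from times s decreasing to u, continuity of the paths and Fatou's lemma.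
    Equality is lost, but an upper bound is enough. *)
Lemma exponential_step_le (u v : R) (xi c : F u -> R) :
  0 <= u -> u <= v -> v <= T ->
  measurable_fun setT xi -> measurable_fun setT c -> (forall w, 0 <= xi w) ->
  (\int[P]_w (xi w * expR (c w * (W v w - W u w) - c w ^+ 2 * (v - u) / 2))%:E <=
   \int[P]_w (xi w)%:E)%E.
Proof.
move=> u0 uv vT mxi mc xi0.
have mi := filtered_measurable uFt (t := u).
have mxi' : measurable_fun setT (xi : Omega -> R) by exact: (measurableT_comp mxi mi).
have mc' : measurable_fun setT (c : Omega -> R) by exact: (measurableT_comp mc mi).
have mW t : 0 <= t -> t <= T -> measurable_fun setT (W t).
  by move=> t0 tT; apply: brownian_measurable W_brownian _ _; rewrite in_itv/= t0.
have mfe (s h : R) : 0 <= s -> s <= T -> measurable_fun setT (fun w : Omega =>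
    (xi w * expR (c w * (W v w - W s w) - c w ^+ 2 * h / 2))%:E).
  move=> s0 sT; apply/measurable_EFinP; apply: measurable_funM => //.
  apply: measurableT_comp => //; apply: measurable_funB.
    apply: measurable_funM => //; apply: measurable_funB; apply: mW => //.
    exact: le_trans uv.
  apply: measurable_funM => //; apply: measurable_funM => //.
  exact: measurable_funX.
move: uv; rewrite le_eqVlt => /predU1P[<-|uv].
  by under eq_integral do rewrite subrr mulr0 subrr mulr0 mul0r subrr expR0 mulr1.
(* [n.+2] instead of [n.+1] keeps every s n strictly below v. *)
pose s n := u + (v - u) / n.+2%:R.
have sP n : u < s n < v.
  rewrite ltrDl divr_gt0 ?subr_gt0//= -ltrBrDl ltr_pdivrMr// ltr_pMr ?subr_gt0//.
  by rewrite ltr1n.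
have sT n : s n <= T by case/andP: (sP n) => _ /ltW/le_trans; exact.
have s0 n : 0 <= s n by case/andP: (sP n) => /ltW + _; exact: le_trans.
apply: (@integral_ae_cvg_le _ _ _ P setT (fun n (w : Omega) =>
    (xi w * expR (c w * (W v w - W (s n) w) - c w ^+ 2 * (v - s n) / 2))%:E)) => //.
- by move=> n; exact: mfe.
- by apply: mfe => //; rewrite (le_trans (ltW uv)).
- by move=> n w _; rewrite lee_fin mulr_ge0// expR_ge0.
- by move=> w _; rewrite lee_fin mulr_ge0// expR_ge0.
- have := brownian_continuous W_brownian; apply: filterS => w cw _.
  have su : s n @[n --> \oo] --> u.
    apply/cvgrPdist_lt => e e0.
    have e1 : 0 < e / (v - u) by rewrite divr_gt0// subr_gt0.
    near=> n; rewrite /s opprD addrA subrr sub0r normrN ger0_norm; last first.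
      by rewrite divr_ge0// subr_ge0 ltW.
    rewrite mulrC -ltr_pdivlMr ?subr_gt0//.
    apply: (@le_lt_trans _ _ n.+1%:R^-1); first by rewrite lef_pV2 ?posrE// ler_nat.
    by near: n; exact: near_infty_natSinv_lt (PosNum e1).
  have Wsu : W (s n) w @[n --> \oo] --> W u w.
    have := within_continuous_right cw u0 (lt_le_trans uv vT).
    by move=> /cvg_at_rightP; apply; split => // n; case/andP: (sP n).
  apply/cvg_EFin; first by apply: nearW.
  apply: cvgM; first exact: cvg_cst.
  apply: continuous_cvg; first exact: continuous_expR.
  apply: cvgB; first by apply: cvgM; [exact: cvg_cst|apply: cvgB; [exact: cvg_cst|]].
  apply: cvgM; last exact: cvg_cst.
  by apply: cvgM; [exact: cvg_cst|apply: cvgB; [exact: cvg_cst|]].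
- move=> n; have /andP[us sv] := sP n.
  by rewrite (exponential_step u0 us sv vT mxi mc xi0).
Unshelve. all: end_near. Qed.

Lemma simple_value_measurable (phi : simple_process Omega R) : simple_wf T Ft phi ->
  measurable_fun setT (fun rw : R * Omega => simple_value phi rw.1 rw.2).
Proof.
move=> wf; apply: measurable_sum => i; have [_ _ _ _ mi] := wf i (ltn_ord i).
apply: measurable_funM.
  apply: (measurableT_comp (f := simple_coef phi i)) => //.
  by move=> _ B mB; rewrite setTI; apply: (usual_measurable uFt); exact: mi.
rewrite (_ : (fun _ => _) =
    (\1_(`]simple_time phi i, simple_time phi i.+1]) : R -> R) \o fst); last first.
  by apply/funext => -[r w] /=; rewrite indicE mem_setE in_itv.
by apply: measurableT_comp; [exact: measurable_indic|exact: measurable_fst].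
Qed.

Lemma simple_integral_measurable (phi : simple_process Omega R) (t : R) : simple_wf T Ft phi ->
  0 <= t -> measurable_fun setT (simple_integral W phi t).
Proof.
move=> wf t0; apply: measurable_sum => i; have [ti0 titi tiT _ mi] := wf i (ltn_ord i).
apply: measurable_funM.
  by move=> _ B mB; rewrite setTI; apply: (usual_measurable uFt); exact: mi.
apply: measurable_funB; apply: brownian_measurable W_brownian _ _; rewrite in_itv/= le_min ge_min t0 andbT.
  by rewrite (le_trans ti0)//= tiT.
by rewrite ti0 (le_trans titi).
Qed.

Section simple.
Variables (phi : simple_process Omega R) (phi_wf : simple_wf T Ft phi) (t s : R).
Hypotheses (t0 : 0 <= t) (ts : t <= s) (sT : s <= T).

Let n := simple_size phi.
Let tm := simple_time phi.
Let co := simple_coef phi.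

(** The partition clamped to [t, s]: increments between these points build the integral from t to
    s. *)
Let a i := Num.max t (Num.min (tm i) s).

Let a_ge i : t <= a i. Proof. by rewrite le_max lexx. Qed.

Let a_le i : a i <= s. Proof. by rewrite ge_max ts ge_min lexx orbT. Qed.

Let a_nd i : (i < n)%N -> a i <= a i.+1.
Proof.
move=> /phi_wf[_ ti _ _ _]; rewrite /a ge_max le_max lexx/= le_max; apply/orP; right.
by rewrite le_min !ge_min ti lexx orbT.
Qed.

Let a_lt i : a i < a i.+1 -> tm i <= a i.
Proof.
have [ti _|ti] := leP (tm i) s; first by rewrite le_max (min_idPl ti) lexx orbT.
have -> : a i = s by rewrite /a (min_idPr (ltW ti)); apply/max_idPr.
by move=> /lt_le_trans/(_ (a_le i.+1)); rewrite ltxx.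
Qed.

(** When tm i exceeds s, the clamped point is s and the coefficient need not be known there. Setting
    it to 0 on intervals of length 0 restores measurability at time a i and changes no sum. *)
Let c i (w : Omega) := if a i < a i.+1 then co i w else 0.

Let mc i : (i < n)%N -> measurable_fun setT (c i : F (a i) -> R).
Proof.
move=> ilt; rewrite /c; case: ltP => [/a_lt ta|_]; last exact: measurable_cst.
move=> _ B mB; rewrite setTI (usual_measurableE uFt).
by apply: (usual_mono uFt ta); have [_ _ _ _] := phi_wf ilt; exact.
Qed.

Let S k (w : Omega) := \sum_(i < k) (c i w * (W (a i.+1) w - W (a i) w) -
   c i w ^+ 2 * (a i.+1 - a i) / 2).

Let mW (u v : R) : 0 <= u -> u <= v -> v <= T -> measurable_fun setT (W u : F v -> R).
Proof.
move=> u0 uv vT _ B mB; rewrite setTI (usual_measurableE uFt).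
apply: (usual_mono uFt uv) => r ur; apply: sub_sigma_algebra; left.
exists u => /=; first by rewrite u0 (le_trans uv)// (ltW ur).
by exists B => //; rewrite setTI.
Qed.

Let mS k : (k <= n)%N -> measurable_fun setT (S k : F (a k) -> R).
Proof.
elim: k => [_|k IH kn].
  by rewrite /S; under eq_fun do rewrite big_ord0; exact: measurable_cst.
rewrite /S; under eq_fun do rewrite big_ord_recr/=.
have up (f : F (a k) -> R) : measurable_fun setT f ->
    measurable_fun setT (f : F (a k.+1) -> R).
  by move=> mf; exact: (measurableT_comp mf (measurable_filtered uFt (a_nd kn))).
have a0 i : 0 <= a i by rewrite (le_trans t0).
have aT i : a i <= T by rewrite (le_trans (a_le i)).
apply: measurable_funD; first by apply: up; apply: IH; exact: ltnW.
apply: measurable_funB.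
  apply: measurable_funM; first exact: (up _ (mc kn)).
  apply: measurable_funB; first exact: mW.
  by apply: (up (W (a k))); exact: mW.
apply: measurable_funM => //; apply: measurable_funM => //.
by apply: measurable_funX; exact: (up _ (mc kn)).
Qed.

(** Induction on the number of intervals: xi times the exponential up to a k is known at time a k,
    so [exponential_step_le] removes the factor of the next interval. *)
Lemma simple_exponential (xi : F t -> R) :
  measurable_fun setT xi -> (forall w, 0 <= xi w) -> forall k, (k <= n)%N ->
  (\int[P]_w (xi w * expR (S k w))%:E <= \int[P]_w (xi w)%:E)%E.
Proof.
move=> mxi xi0; elim=> [_|k IH kn].
  by under eq_integral do rewrite /S big_ord0 expR0 mulr1.
apply: le_trans (IH (ltnW kn)).
pose xi' (w : F (a k)) := xi w * expR (S k w).
have mxi' : measurable_fun setT xi'.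
  apply: measurable_funM; last by apply: measurableT_comp => //; apply: mS; exact: ltnW.
  exact: (measurableT_comp mxi (measurable_filtered uFt (a_ge k))).
have := @exponential_step_le (a k) (a k.+1) xi' (c k) (le_trans t0 (a_ge k)) (a_nd kn)
  (le_trans (a_le _) sT) mxi' (mc kn).
have xi'0 w : 0 <= xi' w by rewrite mulr_ge0// expR_ge0.
move=> /(_ xi'0); apply: le_trans.
rewrite le_eqVlt; apply/orP; left; apply/eqP; apply: eq_integral => w _.
by rewrite /S big_ord_recr/= expRD mulrA.
Qed.

Lemma simple_integralB (w : Omega) :
  \sum_(i < n) c i w * (W (a i.+1) w - W (a i) w) =
  simple_integral W phi s w - simple_integral W phi t w.
Proof.
rewrite /simple_integral -sumrB; apply: eq_bigr => i _; rewrite -mulrBr.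
(* For each partition point x, the gain between t and s is the increment from t to the clamped
   point; the common term W t w cancels between consecutive points. *)
have E x : W (Num.min x s) w - W (Num.min x t) w = W (Num.max t (Num.min x s)) w - W t w.
  have [xt|tx] := leP x t.
    rewrite (min_idPl (le_trans xt ts)) subrr.
    by rewrite (max_idPl xt) subrr.
  by congr (W _ _ - _); apply/esym/max_idPr; rewrite le_min (ltW tx).
have -> : W (Num.min (simple_time phi i.+1) s) w - W (Num.min (simple_time phi i) s) w -
   (W (Num.min (simple_time phi i.+1) t) w - W (Num.min (simple_time phi i) t) w) =
   W (a i.+1) w - W (a i) w.
  have := E (simple_time phi i.+1); have := E (simple_time phi i); rewrite -/(a i) -/(a i.+1).
  by move: (W _ w) (W _ w) (W _ w) (W _ w) (W _ w) (W _ w) (W _ w) => *; lra.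
rewrite /c; case: ifPn => //; rewrite -leNgt => aa.
have -> : a i.+1 = a i by apply/eqP; rewrite eq_le aa (a_nd (ltn_ord i)).
by rewrite subrr !mulr0.
Qed.

(** The intervals are successive, so at most one of them contains r and all cross terms vanish. *)
Lemma simple_value_sqr (r : R) (w : Omega) : simple_value phi r w ^+ 2 =
  \sum_(i < n) co i w ^+ 2 * (tm i < r <= tm i.+1)%R%:R.
Proof.
pose v k := \sum_(i < k) co i w * (tm i < r <= tm i.+1)%R%:R.
(* The induction also records that the first k terms vanish after tm k: this kills the cross term
   with the next one. *)
suff: forall k, (k <= n)%N -> (tm k < r -> v k = 0) /\ v k ^+ 2 =
    \sum_(i < k) co i w ^+ 2 * (tm i < r <= tm i.+1)%R%:R.
  by move=> /(_ n (leqnn n))[].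
elim=> [_|k IH kn]; first by rewrite /v !big_ord0 expr0n.
have [H1 H2] := IH (ltnW kn); have [_ tk _ _ _] := phi_wf kn.
rewrite /v !big_ord_recr/= -/(v k); split.
  move=> kr; rewrite H1 ?add0r; last exact: le_lt_trans kr.
  by rewrite leNgt kr andbF mulr0.
rewrite -H2; case: (ltP (tm k) r) => [/H1 -> /=|_ /=]; last by rewrite !mulr0 !addr0.
by rewrite add0r expr0n add0r exprMn; case: (_ <= _); rewrite ?expr1n ?expr0n.
Qed.

(** The integral of the square is the sum of the squared coefficients times the lengths of the
    original intervals, and clamping to [t, s] only shortens these. *)
Lemma simple_quadratic_le (w : Omega) :
  ((\sum_(i < n) c i w ^+ 2 * (a i.+1 - a i))%:E <=
  \int[lebesgue_measure]_(r in `[0%R, T]) (simple_value phi r w ^+ 2)%:E)%E.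
Proof.
under eq_integral do rewrite simple_value_sqr -sumEFin.
have mI i : measurable_fun `[0, T] (fun r : R => (co i w ^+ 2 * (tm i < r <= tm i.+1)%R%:R)%:E).
  apply/measurable_EFinP; apply: measurable_funM => //.
  rewrite (_ : (fun _ => _) = \1_(`]tm i, tm i.+1])); last first.
    by apply/funext => r; rewrite indicE mem_setE in_itv.
  exact: measurable_indic.
rewrite ge0_integral_sum//; last by move=> i r _; rewrite lee_fin mulr_ge0 ?sqr_ge0.
rewrite -sumEFin; apply: lee_sum => i _.
have [tm0 ti tiT _ _] := phi_wf (ltn_ord i).
have -> : (\int[lebesgue_measure]_(r in `[0%R, T]) (co i w ^+ 2 * (tm i < r <= tm i.+1)%R%:R)%:E =
    (co i w ^+ 2 * (tm i.+1 - tm i))%:E)%E.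
  under eq_integral do rewrite EFinM.
  rewrite ge0_integralZl ?lee_fin ?sqr_ge0//; last first.
    apply/measurable_EFinP; rewrite (_ : (fun _ => _) = \1_(`]tm i, tm i.+1])).
      exact: measurable_indic.
    by apply/funext => r; rewrite indicE mem_setE in_itv.
  rewrite [RHS]EFinM; congr (_ * _)%E.
  transitivity (\int[lebesgue_measure]_(r in `[0%R, T]) (\1_(`]tm i, tm i.+1] : set R) r)%:E)%E.
    by apply: eq_integral => r _; rewrite indicE mem_setE in_itv.
  rewrite integral_indic// (setIidl _).
    transitivity (lebesgue_measure (`]tm i, tm i.+1]%classic : set R)); first by [].
    rewrite lebesgue_measure_itv/= lte_fin; case: ifPn => [_|]; first by rewrite EFinB.
    rewrite -leNgt => it; have -> : tm i.+1 = tm i by apply/eqP; rewrite eq_le it ti.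
    by rewrite subrr.
  by move=> r /=; rewrite !in_itv/= => /andP[/ltW r1 /le_trans ->]; rewrite // (le_trans tm0).
rewrite lee_fin /c; case: ifPn => aa; last by rewrite expr0n mul0r mulr_ge0 ?sqr_ge0// subr_ge0.
rewrite ler_wpM2l ?sqr_ge0//; have tii : tm i <= tm i.+1 := ti; rewrite /a.
move: (tm i) (tm i.+1) tii ts => x z xz ts'.
have m1 : t <= Num.max t (Num.min x s) by rewrite le_max lexx.
have m2 : Num.min x s <= Num.max t (Num.min x s) by rewrite le_max lexx orbT.
have m3 : Num.min z s <= z - x + Num.min x s.
  case: (leP x s) => xs; first by rewrite subrK ge_min lexx.
  by rewrite ge_min; apply/orP; right; move: xz; lra.
  by rewrite lerBlDr ge_max; apply/andP; split; move: m1 m2 m3 xz; lra.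
by move=> i; exact: mI.
Qed.

(* exp (int c dW - int c^2 / 2 dt) is a martingale for simple c, and 2 q bounds
   the quadratic variation. *)
Lemma simple_exponential_le (xi : F t -> R) (q : Omega -> R) :
  measurable_fun setT xi -> (forall w, 0 <= xi w) -> measurable_fun setT q ->
  {ae P, forall w, (\int[lebesgue_measure]_(r in `[0%R, T])
     (simple_value phi r w ^+ 2)%:E <= (2 * q w)%:E)%E} ->
  (\int[P]_w (xi w * expR (simple_integral W phi s w - simple_integral W phi t w - q w))%:E
   <= \int[P]_w (xi w)%:E)%E.
Proof.
move=> mxi xi0 mq hq; apply: le_trans (simple_exponential mxi xi0 (leqnn n)).
have mxi' : measurable_fun setT (xi : Omega -> R).
  exact: (measurableT_comp mxi (filtered_measurable uFt (t := t))).
have mI r : 0 <= r -> measurable_fun setT (simple_integral W phi r).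
  exact: simple_integral_measurable.
apply: ae_ge0_le_integral => //.
- by move=> w _; rewrite lee_fin mulr_ge0// expR_ge0.
- apply/measurable_EFinP; apply: measurable_funM => //; apply: measurableT_comp => //.
  apply: measurable_funB => //; apply: measurable_funB; apply: mI => //.
  exact: le_trans ts.
- by move=> w _; rewrite lee_fin mulr_ge0// expR_ge0.
- apply/measurable_EFinP; apply: measurable_funM => //; apply: measurableT_comp => //.
  exact: (measurableT_comp (mS (leqnn n)) (filtered_measurable uFt (t := a n))).
- apply: filterS hq => w /(le_trans (simple_quadratic_le w)); rewrite lee_fin => hq _.
  rewrite lee_fin ler_wpM2l// ler_expR.
  have -> : S n w = (simple_integral W phi s w - simple_integral W phi t w)
      - (\sum_(i < n) c i w ^+ 2 * (a i.+1 - a i)) / 2.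
    rewrite -simple_integralB mulr_suml -sumrB; apply: eq_bigr => i _.
    by [].
  by rewrite lerD2l lerN2 ler_pdivrMr// mulrC.
Qed.

End simple.

End brownian.

Section ae_subsequence.
Context d (X : measurableType d) (R : realType) (mu : {measure set X -> \bar R}).
Local Open Scope ereal_scope.

(** Integrals at most 2^-(j+1) along the subsequence make the sum integrable, hence finite almost
    everywhere; each term is then below a tail of a convergent series. *)
Lemma ae_cvg_subsequence (Z : nat -> X -> \bar R) :
  (forall k, measurable_fun setT (Z k)) -> (forall k x, 0 <= Z k x) ->
  \int[mu]_x Z k x @[k --> \oo] --> 0 ->
  exists2 k_ : nat -> nat, forall j, \int[mu]_x Z (k_ j) x < +oo &
    {ae mu, forall x, Z (k_ j) x @[j --> \oo] --> 0}.
Proof.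
move=> mZ Z0 cZ.
have H (j : nat) : exists k, \int[mu]_x Z k x <= (1 / (2 ^ j.+1)%:R)%:E.
  have e0 : (0 < 1 / (2 ^ j.+1)%:R :> R)%R by rewrite divr_gt0// ltr0n expn_gt0.
  have /fine_cvgP[cf /cvgrPdist_lt/(_ _ e0)] := cZ.
  move=> /(filterI cf)[k _ /(_ k (leqnn k))[/= kf]].
  rewrite sub0r normrN => /ltW kle; exists k.
  rewrite -(fineK kf) lee_fin; exact: le_trans (ler_norm _) kle.
have [k_ Hk] := choice H; exists k_.
  by move=> j; apply: le_lt_trans (Hk j) _; exact: ltry.
pose S x := \sum_(0 <= j <oo) Z (k_ j) x.
have mS : measurable_fun setT S by apply: ge0_emeasurable_sum => //.
have S0 x : 0 <= S x by exact: nneseries_ge0.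
have iS : mu.-integrable setT S.
  apply/integrableP; split => //; under eq_integral do rewrite gee0_abs//.
  rewrite integral_nneseries//.
  apply: (@le_lt_trans _ _ (\sum_(0 <= j <oo) (1 / (2 ^ j.+1)%:R)%:E)).
    by apply: lee_nneseries => // j _ _; exact: integral_ge0.
  apply: (@le_lt_trans _ _ 1%:E); last exact: ltry.
  exact: epsilon_trick0.
have := integrable_ae measurableT iS; apply: filterS => x /(_ Logic.I) Sfin.
have := @nneseries_tail_cvg R (fun j => Z (k_ j) x) xpredT _ _.
rewrite ltey_eq Sfin => /(_ isT (fun _ _ => Z0 _ _)) tl.
apply: (@squeeze_cvge _ _ _ _ (cst 0) _ _ _ _ (cvg_cst 0) tl).
apply: nearW => j; rewrite Z0/=.
by rewrite (nneseries_split j 1)//= addn1 big_nat1 leeDl// nneseries_ge0.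
Qed.

End ae_subsequence.

Lemma measurable_integral_strip d (Omega : measurableType d) (R : realType) (T : R)
    (f : R * Omega -> \bar R) :
  measurable_fun (strip (Omega := Omega) T) f ->
  (forall rw, strip T rw -> (0 <= f rw)%E) ->
  measurable_fun setT (fun w => \int[lebesgue_measure]_(r in `[0%R, T]) f (r, w))%E.
Proof.
move=> mf f0; pose g := f \_ (strip T).
have mg : measurable_fun setT g.
  by apply/(measurable_restrictT f _) => //; exact: measurable_strip.
have g0 x : (0 <= g x)%E.
  by rewrite /g /patch; case: ifPn => // /set_mem; exact: f0.
have := @measurable_fun_fubini_tonelli_G _ _ _ _ _ (@lebesgue_measure R) g mg g0.
apply: eq_measurable_fun => w _; rewrite /fubini_G [RHS]integral_mkcond.
by apply: eq_integral => r _; rewrite /g /patch; congr (if _ then _ else _).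
Qed.

(** * From simple processes to the Ito integral *)

Section ito.
Context d (Omega : measurableType d) (R : realType).
Variables (P : probability Omega R) (T : R) (W : R -> Omega -> R).
Hypothesis T_gt0 : 0 < T.
Hypothesis P_complete : measure_is_complete P.
Hypothesis W_brownian : brownian_motion P T W.

Let Ft := augmented_filtration P T W.

Let uFt : usual_conditions P T Ft.
Proof.
apply: augmented_filtration_usual => // t tT; exact: brownian_measurable W_brownian _ _.
Qed.

Variables (sigma M : R -> Omega -> R) (K : R).
Hypothesis sigma_meas : measurable_fun (strip (Omega := Omega) T) (fun rw => sigma rw.1 rw.2).
Hypothesis sigma_le : forall t w, t \in `[0, T] -> `|sigma t w| <= K.
Hypothesis M_ito : ito_integral P T Ft W sigma M.

Variables (t s : R).
Hypotheses (t0 : 0 <= t) (ts : t <= s) (sT : s <= T).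

Let tT : t \in `[0, T]. Proof. by rewrite in_itv/= t0 (le_trans ts). Qed.
Let sT' : s \in `[0, T]. Proof. by rewrite in_itv/= sT (le_trans t0). Qed.

Let mM r : r \in `[0, T] -> measurable_fun setT (M r).
Proof. by move=> rT; case: M_ito => aM _ _; exact: (adapted_measurableT uFt aM). Qed.

Let D (phi : simple_process Omega R) (w : Omega) : \bar R :=
  (\int[lebesgue_measure]_(r in `[0%R, T]) ((simple_value phi r w - sigma r w) ^+ 2)%:E)%E.

Let mD phi : simple_wf T Ft phi -> measurable_fun setT (D phi).
Proof.
move=> wf; apply: (measurable_integral_strip (f := fun rw =>
  ((simple_value phi rw.1 rw.2 - sigma rw.1 rw.2) ^+ 2)%:E)); last first.
  by move=> rw _; rewrite lee_fin sqr_ge0.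
apply/measurable_EFinP; apply: measurable_funX; apply: measurable_funB => //.
apply: measurable_funTS; exact: (simple_value_measurable P_complete W_brownian).
Qed.

Let D_ge0 phi w : (0 <= D phi w)%E.
Proof. by apply: integral_ge0 => r _; rewrite lee_fin sqr_ge0. Qed.

(** From v^2 <= 2 sigma^2 + 2 (v - sigma)^2 integrated over [0, T]. The factor 2 matches the one in
    front of q in [simple_exponential_le]. *)
Let quadratic_bound phi w : simple_wf T Ft phi -> 0 <= K -> (D phi w < +oo)%E ->
  (\int[lebesgue_measure]_(r in `[0%R, T]) (simple_value phi r w ^+ 2)%:E <=
   (2 * K ^+ 2 * T + 2 * fine (D phi w))%:E)%E.
Proof.
move=> wf K0 Dw; have Dfin : D phi w \is a fin_num by rewrite ge0_fin_numE.
have msec (g : R -> Omega -> R) : measurable_fun (strip (Omega := Omega) T) (fun rw => g rw.1 rw.2) ->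
    measurable_fun `[0, T] (fun r => g r w).
  move=> mg; have m1 : measurable_fun `[0, T] (fun r : R => (r, w)).
    by apply: measurable_funTS; exact: measurable_fun_pair.
  apply: (measurable_comp (F := strip T) (f := fun rw => g rw.1 rw.2) _ _ mg m1).
    exact: measurable_strip.
  by move=> _ [r rT <-].
have mv : measurable_fun `[0, T] (fun r => simple_value phi r w).
  apply: (msec (simple_value phi)); apply: measurable_funTS.
  exact: (simple_value_measurable P_complete W_brownian).
have ms : measurable_fun `[0, T] (fun r => sigma r w) by exact: msec.
apply: (@le_trans _ _ (\int[lebesgue_measure]_(r in `[0%R, T])
   ((2 * K ^+ 2)%:E + 2%:E * ((simple_value phi r w - sigma r w) ^+ 2)%:E))%E).
  apply: ge0_le_integral => //.
  - by move=> r _; rewrite lee_fin sqr_ge0.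
  - by apply/measurable_EFinP; exact: measurable_funX.
  - apply: emeasurable_funD => //; apply: emeasurable_funM => //.
    by apply/measurable_EFinP; apply: measurable_funX; exact: measurable_funB.
  - move=> r rT; rewrite -EFinM -EFinD lee_fin.
    have : sigma r w ^+ 2 <= K ^+ 2.
      by rewrite -[sigma r w ^+ 2]real_normK ?num_real// ler_sqr ?nnegrE// sigma_le.
    move: (sigma r w) (simple_value phi r w) => x y xK.
    (* This square is the difference of the two sides: 2 x^2 + 2 (y - x)^2 - y^2. *)
    have : 0 <= (y - 2 * x) ^+ 2 by exact: sqr_ge0.
    by move: xK; rewrite !expr2; nra.
rewrite ge0_integralD//; last 3 first.
- by move=> r _; rewrite lee_fin mulr_ge0// sqr_ge0.
- by move=> r _; rewrite mule_ge0// lee_fin sqr_ge0.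
- apply: emeasurable_funM => //.
  by apply/measurable_EFinP; apply: measurable_funX; exact: measurable_funB.
rewrite integral_cst//= ge0_integralZl//=; last 2 first.
- by apply/measurable_EFinP; apply: measurable_funX; exact: measurable_funB.
- by move=> r _; rewrite lee_fin sqr_ge0.
have -> : lebesgue_measure (`[0, T]%classic : set R) = T%:E.
  by rewrite lebesgue_measure_itv/= lte_fin T_gt0 sube0.
have -> : (\int[lebesgue_measure]_(r in `[0%R, T])
    ((simple_value phi r w - sigma r w) ^+ 2)%:E = (fine (D phi w))%:E)%E by rewrite fineK.
by rewrite -!EFinM -EFinD.
Qed.

(** For the approximants the compensator is K^2 T plus the random error [D], which tends to 0 almost
    surely along a subsequence. Fatou's lemma leaves K^2 T, the exponent in the statement. *)
Lemma ito_exponential (A : set Omega) : Ft t A ->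
  (\int[P]_(w in A) (expR (M s w - M t w))%:E <= (expR (K ^+ 2 * T))%:E * P A)%E.
Proof.
move=> FA; have mA : measurable A by exact: (usual_measurable uFt FA).
have [aM _ [phi [wf cD cI]]] := M_ito.
have [->|/set0P[w0 _]] := eqVneq A set0.
  by rewrite integral_set0 measure0 mule0.
have K0 : 0 <= K by rewrite (le_trans (normr_ge0 (sigma t w0)))// sigma_le.
pose Q r k w : \bar R := ((simple_integral W (phi k) r w - M r w) ^+ 2)%:E.
have mQ r k : r \in `[0, T] -> measurable_fun setT (Q r k).
  move=> rT; apply/measurable_EFinP; apply: measurable_funX; apply: measurable_funB.
    by apply: (simple_integral_measurable P_complete W_brownian) => //; move: rT; rewrite in_itv/= => /andP[].
  exact: mM.
have Q0 r k w : (0 <= Q r k w)%E by rewrite lee_fin sqr_ge0.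
(* One sum for the error in the integrand and the errors in the integral at both times, so that a
   single subsequence serves all three. *)
pose Z k w := (D (phi k) w + (Q s k w + Q t k w))%E.
have mZ k : measurable_fun setT (Z k).
  by apply: emeasurable_funD; [exact: mD|apply: emeasurable_funD; exact: mQ].
have Z0 k w : (0 <= Z k w)%E by apply: adde_ge0 => //; exact: adde_ge0.
have cZ : (\int[P]_w Z k w @[k --> \oo] --> 0)%E.
  rewrite (_ : (fun _ => _) = (fun k => \int[P]_w D (phi k) w +
      (\int[P]_w Q s k w + \int[P]_w Q t k w))%E); last first.
    apply/funext => k; rewrite ge0_integralD//; last 3 first.
    - exact: mD.
    - by move=> w _; rewrite adde_ge0.
    - by apply: emeasurable_funD; exact: mQ.
    by rewrite ge0_integralD//; exact: mQ.
  have h : (\int[P]_w D (phi k) w + (\int[P]_w Q s k w + \int[P]_w Q t k w) @[k --> \oo]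
      --> (0 + (0 + 0)))%E.
    apply: cvgeD; [by rewrite adde0|exact: cD|].
    by apply: cvgeD; [by []|exact: cI|exact: cI].
  by rewrite !adde0 in h.
have [k_ ik ck] := ae_cvg_subsequence mZ Z0 cZ.
pose I r k w := simple_integral W (phi k) r w.
pose Y j w : \bar R := (\1_A w * expR (I s (k_ j) w - I t (k_ j) w
   - (K ^+ 2 * T + fine (D (phi (k_ j)) w))))%:E.
have mI r k : r \in `[0, T] -> measurable_fun setT (I r k).
  by rewrite in_itv/= => /andP[r0 _]; apply: (simple_integral_measurable P_complete W_brownian).
have m1 : measurable_fun setT (\1_A : Omega -> R) by exact: measurable_indic.
have mY j : measurable_fun setT (Y j).
  apply/measurable_EFinP; apply: measurable_funM => //; apply: measurableT_comp => //.
  apply: measurable_funB; first by apply: measurable_funB; exact: mI.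
  by apply: measurable_funD => //; apply: measurableT_comp => //; exact: mD.
have Dfin j : {ae P, forall w, D (phi (k_ j)) w < +oo}%E.
  have iZ : P.-integrable setT (Z (k_ j)).
    apply/integrableP; split => //; under eq_integral do rewrite gee0_abs//.
    exact: ik.
  have := integrable_ae measurableT iZ; apply: filterS => w /(_ Logic.I).
  rewrite (ge0_fin_numE (Z0 _ _)) => /(le_lt_trans _); apply.
  by rewrite leeDl// adde_ge0.
have YA j : (\int[P]_w Y j w <= P A)%E.
  have PA : P A = (\int[P]_w (\1_A w)%:E)%E by rewrite integral_indic// setIT.
  rewrite PA; apply: (simple_exponential_le P_complete W_brownian (wf _) t0 ts sT).
  - by apply: measurable_indic; rewrite (usual_measurableE uFt).
  - by move=> w; rewrite indicE.
  - by apply: measurable_funD => //; apply: measurableT_comp => //; exact: mD.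
  - apply: filterS (Dfin j) => w Dw; apply: le_trans (quadratic_bound (wf _) K0 Dw) _.
    by rewrite lee_fin mulrDr mulrA.
have G0 : (\int[P]_w (\1_A w * expR (M s w - M t w - K ^+ 2 * T))%:E <= P A)%E.
  apply: (@integral_ae_cvg_le _ _ _ P setT Y) => //.
  - apply/measurable_EFinP; apply: measurable_funM => //; apply: measurableT_comp => //.
    by apply: measurable_funB => //; apply: measurable_funB; exact: mM.
  - by move=> j w _; rewrite lee_fin mulr_ge0// expR_ge0.
  - apply: filterS ck => w cw _.
    have cZ' (f : nat -> \bar R) : (forall j, 0 <= f j <= Z (k_ j) w)%E -> f j @[j --> \oo] --> 0%E.
      move=> fj; apply: (@squeeze_cvge _ _ _ _ (cst 0%E) _ _ _ _ (cvg_cst 0%E) cw).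
      by apply: nearW => j; exact: fj.
    have cDw : D (phi (k_ j)) w @[j --> \oo] --> 0%E.
      by apply: cZ' => j; rewrite D_ge0/= leeDl// adde_ge0.
    have cQ r : r = s \/ r = t -> Q r (k_ j) w @[j --> \oo] --> 0%E.
      move=> rst; apply: cZ' => j; rewrite Q0/=; apply: (@le_trans _ _ (Q s (k_ j) w + Q t (k_ j) w))%E.
        by case: rst => ->; [rewrite leeDl|rewrite leeDr].
      by rewrite leeDr.
    have cIw r : r = s \/ r = t -> I r (k_ j) w @[j --> \oo] --> M r w.
      move=> /cQ /fine_cvgP[_ cq]; apply/cvgrPdist_lt => e e0.
      have e2 : 0 < e ^+ 2 by rewrite exprn_gt0.
      move/cvgrPdist_lt : cq => /(_ _ e2); apply: filterS => j /=.
      rewrite sub0r normrN ger0_norm ?sqr_ge0// distrC.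
      rewrite -[X in X < _]real_normK ?num_real//.
      by rewrite ltr_sqr ?nnegrE// ltW.
    have /fine_cvgP[_ cDf] := cDw.
    apply/cvg_EFin; first exact: nearW.
    apply: cvgM; first exact: cvg_cst.
    apply: continuous_cvg; first exact: continuous_expR.
    rewrite -[X in _ --> _ - X]addr0; apply: cvgB.
      by apply: cvgB; apply: cIw; [left|right].
    by apply: cvgD; [exact: cvg_cst|exact: cDf].
have -> : (\int[P]_(w in A) (expR (M s w - M t w))%:E =
    (expR (K ^+ 2 * T))%:E * \int[P]_w (\1_A w * expR (M s w - M t w - K ^+ 2 * T))%:E)%E.
  rewrite -ge0_integralZl ?lee_fin ?expR_ge0//; last first.
    apply/measurable_EFinP; apply: measurable_funM => //; apply: measurableT_comp => //.
    by apply: measurable_funB => //; apply: measurable_funB; exact: mM.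
  rewrite [LHS]integral_mkcond; apply: eq_integral => w _; rewrite /patch indicE.
  case: ifPn => wA; last by rewrite mul0r mule0.
  by rewrite mul1r -EFinM -expRD addrCA subrr addr0.
by rewrite lee_wpmul2l// lee_fin expR_ge0.
Qed.

End ito.

(** * The production function *)

Section production.
Context {R : realType} (F : R -> R).
Hypothesis F_production : production_function F.

(** Were F b above the tangent at a, the chord slope would differ from F'(a) by some eta > 0. For 0
    < t < 1, strict concavity puts the difference quotient at a + t (b - a) further from F'(a) than
    the chord slope, on the same side, although it converges to F'(a) as t -> 0. *)
Lemma production_tangent (a b : R) : 0 < a -> 0 < b ->
  F b <= F a + derive1 F a * (b - a).
Proof.
move=> a0 b0; have [->|ba] := eqVneq b a; first by rewrite subrr mulr0 addr0.
have ba0 : b - a != 0 by rewrite subr_eq0.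
rewrite leNgt; apply/negP => Fb.
pose eta := `|(F b - F a) / (b - a) - derive1 F a|.
have eta0 : 0 < eta.
  rewrite normr_gt0 subr_eq0; apply/eqP => E; move: Fb; rewrite -E.
  by rewrite divfK// addrC subrK ltxx.
have /cvgrPdist_lt/(_ _ eta0) := production_derivable F_production a0.
rewrite -/(derive F a 1) -derive1E => -[e /= e0 He].
(* Below 1 for concavity, and with t |b - a| < e, so that the difference quotient is within eta of
   the derivative. *)
pose t := Num.min (2^-1) (e / 2 / `|b - a|).
have t0 : 0 < t by rewrite lt_min invr_gt0 ltr0n/= !divr_gt0// normr_gt0.
have t1 : t < 1 by rewrite gt_min; apply/orP; left; rewrite invf_lt1// ltr1n.
have hn0 : t * (b - a) != 0 by rewrite mulf_neq0// gt_eqF.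
have he : `|0 - t * (b - a)| < e.
  rewrite sub0r normrN normrM (gtr0_norm t0) -ltr_pdivlMr ?normr_gt0// gt_min.
  by apply/orP; right; rewrite ltr_pM2r ?invr_gt0 ?normr_gt0//; move: e0; lra.
have := He _ he hn0; rewrite /= scaler1 /shift.
have := production_strictly_concave F_production b0 a0 ba t0 t1.
have -> : t * b + (1 - t) * a = t * (b - a) + a by ring.
move: (F (t * (b - a) + a)) => Fh conc.
rewrite [_ *: _](_ : _ = (Fh - F a) / t / (b - a)); last first.
  by rewrite /GRing.scale/= invfM mulrC mulrA.
have : F b - F a < (Fh - F a) / t by rewrite ltr_pdivlMr//; move: conc; lra.
have [ab|] := ltP a b.
  have ba' : 0 < b - a by rewrite subr_gt0.
  have : derive1 F a < (F b - F a) / (b - a) by rewrite ltr_pdivlMr//; move: Fb; lra.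
  move=> h1; rewrite -(ltr_pM2r (x := (b - a)^-1)) ?invr_gt0// => h2.
  rewrite /eta ltr_norml => /andP[+ _]; rewrite gtr0_norm ?subr_gt0//.
  by move: h1 h2; lra.
rewrite le_eqVlt (negbTE ba)/= => ab.
have ba' : b - a < 0 by rewrite subr_lt0.
have : (F b - F a) / (b - a) < derive1 F a by rewrite ltr_ndivrMr//; move: Fb; lra.
move=> h1; rewrite -(ltr_nM2r (x := (b - a)^-1)) ?invr_lt0// => h2.
rewrite /eta ltr_norml => /andP[_ +]; rewrite ltr0_norm ?subr_lt0//.
by move: h1 h2; lra.
Qed.

(** The sum of the tangent inequalities at a and at b. *)
Lemma production_derive_ni (a b : R) : 0 < a -> a <= b -> derive1 F b <= derive1 F a.
Proof.
move=> a0; rewrite le_eqVlt => /predU1P[->//|ab]; have b0 := lt_trans a0 ab.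
have h1 := production_tangent a0 b0; have h2 := production_tangent b0 a0.
rewrite -(ler_pM2r (x := b - a)) ?subr_gt0//; move: h1 h2.
by move: (derive1 F a) (derive1 F b) (F a) (F b) => A B fa fb; lra.
Qed.

Lemma production_derive_ge0 (a : R) : 0 < a -> 0 <= derive1 F a.
Proof.
move=> a0; have a1 : a < a + 1 by rewrite ltrDl.
have := production_tangent a0 (lt_trans a0 a1).
have := production_increasing F_production a0 a1; lra.
Qed.

(** The Inada condition at infinity, combined with F' >= 0. It makes the coefficient of the capacity
    as small as the finiteness of the cost requires. *)
Lemma production_derive_small (e : R) : 0 < e ->
  exists2 c : R, 0 < c & forall a, c <= a -> derive1 F a <= e.
Proof.
move=> e0; have /cvgrPdist_lt/(_ e e0)[M [Mr HM]] := production_derive_atoo F_production.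
exists (Num.max 1 (M + 1)); first by rewrite lt_max ltr01.
move=> a; rewrite ge_max => /andP[a1 Ma].
have := HM a; rewrite sub0r normrN => /(_ _)/ltW; rewrite ger0_norm.
  by apply; rewrite (lt_le_trans _ Ma)// ltrDl.
by apply: production_derive_ge0; rewrite (lt_le_trans ltr01).
Qed.

Lemma production_measurable_comp d (X : measurableType d) (g : X -> R) (D : set X) :
  (forall x, 0 < g x) -> measurable_fun D g -> measurable_fun D (F \o g).
Proof.
move=> g0 mg; apply: (measurable_comp (F := [set c : R | 0 < c])) => //.
- rewrite [X in measurable X](_ : _ = `]0, +oo[%classic)//.
  by apply/seteqP; split => x /=; rewrite in_itv/= andbT.
- by move=> _ [x _ <-] /=.
- exact: production_measurable.
Qed.

Lemma production_derive_measurable_comp d (X : measurableType d) (g : X -> R) (D : set X) :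
  (forall x, 0 < g x) -> measurable_fun D g -> measurable_fun D (derive1 F \o g).
Proof.
move=> g0 mg; have E : [set c : R | 0 < c] = `]0, +oo[%classic.
  by apply/seteqP; split => x /=; rewrite in_itv/= andbT.
apply: (measurable_comp (F := [set c : R | 0 < c])) => //.
- by rewrite E.
- by move=> _ [x _ <-] /=.
- rewrite E; apply: open_continuous_measurable_fun; first exact: interval_open.
  by move=> x; rewrite inE/= in_itv/= andbT; exact: production_derive_continuous.
Qed.

End production.

(** * Exponential moments from a stopping time on *)

Section stopped_exponential.
Context d (Omega : measurableType d) (R : realType).
Variables (P : probability Omega R) (T : R) (Ft : R -> set (set Omega)).
Hypothesis T_gt0 : 0 < T.
Hypothesis uFt : usual_conditions P T Ft.
Variables (M : R -> Omega -> R) (K : R).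
Hypothesis M_meas : forall t, t \in `[0, T] -> measurable_fun setT (M t).
Hypothesis M_continuous : forall w, {within `[0, T], continuous (M ^~ w)}.
Hypothesis M_exponential : forall (t s : R) (A : set Omega), 0 <= t -> t <= s -> s <= T ->
  Ft t A -> (\int[P]_(w in A) (expR (M s w - M t w))%:E <= K%:E * P A)%E.

(** tau is rounded up to the grid of mesh s / (n + 1): the event that it falls in a cell is known at
    the right end of the cell, where the bound for deterministic times applies. Summing over cells
    and letting n grow, path continuity and Fatou's lemma conclude. *)
Lemma stopped_exponential (tau : Omega -> R) (s : R) : stopping_time P T Ft tau ->
  (forall w, 0 <= tau w <= T) -> 0 <= s <= T ->
  (\int[P]_(w in [set w | (tau w < s)%R]) (expR (M s w - M (tau w) w))%:E <=
   K%:E * P [set w | (tau w < s)%R])%E.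
Proof.
move=> st tau0T /andP[]; rewrite le_eqVlt => /predU1P[<- _|s0 sT].
  rewrite (_ : [set _ | _] = set0); first by rewrite integral_set0 measure0 mule0.
  by apply/seteqP; split => // w /=; rewrite ltNge; case/andP: (tau0T w) => ->.
pose D := [set w | tau w < s].
have mtau := stopping_measurable uFt st tau0T.
have mD : measurable D.
  rewrite [X in measurable X](_ : _ = setT `&` tau @^-1` `]-oo, s[); first exact: mtau.
  by apply/seteqP; split => w /=; rewrite /D/= in_itv/= => // -[].
pose g n k : R := k%:R * (s / n.+1%:R).
have sn0 n : 0 < s / n.+1%:R by rewrite divr_gt0.
have gS n : g n n.+1 = s by rewrite /g mulrC divfK.
have g_nd n : {homo g n : k l / (k <= l)%N >-> k <= l}.
  by move=> k l kl; rewrite /g ler_pM2r// ler_nat.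
pose E n k := [set w | g n k <= tau w < g n k.+1].
have mE n k : measurable (E n k).
  rewrite [X in measurable X](_ : _ = setT `&` tau @^-1` `[g n k, g n k.+1[); first exact: mtau.
  by apply/seteqP; split => w /=; rewrite /E/= in_itv/= => // -[].
have g0 n k : 0 <= g n k by rewrite /g mulr_ge0// ltW.
have FE n k : (k <= n)%N -> Ft (g n k.+1) (E n k).
  move=> kn; have gkT j : (j <= n.+1)%N -> g n j <= T.
    by move=> /(g_nd n); rewrite gS => /le_trans; apply.
  have lt j : (j <= n.+1)%N -> Ft (g n j) [set w | tau w < g n j].
    move=> jn; apply: (stopping_lt uFt st); first by rewrite g0 gkT.
    by move=> w; case/andP: (tau0T w).
  rewrite (_ : E n k = [set w | tau w < g n k.+1] `&` ~` [set w | tau w < g n k]).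
    apply: (usual_I uFt); first exact: lt.
    apply: (usual_C uFt); apply: (usual_mono uFt (s := g n k)); first exact: g_nd.
    by apply: lt; exact: ltnW.
  apply/seteqP; split => w; rewrite /E/= leNgt; first by move=> /andP[/negP].
  by move=> [-> /negP ->].
pose e n k (w : Omega) : \bar R := (\1_(E n k) w * expR (M s w - M (g n k.+1) w))%:E.
have gkT n k : (k <= n)%N -> 0 <= g n k.+1 <= s.
  by move=> kn; rewrite g0/= -[leRHS](gS n) g_nd.
have mM n k : (k <= n)%N -> measurable_fun setT (M (g n k.+1)).
  by move=> /gkT/andP[? gs]; apply: M_meas; rewrite in_itv/= g0/= (le_trans gs).
have mMs : measurable_fun setT (M s) by apply: M_meas; rewrite in_itv/= ltW.
have me n k : (k <= n)%N -> measurable_fun D (e n k).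
  move=> kn; apply: measurable_funTS; apply/measurable_EFinP; apply: measurable_funM => //.
  by apply: measurableT_comp => //; apply: measurable_funB => //; exact: mM.
have e0 n k w : (0 <= e n k w)%E by rewrite lee_fin mulr_ge0// expR_ge0.
have ED n k : (k <= n)%N -> E n k `<=` D.
  by move=> kn w /andP[_ /lt_le_trans]; apply; case/andP: (gkT n k kn).
pose f n w := (\sum_(k < n.+1) e n k w)%E.
apply: (@integral_cvg_le _ _ _ P D f) => //.
- by move=> n; apply: emeasurable_sum => k; apply: me; rewrite -ltnS.
- by move=> n w _; apply: sume_ge0 => k _.
- move=> w Dw; have /andP[w0 wT] := tau0T w.
  pose k n := Num.truncn (tau w / (s / n.+1%:R)).
  have Ek n : E n (k n) w.
    rewrite /E/= /g -ler_pdivlMr// -ltr_pdivrMr//.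
    by apply: truncn_itv; rewrite divr_ge0// ltW.
  have kn n : (k n < n.+1)%N.
    have /andP[gk _] := Ek n; rewrite ltnNge; apply/negP => nk.
    by move: (le_trans (g_nd n _ _ nk) gk); rewrite gS leNgt Dw.
  have fE n : f n w = (expR (M s w - M (g n (k n).+1) w))%:E.
    rewrite /f (bigD1 (Ordinal (kn n)))//= big1 ?adde0.
      by rewrite /e indicE mem_set ?mul1r//; exact: Ek.
    move=> j jk; rewrite /e indicE memNset ?mul0r// => Ej.
    move/eqP : jk; apply; apply/val_inj => /=; apply/esym/truncn_def.
    by move: Ej; rewrite /E/= /g -ler_pdivlMr// -ltr_pdivrMr.
  under eq_fun do rewrite fE.
  apply/cvg_EFin; first exact: nearW.
  apply: continuous_cvg; first exact: continuous_expR.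
  apply: cvgB; first exact: cvg_cst.
  have := within_continuous_right (@M_continuous w) w0 (lt_le_trans Dw sT).
  move=> /cvg_at_rightP; apply; split; first by move=> n; case/andP: (Ek n).
  apply/cvgrPdist_lt => eps eps0; have es0 : 0 < eps / s by rewrite divr_gt0.
  near=> n; have /andP[gk kg] := Ek n.
  rewrite distrC ger0_norm ?subr_ge0 ?(ltW kg)//.
  apply: (@le_lt_trans _ _ (s / n.+1%:R)).
    by rewrite lerBlDr [leRHS]addrC /g -(natr1 (k n)) mulrDl mul1r lerD2r.
  rewrite mulrC -ltr_pdivlMr//; near: n; exact: near_infty_natSinv_lt (PosNum es0).
- move=> n; rewrite ge0_integral_sum//; last by move=> k; apply: me; rewrite -ltnS.
  have PE : (\sum_(k < n.+1) P (E n k) <= P D)%E.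
    rewrite -measure_semi_additive_ord//; last 2 first.
    - apply/trivIsetP => -[i ilt] [j jlt] _ _ ij; apply/seteqP; split => // w /= [Ei Ej].
      move/eqP : ij; apply; apply/val_inj => /=.
      have tr k : E n k w -> Num.truncn (tau w / (s / n.+1%:R)) = k.
        by move=> Ek; apply: truncn_def; move: Ek; rewrite /E/= /g -ler_pdivlMr// -ltr_pdivrMr.
      by rewrite -(tr _ Ei) -(tr _ Ej).
    - by apply: bigsetU_measurable => k _.
    apply: le_measure; rewrite ?inE//; first by apply: bigsetU_measurable => k _.
    apply: (big_ind (fun A => A `<=` D)) => //; first by move=> A B AD BD w [/AD|/BD].
    by move=> k _; apply: ED; rewrite -ltnS.
  apply: (@le_trans _ _ (\sum_(k < n.+1) K%:E * P (E n k))%E).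
    apply: lee_sum => k _; have kn : (k <= n)%N := ltn_ord k.
    have /andP[? gs] := gkT n k kn.
    apply: le_trans (M_exponential (g0 n k.+1) gs sT (FE n k kn)).
    rewrite [leRHS]integral_mkcond [leLHS]integral_mkcond.
    rewrite le_eqVlt; apply/orP; left; apply/eqP; apply: eq_integral => w _.
    rewrite /patch; case: ifPn => wD; case: ifPn => wE //.
    - by rewrite /e indicE wE mul1r.
    - by rewrite /e indicE (negbTE wE) mul0r.
    - by move: wD; rewrite (mem_set (ED n k kn _ (set_mem wE))).
  (* The sign of K is read off from the bound itself at t = s = 0 on the whole space. *)
  have K0 : (0 <= K%:E)%E.
    have T0 : 0 <= T by exact: ltW.
    have := M_exponential (lexx 0) (lexx 0) T0 (usual_T uFt 0).
    rewrite probability_setT mule1; apply: le_trans.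
    by apply: integral_ge0 => w _; rewrite lee_fin expR_ge0.
  by rewrite -ge0_sume_distrr// lee_wpmul2l.
Unshelve. all: end_near. Qed.

End stopped_exponential.

(** * Double integrals and random times *)

Section double_integral.
Context d (Omega : measurableType d) (R : realType) (P : probability Omega R) (T : R).
Implicit Types f g : R -> Omega -> \bar R.

Definition strip_measurable f :=
  measurable_fun (strip (Omega := Omega) T) (fun sw => f sw.1 sw.2).

Definition strip_ge0 f := forall s w, s \in `[0, T] -> (0 <= f s w)%E.

Definition double_integral f : \bar R :=
  (\int[P]_w \int[lebesgue_measure]_(s in `[0%R, T]) f s w)%E.

Lemma strip_section f w : strip_measurable f -> measurable_fun `[0, T] (f ^~ w).
Proof.
move=> mf; have m1 : measurable_fun `[0, T] (fun r : R => (r, w)).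
  by apply: measurable_funTS; exact: measurable_fun_pair.
apply: (measurable_comp (F := strip T) (f := fun sw => f sw.1 sw.2) _ _ mf m1).
  exact: measurable_strip.
by move=> _ [r rT <-].
Qed.

Lemma measurable_inner f : strip_measurable f -> strip_ge0 f ->
  measurable_fun setT (fun w => \int[lebesgue_measure]_(s in `[0%R, T]) f s w)%E.
Proof.
move=> mf f0; apply: (measurable_integral_strip (f := fun sw => f sw.1 sw.2)) => //.
by move=> [s w] sT; exact: f0.
Qed.

(** The iterated integral becomes one integral over the product space, with f set to 0 outside
    [0, T]; Fatou's lemma and dominated convergence are then applied once instead of once per
    variable. *)
Let patched f : Omega * measurableTypeR R -> \bar R :=
  fun z => if z.2 \in `[0, T] then f z.2 z.1 else 0%E.

Let measurable_patched f : strip_measurable f -> measurable_fun setT (patched f).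
Proof.
move=> mf; have mg : measurable_fun setT ((fun sw => f sw.1 sw.2) \_ (strip T)).
  by apply/(measurable_restrictT (fun sw : R * Omega => f sw.1 sw.2) _) => //; exact: measurable_strip.
have sw : measurable_fun setT (fun z : Omega * measurableTypeR R => (z.2 : R, z.1)).
  by apply: measurable_fun_pair; [exact: measurable_snd|exact: measurable_fst].
have := measurableT_comp mg sw; apply: eq_measurable_fun => -[w s] _ /=.
rewrite /patched /patch/=; case: ifPn => sT; case: ifPn => // sT'.
  by move/set_mem : sT; rewrite /strip/= (negbTE sT').
by move/negP : sT; case; apply/mem_set.
Qed.

Let double_integralE f : strip_measurable f -> strip_ge0 f ->
  double_integral f = (\int[P \x lebesgue_measure]_z patched f z)%E.
Proof.
move=> mf f0; rewrite fubini_tonelli1.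
- apply: eq_integral => w _; rewrite /fubini_F [LHS]integral_mkcond.
  by apply: eq_integral => s _; rewrite /patch /patched/= mem_setE.
- exact: measurable_patched.
- by move=> [w s]; rewrite /patched/=; case: ifPn => // /f0.
Qed.

Lemma double_integral_ge0 f : strip_ge0 f -> (0 <= double_integral f)%E.
Proof. by move=> f0; apply: integral_ge0 => w _; apply: integral_ge0 => s; exact: f0. Qed.

Lemma double_integral_le f g : strip_measurable f -> strip_measurable g ->
  strip_ge0 f -> (forall s w, s \in `[0, T] -> (f s w <= g s w)%E) ->
  (double_integral f <= double_integral g)%E.
Proof.
move=> mf mg f0 fg.
have g0 : strip_ge0 g by move=> s w sT; apply: le_trans (f0 s w sT) (fg s w sT).
apply: ge0_le_integral => //.
- by move=> w _; apply: integral_ge0 => s; exact: f0.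
- exact: measurable_inner.
- exact: measurable_inner.
- move=> w _; apply: ge0_le_integral => //.
  + by move=> s; exact: f0.
  + exact: strip_section.
  + exact: strip_section.
  + by move=> s; exact: fg.
Qed.

Lemma eq_double_integral f g : (forall s w, s \in `[0, T] -> f s w = g s w) ->
  double_integral f = double_integral g.
Proof.
move=> fg; apply: eq_integral => w _; apply: eq_integral => s; rewrite inE; exact: fg.
Qed.

Lemma double_integralD f g : strip_measurable f -> strip_measurable g ->
  strip_ge0 f -> strip_ge0 g ->
  double_integral (fun s w => f s w + g s w)%E = (double_integral f + double_integral g)%E.
Proof.
move=> mf mg f0 g0; rewrite /double_integral -ge0_integralD//.
- apply: eq_integral => w _; rewrite ge0_integralD//.
  + by move=> s; exact: f0.
  + exact: strip_section.
  + by move=> s; exact: g0.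
  + exact: strip_section.
- by move=> w _; apply: integral_ge0 => s; exact: f0.
- exact: measurable_inner.
- by move=> w _; apply: integral_ge0 => s; exact: g0.
- exact: measurable_inner.
Qed.

Lemma double_integralZl (k : R) f : 0 <= k -> strip_measurable f -> strip_ge0 f ->
  double_integral (fun s w => k%:E * f s w)%E = (k%:E * double_integral f)%E.
Proof.
move=> k0 mf f0; rewrite /double_integral -ge0_integralZl//.
- apply: eq_integral => w _; rewrite ge0_integralZl//.
  + exact: strip_section.
  + by move=> s; exact: f0.
- exact: measurable_inner.
- by move=> w _; apply: integral_ge0 => s; exact: f0.
Qed.

Lemma double_integral_cvg_le (f_ : nat -> R -> Omega -> \bar R) f (c : \bar R) :
  (forall n, strip_measurable (f_ n)) -> (forall n, strip_ge0 (f_ n)) ->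
  strip_measurable f -> strip_ge0 f ->
  (forall s w, s \in `[0, T] -> f_ n s w @[n --> \oo] --> f s w) ->
  (forall n, double_integral (f_ n) <= c)%E -> (double_integral f <= c)%E.
Proof.
move=> mf_ f_0 mf f0 cf fc; rewrite double_integralE//.
apply: (@integral_cvg_le _ _ _ _ setT (fun n => patched (f_ n))) => //.
- by move=> n; exact: measurable_patched.
- by move=> n [w s] _; rewrite /patched/=; case: ifPn => // /f_0.
- by move=> [w s] _; rewrite /patched/=; case: ifPn => sT; [exact: cf|exact: cvg_cst].
- by move=> n; rewrite -double_integralE.
Qed.

Lemma double_integral_dominated_ge (f_ : nat -> R -> Omega -> \bar R) f g (c : \bar R) :
  (forall n, strip_measurable (f_ n)) -> (forall n, strip_ge0 (f_ n)) ->
  strip_measurable f -> strip_ge0 f -> strip_measurable g -> strip_ge0 g ->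
  (forall s w, s \in `[0, T] -> f_ n s w @[n --> \oo] --> f s w) ->
  (forall n s w, s \in `[0, T] -> (f_ n s w <= g s w)%E) ->
  (double_integral g < +oo)%E ->
  (forall n, c <= double_integral (f_ n))%E -> (c <= double_integral f)%E.
Proof.
move=> mf_ f_0 mf f0 mg g0 cf fg goo fc; rewrite double_integralE//.
have pg0 z : (0 <= patched g z)%E by rewrite /patched; case: ifPn => // /g0.
have pf0 n z : (0 <= patched (f_ n) z)%E by rewrite /patched; case: ifPn => // /f_0.
have [] := @dominated_convergence _ _ _ (P \x lebesgue_measure)%E setT measurableT
  (fun n => patched (f_ n)) (patched f) (patched g).
- by move=> n; exact: measurable_patched.
- exact: measurable_patched.
- by apply: aeW => -[w s] _; rewrite /patched/=; case: ifPn => sT; [exact: cf|exact: cvg_cst].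
- apply/integrableP; split; first exact: measurable_patched.
  by under eq_integral do rewrite gee0_abs//; rewrite -double_integralE.
- apply: aeW => z n _; rewrite gee0_abs// /patched; case: ifPn => //; exact: fg.
move=> _ _ h; rewrite -(cvg_lim (@ereal_hausdorff R) h).
apply: lime_ge; first by apply/cvg_ex; eexists; exact: h.
by apply: nearW => n /=; rewrite -double_integralE.
Qed.

End double_integral.

(** Multiplying by the indicators of [D1] and [D2] reduces the exchange to the whole product
    space. *)
Lemma tonelli_in d1 d2 (T1 : measurableType d1) (T2 : measurableType d2) (R : realType)
    (m1 : {sigma_finite_measure set T1 -> \bar R})
    (m2 : {sigma_finite_measure set T2 -> \bar R})
    (D1 : set T1) (D2 : set T2) (f : T1 * T2 -> \bar R) :
  measurable D1 -> measurable D2 -> measurable_fun setT f -> (forall z, 0 <= f z)%E ->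
  (\int[m1]_(x in D1) \int[m2]_(y in D2) f (x, y) =
   \int[m2]_(y in D2) \int[m1]_(x in D1) f (x, y))%E.
Proof.
move=> mD1 mD2 mf f0.
pose k (z : T1 * T2) : \bar R := ((\1_D1 z.1 * \1_D2 z.2)%:E * f z)%E.
have mk : measurable_fun setT k.
  apply: emeasurable_funM => //; apply/measurable_EFinP; apply: measurable_funM.
    by apply: (measurableT_comp (f := \1_D1 : T1 -> R)); [exact: measurable_indic|exact: measurable_fst].
  by apply: (measurableT_comp (f := \1_D2 : T2 -> R)); [exact: measurable_indic|exact: measurable_snd].
have k0 z : (0 <= k z)%E by rewrite /k mule_ge0// lee_fin mulr_ge0.
have E x y : k (x, y) = if x \in D1 then if y \in D2 then f (x, y) else 0%E else 0%E.
  rewrite /k !indicE/=; case: (x \in D1); case: (y \in D2) => /=;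
  by rewrite ?mul1r ?mul0r ?mul1e ?mul0e.
transitivity (\int[m1]_x \int[m2]_y k (x, y))%E.
  rewrite [LHS]integral_mkcond; apply: eq_integral => x _; rewrite /patch.
  case: ifPn => xD.
    by rewrite [LHS]integral_mkcond; apply: eq_integral => y _; rewrite E xD.
  by rewrite integral0_eq// => y _; rewrite E (negbTE xD).
rewrite (fubini_tonelli _ mk k0) [RHS]integral_mkcond.
apply: eq_integral => y _; rewrite /patch.
case: ifPn => yD.
  by rewrite [RHS]integral_mkcond; apply: eq_integral => x _; rewrite E yD.
by rewrite integral0_eq// => x _; rewrite E (negbTE yD); case: ifP.
Qed.

Section random_times.
Context d (Omega : measurableType d) (R : realType) (P : probability Omega R) (T : R).
Variables (tau : R -> Omega -> R) (I : set R).
Hypothesis mI : measurable I.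
Hypothesis mtau : measurable_fun setT (fun uw : R * Omega => tau uw.1 uw.2).

Lemma tonelli_random_time (g : R -> Omega -> \bar R) :
  measurable_fun setT (fun uw : R * Omega => g uw.1 uw.2) ->
  (forall u w, 0 <= g u w)%E ->
  (\int[P]_w \int[lebesgue_measure]_(u in I) g u w =
   \int[lebesgue_measure]_(u in I) \int[P]_w g u w)%E.
Proof.
move=> mg g0.
have sw : measurable_fun setT (fun z : Omega * measurableTypeR R => (z.2 : R, z.1)).
  by apply: measurable_fun_pair; [exact: measurable_snd|exact: measurable_fst].
exact: (@tonelli_in _ _ _ _ _ P lebesgue_measure setT I (fun z => g z.2 z.1) measurableT mI
  (measurableT_comp mg sw)).
Qed.

Lemma measurable_expectation (f : R -> Omega -> \bar R) :
  measurable_fun setT (fun uw : R * Omega => f uw.1 uw.2) -> (forall u w, 0 <= f u w)%E ->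
  measurable_fun setT (fun u : measurableTypeR R => \int[P]_w f u w)%E.
Proof.
move=> mf f0.
have sw : measurable_fun setT (fun z : Omega * measurableTypeR R => (z.2 : R, z.1)).
  by apply: measurable_fun_pair; [exact: measurable_snd|exact: measurable_fst].
exact: (measurable_fun_fubini_tonelli_G (m1 := P) _ (measurableT_comp mf sw) (fun z => f0 _ _)).
Qed.

Variables (h : R -> Omega -> R) (m : R -> Omega -> R).
Hypothesis mh : measurable_fun setT (fun uw : R * Omega => h uw.1 uw.2).
Hypothesis h0 : forall t w, 0 <= h t w.

Lemma measurable_window :
  measurable_fun setT (fun sw : R * Omega => \int[lebesgue_measure]_(u in I)
    (if (tau u sw.2 < sw.1)%R then h (tau u sw.2) sw.2 else 0)%:E)%E.
Proof.
pose k (z : (R * Omega) * measurableTypeR R) : \bar R := ((\1_I z.2)%:E *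
  (if tau z.2 z.1.2 < z.1.1 then h (tau z.2 z.1.2) z.1.2 else 0)%:E)%E.
have mk : measurable_fun setT k.
  have mw : measurable_fun setT (fun z : (R * Omega) * measurableTypeR R => z.1.2).
    exact: (measurableT_comp measurable_snd measurable_fst).
  have ms : measurable_fun setT (fun z : (R * Omega) * measurableTypeR R => z.1.1).
    exact: (measurableT_comp measurable_fst measurable_fst).
  have mu : measurable_fun setT (fun z : (R * Omega) * measurableTypeR R => z.2 : R).
    exact: measurable_snd.
  have mt := measurableT_comp mtau (measurable_fun_pair mu mw).
  apply: emeasurable_funM; apply/measurable_EFinP.
    by apply: (measurableT_comp (f := \1_I : R -> R) _ mu); exact: measurable_indic.
  apply: measurable_fun_ifT => //; first exact: measurable_fun_ltr.
  exact: (measurableT_comp mh (measurable_fun_pair mt mw)).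
have k0 z : (0 <= k z)%E.
  by rewrite mule_ge0// lee_fin//; case: ifP.
have := measurable_fun_fubini_tonelli_F (m2 := lebesgue_measure) k mk k0.
apply: eq_measurable_fun => -[s w] _; rewrite /fubini_F [RHS]integral_mkcond.
apply: eq_integral => u _; rewrite /k /patch/= indicE.
by case: (u \in I); rewrite ?mul1e ?mul0e.
Qed.

Hypothesis mm : measurable_fun (strip (Omega := Omega) T) (fun uw => m uw.1 uw.2).
Hypothesis m0 : forall s w, s \in `[0, T] -> 0 <= m s w.

Let ms s w := if s \in `[0, T] then m s w else 0.

Let ms0 s w : 0 <= ms s w. Proof. by rewrite /ms; case: ifPn => // /m0. Qed.

Let mms : measurable_fun setT (fun sw : R * Omega => ms sw.1 sw.2).
Proof.
have : measurable_fun setT ((fun sw : R * Omega => m sw.1 sw.2) \_ (strip T)).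
  by apply/(measurable_restrictT (fun sw : R * Omega => m sw.1 sw.2) _) => //; exact: measurable_strip.
apply: eq_measurable_fun => -[s w] _; rewrite /ms /patch /=.
case: ifPn => sT; case: ifPn => // sT'.
  by move/set_mem : sT; rewrite /strip/= (negbTE sT').
by move/negP : sT; case; apply/mem_set.
Qed.

Let k (z : (Omega * measurableTypeR R) * measurableTypeR R) : \bar R :=
  (if (tau z.1.2 z.1.1 < z.2)%R then h (tau z.1.2 z.1.1) z.1.1 * ms z.2 z.1.1 else 0)%:E.

Let mk : measurable_fun setT k.
Proof.
have mw : measurable_fun setT (fun z : (Omega * measurableTypeR R) * measurableTypeR R => z.1.1).
  exact: (measurableT_comp measurable_fst measurable_fst).
have mu : measurable_fun setT (fun z : (Omega * measurableTypeR R) * measurableTypeR R => z.1.2 : R).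
  exact: (measurableT_comp measurable_snd measurable_fst).
have mt : measurable_fun setT (fun z : (Omega * measurableTypeR R) * measurableTypeR R => tau z.1.2 z.1.1).
  exact: (measurableT_comp mtau (measurable_fun_pair mu mw)).
have ms2 : measurable_fun setT (fun z : (Omega * measurableTypeR R) * measurableTypeR R => z.2 : R).
  exact: measurable_snd.
apply/measurable_EFinP; apply: measurable_fun_ifT.
- exact: measurable_fun_ltr.
- apply: measurable_funM; first exact: (measurableT_comp mh (measurable_fun_pair mt mw)).
  exact: (measurableT_comp mms (measurable_fun_pair ms2 mw)).
- exact: measurable_cst.
Qed.

Let k0 z : (0 <= k z)%E.
Proof. by rewrite /k lee_fin; case: ifPn => // _; rewrite mulr_ge0. Qed.

Lemma measurable_invested_time :
  measurable_fun setT (fun uw : R * Omega => \int[lebesgue_measure]_(s in `[0%R, T])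
     (if (tau uw.1 uw.2 < s)%R then h (tau uw.1 uw.2) uw.2 * m s uw.2 else 0)%:E)%E.
Proof.
have sw : measurable_fun setT (fun z : R * Omega => (z.2, z.1 : measurableTypeR R)).
  by apply: measurable_fun_pair; [exact: measurable_snd|exact: measurable_fst].
have := measurableT_comp (measurable_fun_fubini_tonelli_F (m2 := lebesgue_measure) k mk k0) sw.
apply: eq_measurable_fun => -[u w] _; rewrite /fubini_F /= [RHS]integral_mkcond.
apply: eq_integral => s _; rewrite /k /= /patch mem_setE /ms.
by case: ifP => // _; case: ifP; rewrite ?mulr0.
Qed.

(** An amount invested at time tau_u acts on all of ]tau_u, T]. Exchanging u with s on each path,
    and then u with w, expresses the total effect level by level; for fixed u only one random time
    remains. *)
Lemma tonelli_invested :
  (\int[P]_w \int[lebesgue_measure]_(s in `[0%R, T])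
     ((m s w)%:E * \int[lebesgue_measure]_(u in I) (if (tau u w < s)%R then h (tau u w) w else 0)%:E) =
   \int[lebesgue_measure]_(u in I) \int[P]_w \int[lebesgue_measure]_(s in `[0%R, T])
     (if (tau u w < s)%R then h (tau u w) w * m s w else 0)%:E)%E.
Proof.
rewrite -tonelli_random_time; first last.
- move=> u w; apply: integral_ge0 => s /m0 ?; rewrite lee_fin; case: ifP => // _.
  by rewrite mulr_ge0.
- exact: measurable_invested_time.
apply: eq_integral => w _.
have mp : measurable_fun setT (fun z : measurableTypeR R * measurableTypeR R => ((w, z.2), z.1)).
  apply: measurable_fun_pair; last exact: measurable_fst.
  by apply: measurable_fun_pair; [exact: measurable_cst|exact: measurable_snd].
have mkw := measurableT_comp mk mp.
transitivity (\int[lebesgue_measure]_(s in `[0%R, T]) \int[lebesgue_measure]_(u in I) k ((w, u), s))%E.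
  apply: eq_integral => s; rewrite inE => sT; rewrite -ge0_integralZl//.
  - apply: eq_integral => u _; rewrite /k /= /ms sT -EFinM; congr (_%:E).
    by case: ifP; rewrite ?mulr0// mulrC.
  - apply: measurable_funTS; apply/measurable_EFinP.
    have mu : measurable_fun setT (fun u : measurableTypeR R => (u : R, w)).
      exact: measurable_fun_pair.
    have mt : measurable_fun setT (fun u : measurableTypeR R => tau u w).
      exact: (measurableT_comp mtau mu).
    apply: measurable_fun_ifT => //; first exact: measurable_fun_ltr.
    have mtw : measurable_fun setT (fun u : measurableTypeR R => (tau u w, w)).
      exact: measurable_fun_pair.
    exact: (measurableT_comp mh mtw).
  - by move=> u _; rewrite lee_fin; case: ifP.
  - by rewrite lee_fin m0.
have := @tonelli_in _ _ _ _ _ lebesgue_measure lebesgue_measure (`[0, T]%classic : set R) I _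
   (measurable_itv _) mI mkw (fun z => k0 _).
move=> ->; apply: eq_integral => u _; apply: eq_integral => s; rewrite inE => sT.
by rewrite /k /= /ms sT.
Qed.

End random_times.

(** * Operations on investment processes *)

Section admissible_operations.
Context d (Omega : measurableType d) (R : realType).
Variables (P : probability Omega R) (T : R) (Ft : R -> set (set Omega)).
Hypothesis T_gt0 : 0 < T.
Hypothesis uFt : usual_conditions P T Ft.
Implicit Types nu : R -> Omega -> R.

Lemma adaptedP nu : adapted T Ft nu <->
  (forall t, t \in `[0, T] -> measurable_fun setT (nu t : filtered Ft t -> R)).
Proof.
split=> h t tT; first exact: (adapted_measurable uFt).
by move=> B mB; rewrite -(usual_measurableE uFt) -[X in measurable X]setTI; exact: h.
Qed.

Lemma admissibleZ nu (a : R) : 0 <= a -> admissible P T Ft nu ->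
  admissible P T Ft (fun t w => a * nu t w).
Proof.
move=> a0 [n0 nd lc ad n00]; split.
- by move=> t w tT; rewrite mulr_ge0// n0.
- by move=> w s t sT tT st; rewrite ler_wpM2l// nd.
- by move=> w t tT; apply: cvgMr; exact: lc.
- apply/adaptedP => t tT; apply: measurable_funM => //; exact: (adaptedP nu).1.
- by move: n00; apply: filterS => w ->; rewrite mulr0.
Qed.

(** The strict inequality in [jump] is what matters: the jump is visible at t when tau w < t, an
    event of [Ft t], and this makes the path left-continuous. *)
Lemma admissible_jump nu (a : R) (tau : Omega -> R) : 0 <= a ->
  stopping_time P T Ft tau -> (forall w, 0 <= tau w <= T) -> admissible P T Ft nu ->
  admissible P T Ft (fun t w => nu t w + a * jump (tau w) t).
Proof.
move=> a0 st tT [n0 nd lc ad n00]; split.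
- by move=> t w t0; rewrite addr_ge0 ?n0// mulr_ge0.
- by move=> w s t sT tT' stt; rewrite lerD ?nd// ler_wpM2l// jump_nd.
- move=> w t t0T; apply: cvgD; first exact: lc.
  apply: cvgMr; have [tt|tt] := ltP (tau w) t.
    have E : jump (tau w) t = 1 by rewrite /jump tt.
    rewrite E; apply: cvg_near_cst; near=> s; rewrite /jump.
    suff -> : tau w < s by [].
    by near: s; exact: nbhs_left_gt.
  have E : jump (tau w) t = 0 by rewrite /jump ltNge tt.
  rewrite E; apply: cvg_near_cst; near=> s; rewrite /jump ltNge.
  suff -> : s <= tau w by [].
  by apply: le_trans tt; near: s; exact: nbhs_left_le.
- apply/adaptedP => t t0T; apply: measurable_funD; first exact: (adaptedP nu).1.
  apply: measurable_funM => //.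
  have mA : measurable ([set w | tau w < t] : set (filtered Ft t)).
    rewrite (usual_measurableE uFt); apply: (stopping_lt uFt st) => //.
    by move=> w; case/andP: (tT w).
  suff -> : (fun w => jump (tau w) t) = \1_[set w | tau w < t] :> (filtered Ft t -> R).
    exact: measurable_indic.
  apply/funext => w; rewrite indicE /jump; case: ltP => h; congr (_%:R).
    by rewrite mem_set.
  by rewrite memNset//= => h'; move: (le_lt_trans h h'); rewrite ltxx.
- by move: n00; apply: filterS => w ->; rewrite /jump ltNge; case/andP: (tT w) => -> _; rewrite mulr0 addr0.
Unshelve. all: end_near. Qed.

Lemma admissible_cvgT nu w : admissible P T Ft nu -> nu s w @[s --> T^'-] --> nu T w.
Proof. by move=> A; apply: (admissible_left_continuous A); rewrite in_itv/= T_gt0 lexx. Qed.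

(** The time change with a domain that does not depend on w: the condition on the hitting time moves
    into the integrand, ready for the exchange with the expectation. *)
Lemma integral_hit nu w s (g : R -> \bar R) : admissible P T Ft nu -> s <= T ->
  measurable_fun `[0, s[ g -> (forall t, t \in `[0, s[ -> (0 <= g t)%E) ->
  (\int[stieltjes T (nu ^~ w)]_(t in `[0%R, s[) g t =
   \int[lebesgue_measure]_(u in `]0%R, +oo[)
     (if (hit T nu u w < s)%R then g (hit T nu u w) else 0))%E.
Proof.
move=> A sT mg g0; rewrite integral_time_change//; first last.
- exact: admissible_cvgT.
- exact: (admissible_nd A).
rewrite [LHS]integral_mkcond [RHS]integral_mkcond; apply: eq_integral => u _.
rewrite /patch !mem_setE in_itv/= andbT.
case: (ltP 0 u) => u0; last first.
  by rewrite memNset//= => -[]; rewrite ltNge u0.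
have [h|h] := boolP (hit T nu u w < s); first by rewrite mem_set.
by rewrite memNset//= => -[_ h']; move: h; rewrite /hit h'.
Qed.

Lemma admissible_measurable_hit nu : admissible P T Ft nu ->
  measurable_fun setT (fun uw : R * Omega => hit T nu uw.1 uw.2).
Proof.
move=> A; apply: (measurable_hit T_gt0 uFt); first exact: (admissible_nd A).
exact: (admissible_adapted A).
Qed.

Lemma admissible_hit_stopping nu u : admissible P T Ft nu ->
  stopping_time P T Ft (hit T nu u).
Proof.
move=> A; apply: (hit_stopping T_gt0 uFt); first exact: (admissible_nd A).
exact: (admissible_adapted A).
Qed.

Section invested.
Variable h : R -> Omega -> R.
Hypothesis mh : measurable_fun setT (fun tw : R * Omega => h tw.1 tw.2).
Hypothesis h0 : forall t w, 0 <= h t w.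
Hypothesis h_bdd : forall w, exists B, forall t, h t w <= B.

(** For h = f_C / C^0 this is the integral in the formula for the capacity, which is therefore
    affine in it. *)
Definition invested nu (s : R) (w : Omega) : R :=
  \int[stieltjes T (nu ^~ w)]_(t in `[0, s[) h t w.

Let mhw w (D : set R) : measurable_fun D (fun t => (h t w)%:E).
Proof.
apply/measurable_EFinP/measurable_funTS.
by apply: (measurableT_comp mh (g := fun t => (t, w))); exact: measurable_fun_pair.
Qed.

Lemma invested_ge0 nu s w : 0 <= invested nu s w.
Proof. by apply: Rintegral_ge0 => t _. Qed.

(** Only levels up to nu T - nu 0 can be hit before T, and the integrand is at most B on them. *)
Let finite_integral nu s w : admissible P T Ft nu -> s <= T ->
  (\int[stieltjes T (nu ^~ w)]_(t in `[0%R, s[) (h t w)%:E \is a fin_num)%E.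
Proof.
move=> A sT; have [B hB] := h_bdd w.
have B0 : 0 <= B by exact: le_trans (h0 0 w) (hB 0).
have nuT : 0 <= nu T w - nu 0 w.
  by rewrite subr_ge0 (admissible_nd A)// ?in_itv/= ?lexx ltW.
rewrite ge0_fin_numE; last by apply: integral_ge0 => t _; rewrite lee_fin.
rewrite integral_hit//; last by move=> t _; rewrite lee_fin.
apply: (@le_lt_trans _ _ (\int[lebesgue_measure]_(u in `]0%R, (nu T w - nu 0 w)%R])
  (cst B%:E) u)%E); last first.
  rewrite integral_cst//.
  rewrite [X in (_ * X < _)%E](_ : _ = (nu T w - nu 0 w)%:E) -?EFinM ?ltry//.
  transitivity (lebesgue_measure (`]0, nu T w - nu 0 w]%classic : set R)) => //.
  rewrite lebesgue_measure_itv/= lte_fin; case: ltP => [_|c0]; first by rewrite -EFinD subr0.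
  by congr (_%:E); apply/eqP; rewrite eq_le nuT c0.
rewrite [leLHS]integral_mkcond [leRHS]integral_mkcond.
apply: ge0_le_integral => //.
- by move=> u _; rewrite /patch; case: ifP => // _; case: ifP => // _; rewrite lee_fin.
- apply: (iffLR (measurable_restrictT _ (measurable_itv _))).
  apply: measurable_funTS; apply: measurable_fun_ifT => //.
  + apply: measurable_fun_ltr => //.
    by apply: (measurableT_comp (admissible_measurable_hit A) (g := fun u => (u, w))); exact: measurable_fun_pair.
  + apply: (measurableT_comp (mhw w (D := setT)) (g := fun u => hit T nu u w)).
    by apply: (measurableT_comp (admissible_measurable_hit A) (g := fun u => (u, w))); exact: measurable_fun_pair.
- apply: (iffLR (measurable_restrictT _ (measurable_itv _))).
  exact: measurable_cst.
- move=> u _; rewrite /patch !mem_setE !in_itv/= andbT.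
  case: (ltP 0 u) => u0 //=; case: ifPn => hs.
    have -> : u <= nu T w - nu 0 w.
      by apply: (hitting_lt_le T_gt0 (@admissible_nd _ _ _ _ _ _ _ A w)); exact: lt_le_trans hs sT.
    by rewrite lee_fin.
  by case: ifP => // _; rewrite lee_fin.
Qed.

Lemma investedE nu s w : admissible P T Ft nu -> s <= T ->
  (invested nu s w)%:E = (\int[lebesgue_measure]_(u in `]0%R, +oo[)
     (if (hit T nu u w < s)%R then h (hit T nu u w) w else 0)%:E)%E.
Proof.
move=> A sT; rewrite /invested /Rintegral fineK; last exact: finite_integral.
rewrite integral_hit//; last by move=> t _; rewrite lee_fin.
by apply: eq_integral => u _; case: ifP.
Qed.

Lemma measurable_invested nu : admissible P T Ft nu ->
  measurable_fun (strip (Omega := Omega) T) (fun sw => invested nu sw.1 sw.2).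
Proof.
move=> A; have mI : measurable (`]0, +oo[%classic : set R) by exact: measurable_itv.
have := measurable_window mI (admissible_measurable_hit A) mh h0.
move=> /(measurable_funTS (D := strip T)) mW.
apply/measurable_EFinP; apply: eq_measurable_fun mW => -[s w].
by rewrite inE /strip/= in_itv/= => /andP[_ sT]; rewrite investedE.
Qed.

Lemma investedZ nu (a : {nonneg R}) s w : admissible P T Ft nu -> s <= T ->
  invested (fun t w => a%:num * nu t w) s w = a%:num * invested nu s w.
Proof.
move=> A1 sT; rewrite /invested /Rintegral integral_stieltjesZ//; first last.
- by move=> t _; rewrite lee_fin.
- exact: (admissible_nd A1).
by rewrite fineM//; exact: finite_integral.
Qed.

Lemma invested_jump nu (tau : Omega -> R) (a : {nonneg R}) s w :
  admissible P T Ft nu -> (forall w, 0 <= tau w <= T) -> s <= T ->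
  invested (fun t w => nu t w + a%:num * jump (tau w) t) s w =
  invested nu s w + a%:num * (if tau w < s then h (tau w) w else 0).
Proof.
move=> A tT sT; rewrite /invested /Rintegral integral_stieltjesD//; first last.
- by move=> t _; rewrite lee_fin.
- by move=> x z _ _; exact: jump_nd.
- exact: (admissible_nd A).
rewrite integral_jump//; first last.
- by move=> x /=; rewrite !in_itv/= => /andP[-> xs]; exact: lt_le_trans sT.
rewrite fineD ?fineM//; [|exact: finite_integral].
rewrite indicE /= mem_setE in_itv/=; case/andP: (tT w) => -> _ /=.
by case: ifP => _; rewrite ?mul1r ?mul0r.
Qed.

End invested.
End admissible_operations.

(** * Conditional expectations *)

Lemma integral_le0_negligible d (X : measurableType d) (R : realType)
    (mu : {measure set X -> \bar R}) (D : set X) (f : X -> \bar R) :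
  measurable D -> measurable_fun D f -> (forall x, D x -> (0 < f x)%E) ->
  (\int[mu]_(x in D) f x <= 0)%E -> {ae mu, forall x, ~ D x}.
Proof.
move=> mD mf f0 i0.
have : (\int[mu]_(x in D) `|f x| = 0)%E.
  rewrite (eq_integral f); last by move=> x; rewrite inE => /f0 /ltW /gee0_abs.
  by apply/eqP; rewrite eq_le i0/= integral_ge0// => x /f0 /ltW.
move=> /(ae_eq_integral_abs _ mD mf); apply: filterS => x h Dx.
by have := f0 _ Dx; rewrite h// ltxx.
Qed.

Section conditioning.
Context d (Omega : measurableType d) (R : realType) (P : probability Omega R).
Variable GG : set (set Omega).
Hypothesis GG_sigma : sigma_algebra setT GG.
Hypothesis GG_measurable : GG `<=` measurable.

Lemma sub_sigma_measurable d2 (V : measurableType d2) (Y : Omega -> V) :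
  (forall B, measurable B -> GG (Y @^-1` B)) -> measurable_fun setT Y.
Proof. by move=> mY _ B mB; rewrite setTI; apply/GG_measurable/mY. Qed.

Lemma sub_sigma_lt (X Y : Omega -> \bar R) :
  (forall B, measurable B -> GG (X @^-1` B)) ->
  (forall B, measurable B -> GG (Y @^-1` B)) -> GG [set w | (X w < Y w)%E].
Proof.
move=> mX mY; have gE (A : set (g_sigma_algebraType GG)) : measurable A = GG A.
  by rewrite -[RHS](_ : <<s GG >> A = _)// sigma_algebra_id.
rewrite -gE -[X in measurable X]setTI.
have mX' : @measurable_fun _ _ (g_sigma_algebraType GG) _ setT X.
  by move=> _ B mB; rewrite setTI gE; exact: mX.
have mY' : @measurable_fun _ _ (g_sigma_algebraType GG) _ setT Y.
  by move=> _ B mB; rewrite setTI gE; exact: mY.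
exact: (measurable_lte measurableT mX' mY').
Qed.

Variables X Y : Omega -> \bar R.
Hypothesis X_ge0 : forall w, (0 <= X w)%E.
Hypothesis Y_cond : cond_expectation P GG X Y.

Lemma cond_expectation_measurable : measurable_fun setT Y.
Proof. exact: sub_sigma_measurable Y_cond.1. Qed.

(** [cond_expectation] does not prescribe the sign of Y. On the event Y < 0 the integral of Y equals
    that of X, which is nonnegative, so the event is null. *)
Lemma cond_expectation_ge0 : {ae P, forall w, (0 <= Y w)%E}.
Proof.
have GB : GG [set w | (Y w < cst 0 w)%E].
  apply: sub_sigma_lt Y_cond.1 _ => B _; rewrite preimage_cst; case: ifP => _.
    by case: GG_sigma => G0 GC _; rewrite -(setD0 setT); exact: GC.
  by case: GG_sigma.
have mB := GG_measurable GB.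
have := Y_cond.2 _ GB.
have -> : (\int[P]_(w in [set w | (Y w < cst 0 w)%E]) Y w =
  - \int[P]_(w in [set w | (Y w < cst 0 w)%E]) - Y w)%E.
  rewrite -integral_ge0N//; first by apply: eq_integral => w _; rewrite oppeK.
  by move=> w /= /ltW; rewrite oppe_ge0.
move=> e; have i0 : (\int[P]_(w in [set w | (Y w < cst 0 w)%E]) - Y w <= 0)%E.
  by rewrite -oppe_ge0 e; apply: integral_ge0.
have := integral_le0_negligible mB _ _ i0; move=> /(_ _ _)/wrap[].
- by apply: measurableT_comp => //; apply: measurable_funTS; exact: cond_expectation_measurable.
- by move=> w /= h; rewrite oppe_gt0.
by apply: filterS => w /= /negP; rewrite -leNgt.
Qed.

(** Tested on the event Q < Y, which belongs to [GG]; since Q is bounded, its integral is finite and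
    can be cancelled. *)
Lemma cond_expectation_le (Q : Omega -> R) : (forall w, 0 <= Q w <= 1) ->
  (forall B, measurable B -> GG (Q @^-1` B)) ->
  (forall B, GG B -> \int[P]_(w in B) X w <= \int[P]_(w in B) (Q w)%:E)%E ->
  {ae P, forall w, (Y w <= (Q w)%:E)%E}.
Proof.
move=> Q01 mQ XQ; pose B := [set w | ((Q w)%:E < Y w)%E].
have GB : GG B.
  apply: sub_sigma_lt Y_cond.1 => C mC.
  by apply: (mQ (EFin @^-1` C)); rewrite -[X in measurable X]setTI; exact: EFin_measurable.
have mB := GG_measurable GB.
have mQ' : measurable_fun B (fun w => (Q w)%:E).
  by apply/measurable_EFinP/measurable_funTS; exact: sub_sigma_measurable mQ.
have mYB : measurable_fun B Y by apply: measurable_funTS; exact: cond_expectation_measurable.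
have mYQ : measurable_fun B (fun w => Y w - (Q w)%:E)%E by exact: emeasurable_funB.
have YQ0 w : B w -> (0 < Y w - (Q w)%:E)%E by move=> h; rewrite sube_gt0.
have Q0 w : (0 <= (Q w)%:E)%E by rewrite lee_fin; case/andP: (Q01 w).
have fQ : (\int[P]_(w in B) (Q w)%:E \is a fin_num)%E.
  rewrite ge0_fin_numE; last by apply: integral_ge0.
  apply: (@le_lt_trans _ _ (\int[P]_(w in B) (cst 1%E w))%E).
    by apply: ge0_le_integral => // w _; rewrite lee_fin; case/andP: (Q01 w).
  rewrite integral_cst// mul1e; apply: le_lt_trans (probability_le1 P mB) _.
  exact: ltry.
have : (\int[P]_(w in B) (Y w - (Q w)%:E) <= 0)%E.
  rewrite -(leeD2rE _ _ fQ) add0e -ge0_integralD//; last by move=> w /YQ0 /ltW.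
  apply: le_trans (XQ _ GB); rewrite -(Y_cond.2 _ GB).
  by rewrite le_eqVlt; apply/orP; left; apply/eqP; apply: eq_integral => w _; rewrite subeK.
move=> /(integral_le0_negligible mB mYQ YQ0).
by apply: filterS => w /negP; rewrite -leNgt.
Qed.

(** When g <= 0, the equation g = Y - Q reads Y + (- g) = Q with nonnegative terms, finite because Q
    is real. Before T it is integrated using the defining property of Y; from T on every term is
    0. *)
Lemma cond_expectation_decomposition (tau : Omega -> R) (T : R) (Q : Omega -> R)
    (g : Omega -> \bar R) : measurable_fun setT X ->
  GG [set w | tau w < T] -> (forall w, T <= tau w -> X w = 0%E) ->
  measurable_fun setT Q -> (forall w, 0 <= Q w) ->
  (forall w, T <= tau w -> Q w = 0%R) -> measurable_fun setT g ->
  {ae P, forall w, g w = (Y w - (Q w)%:E)%E} -> {ae P, forall w, (g w <= 0)%E} ->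
  (\int[P]_w X w + \int[P]_w (if (tau w < T)%R then maxe (- g w) 0 else 0) =
   \int[P]_w (Q w)%:E)%E.
Proof.
move=> mX GA X0 mQ Q0 QT mg gE g0; pose A := [set w | tau w < T].
have mA := GG_measurable GA.
have restrictA (f : Omega -> \bar R) : (forall w, T <= tau w -> f w = 0%E) ->
    (\int[P]_w f w = \int[P]_(w in A) f w)%E.
  move=> f0; rewrite [RHS]integral_mkcond; apply: eq_integral => w _.
  rewrite /patch /A; case: (ltP (tau w) T) => h; first by rewrite mem_set.
  by rewrite f0// memNset//= ltNge h.
have mY := cond_expectation_measurable.
rewrite (restrictA X)// (restrictA (fun w => (Q w)%:E)); last by move=> w /QT ->.
rewrite (restrictA (fun w => (if (tau w < T)%R then maxe (- g w) 0 else 0)%E)); last first.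
  by move=> w; rewrite leNgt => /negbTE ->.
rewrite -(Y_cond.2 _ GA).
have -> : (\int[P]_(w in A) Y w = \int[P]_(w in A) maxe (Y w) 0)%E.
  apply: ae_eq_integral => //; first exact: measurable_funTS.
    by apply: measurable_funTS; exact: measurable_maxe.
  by move: cond_expectation_ge0; apply: filterS => w /max_idPl ->.
have -> : (\int[P]_(w in A) (if (tau w < T)%R then maxe (- g w) 0 else 0) =
    \int[P]_(w in A) maxe (- g w) 0)%E.
  by apply: eq_integral => w; rewrite inE /A /= => ->.
have mYp : measurable_fun A (fun w => maxe (Y w) 0)%E.
  by apply: measurable_funTS; exact: measurable_maxe.
have mgn : measurable_fun A (fun w => maxe (- g w) 0)%E.
  by apply: measurable_funTS; apply: measurable_maxe => //; exact: measurableT_comp.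
rewrite -ge0_integralD//; last 2 first.
- by move=> w _; rewrite le_max lexx orbT.
- by move=> w _; rewrite le_max lexx orbT.
apply: ge0_ae_eq_integral => //.
- exact: emeasurable_funD.
- by apply/measurable_EFinP; exact: measurable_funTS.
- by move=> w _; rewrite adde_ge0// le_max lexx orbT.
- by move=> w _; rewrite lee_fin.
move: cond_expectation_ge0 gE g0; apply: filterS3 => w Yw0 -> gw0 _.
move: Yw0 gw0; case: (Y w) => [r| |]//.
rewrite -EFinD !lee_fin => r0 rQ; rewrite -EFinN.
have -> : (maxe r%:E 0 = r%:E)%E by apply/max_idPl; rewrite lee_fin.
have -> : (maxe (- (r - Q w))%:E 0 = (- (r - Q w))%:E)%E by apply/max_idPl; rewrite lee_fin oppr_ge0.
by rewrite -EFinD; congr (_%:E); lra.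
Qed.

End conditioning.

Section stopped_algebra.
Context d (Omega : measurableType d) (R : realType).
Variables (P : probability Omega R) (T : R) (Ft : R -> set (set Omega)).
Hypothesis uFt : usual_conditions P T Ft.

Lemma stopped_sigma_algebraP (tau : Omega -> R) : stopping_time P T Ft tau ->
  sigma_algebra setT (stopped_sigma_algebra T Ft tau).
Proof.
move=> st.
have F0 t : Ft t set0 by rewrite -(setCT); apply: (usual_C uFt); exact: (usual_T uFt).
split.
- by split => // t _; rewrite set0I.
- by move=> A; rewrite setTD; exact: (stopped_C uFt st).
- move=> A hA; split; first by apply: (usual_bigcup uFt) => n; case: (hA n).
  move=> t tT; rewrite setI_bigcupl; apply: (usual_bigcup uFt) => n.
  by case: (hA n) => _; exact.
Qed.

End stopped_algebra.

(** * The investment problem for regularized data *)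

Lemma double_integralD_le d (Omega : measurableType d) (R : realType)
    (P : probability Omega R) (T : R) (f1 g1 f2 g2 : R -> Omega -> \bar R) :
  strip_measurable T f1 -> strip_measurable T g1 -> strip_ge0 T f1 -> strip_ge0 T g1 ->
  strip_measurable T f2 -> strip_measurable T g2 -> strip_ge0 T f2 -> strip_ge0 T g2 ->
  (forall s w, s \in `[0, T] -> (f1 s w + g1 s w <= f2 s w + g2 s w)%E) ->
  (double_integral P T f1 + double_integral P T g1 <=
   double_integral P T f2 + double_integral P T g2)%E.
Proof.
move=> mf1 mg1 f10 g10 mf2 mg2 f20 g20 fg.
rewrite -(double_integralD P mf1 mg1 f10 g10) -(double_integralD P mf2 mg2 f20 g20).
apply: double_integral_le => //.
- exact: emeasurable_funD.
- exact: emeasurable_funD.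
- by move=> s w sT; rewrite adde_ge0 ?f10 ?g10.
Qed.

Lemma lee_finD2 (R : realType) (a b c d : R) : a + b <= c + d ->
  (a%:E + b%:E <= c%:E + d%:E)%E.
Proof. by move=> h; rewrite -!EFinD lee_fin. Qed.

(** From sums back to net profits: a and e are the revenue and cost of a competitor, b and c those
    of the candidate. A competitor of infinite cost has net profit -oo. *)
Lemma ereal_exchange (R : realType) (a b c e : \bar R) :
  (0 <= a)%E -> (0 <= b)%E -> (0 <= c)%E -> (0 <= e)%E ->
  (b < +oo)%E -> (c < +oo)%E -> (a + c <= b + e)%E -> (a - e <= b - c)%E.
Proof.
case: a => [a| |]// ; case: b => [b| |]//; case: c => [c| |]//; case: e => [e| |]//.
- by rewrite -!EFinD !lee_fin; lra.
- by move=> *; rewrite addeC addNye leNye.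
- by move=> *; exact: leNye.
Qed.

Lemma ereal_minuend_lty (R : realType) (a b : \bar R) :
  (0 <= b)%E -> (b < +oo)%E -> (a - b < +oo)%E -> (a < +oo)%E.
Proof. by case: a => [a| |]; case: b => [b| |] //= *; rewrite ?ltry. Qed.

Lemma ereal_diff_finite (R : realType) (a b : \bar R) : (0 <= a)%E -> (0 <= b)%E ->
  (a - b)%E \is a fin_num -> (a < +oo)%E /\ (b < +oo)%E.
Proof. by case: a => [a| |]; case: b => [b| |] //= *; rewrite !ltry. Qed.

Lemma ereal_unexchange (R : realType) (a b c e : \bar R) :
  (0 <= a)%E -> (0 <= b)%E -> (0 <= c)%E -> (0 <= e)%E ->
  (b < +oo)%E -> (c < +oo)%E -> (e < +oo)%E -> (a - e <= b - c)%E -> (a + c <= b + e)%E.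
Proof.
case: a => [a| |]; case: b => [b| |]; case: c => [c| |]; case: e => [e| |] //.
by rewrite -!EFinD !lee_fin; lra.
Qed.

Lemma ereal_scale_lty (R : realType) (x : \bar R) (k : R) : 0 < k ->
  (k%:E * x < +oo)%E -> (x < +oo)%E.
Proof. by move=> k0; case: x => [x| |]; rewrite ?ltry// gt0_muley. Qed.

(** In use, a and c are revenue and cost of the optimal plan, r the revenue after a jump of size k,
    e the unit cost of the jump, and x and j the pairings, at the jumped plan, with the old plan and
    with the unit jump. The hypotheses [h1], [h2], [h3] of the proof are optimality, the tangent
    inequality, and the bound that makes x and j finite. *)
Lemma ereal_jump_step (R : realType) (a c e x j r : \bar R) (k : R) : 0 < k ->
  (0 <= a)%E -> (0 <= c)%E -> (0 <= e)%E -> (0 <= x)%E -> (0 <= j)%E ->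
  (a < +oo)%E -> (c < +oo)%E -> (e < +oo)%E -> (r < +oo)%E ->
  (r + c <= a + (c + k%:E * e))%E -> (a + (x + k%:E * j) <= r + x)%E ->
  (x + k%:E * j <= r)%E -> (j <= e)%E.
Proof.
move=> k0 a0 c0 e0 x0 j0 afin cfin efin rfin h1 h2 h3.
have k0' : (0 <= k%:E)%E by rewrite lee_fin ltW.
have xj : (x + k%:E * j < +oo)%E := le_lt_trans h3 rfin.
have xfin : (x < +oo)%E := le_lt_trans (leeDl _ (mule_ge0 k0' j0)) xj.
have r0 : (0 <= r)%E by apply: le_trans h3; rewrite adde_ge0// mule_ge0.
have jfin := ereal_scale_lty k0 (le_lt_trans (leeDr _ x0) xj).
move: a0 c0 e0 x0 j0 r0 afin cfin efin rfin xfin jfin h1 h2; clear -k0.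
case: a => [a| |]; case: c => [c| |] //; case: e => [e| |] //; case: x => [x| |] //.
case: j => [j| |] //; case: r => [r| |] //.
rewrite -!EFinM -!EFinD !lee_fin => _ _ _ _ _ _ _ _ _ _ _ _ h1 h2.
have : k * j <= k * e by lra.
by rewrite ler_pM2l.
Qed.

(** In use, a and c are revenue and cost of the optimal plan, b the revenue of the plan scaled by k,
    and x the pairing at the scaled plan with the full one. Tangent and optimality add up to (1 - k)
    c <= (1 - k) x. *)
Lemma ereal_scaling_step (R : realType) (a b c x : \bar R) (k : R) : 0 < k -> k < 1 ->
  (0 <= a)%E -> (0 <= b)%E -> (0 <= c)%E -> (0 <= x)%E ->
  (a < +oo)%E -> (c < +oo)%E -> (b < +oo)%E -> (x < +oo)%E ->
  (a + k%:E * x <= b + x)%E -> (b + c <= a + k%:E * c)%E -> (c <= x)%E.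
Proof.
move=> k0 k1; case: a => [a| |]; case: b => [b| |]; case: c => [c| |]; case: x => [x| |] //.
rewrite -!EFinM -!EFinD !lee_fin => _ _ _ _ _ _ _ _ h1 h2.
have : (1 - k) * c <= (1 - k) * x by lra.
by rewrite ler_pM2l// subr_gt0.
Qed.

Lemma ereal_add_le_cancel (R : realType) (a r : \bar R) : (0 <= r)%E -> (0 <= a)%E ->
  (a < +oo)%E -> (a + r <= a)%E -> r = 0%E.
Proof.
case: a => [a| |]; case: r => [r| |] //.
by rewrite -EFinD !lee_fin => r0 _ _ h; congr (_%:E); lra.
Qed.

Lemma cvg_EFin_real (R : realType) (u : nat -> R) (l : R) :
  u n @[n --> \oo] --> l -> (u n)%:E @[n --> \oo] --> l%:E.
Proof. by move=> ul; apply: cvg_EFin => //; exact: nearW. Qed.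

Lemma measurable_section_at d1 d2 d3 (T1 : measurableType d1) (T2 : measurableType d2)
    (T3 : measurableType d3) (f : T1 * T2 -> T3) (x : T1) :
  measurable_fun setT f -> measurable_fun setT (fun z => f (x, z)).
Proof. by move=> mf; apply: (measurableT_comp mf); exact: measurable_fun_pair. Qed.

Lemma tangent_scaling (R : realType) (f1 f2 g1 e z c a b : R) :
  e * f2 <= e * (f1 + g1 * (z * (c + b) - z * (c + a))) ->
  e * f2 + e * z * g1 * a <= e * f1 + e * z * g1 * b.
Proof. lra. Qed.

Lemma tangent_at0 (R : realType) (f1 g1 e z c a : R) :
  e * 0 <= e * (f1 + g1 * (z * c - z * (c + a))) -> e * z * g1 * a <= e * f1.
Proof. lra. Qed.

(* dl, Z and h are the discount factor, C^0 and f_C / C^0, extended to all real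
   times by their values at the nearest time in [0, T]: they are then jointly
   measurable and bounded on the whole line. *)
Section reduced_problem.
Context d (Omega : measurableType d) (R : realType).
Variables (P : probability Omega R) (T : R) (Ft : R -> set (set Omega)).
Hypothesis T_gt0 : 0 < T.
Hypothesis uFt : usual_conditions P T Ft.
Variables (F : R -> R) (y : R) (dl Z h : R -> Omega -> R) (d0 : R).
Hypothesis F_production : production_function F.
Hypothesis y_gt0 : 0 < y.
Hypothesis dl_meas : measurable_fun setT (fun tw : R * Omega => dl tw.1 tw.2).
Hypothesis Z_meas : measurable_fun setT (fun tw : R * Omega => Z tw.1 tw.2).
Hypothesis h_meas : measurable_fun setT (fun tw : R * Omega => h tw.1 tw.2).
Hypothesis d0_gt0 : 0 < d0.
Hypothesis dl_ge : forall t w, d0 <= dl t w.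
Hypothesis dl_le1 : forall t w, dl t w <= 1.
Hypothesis Z_gt0 : forall t w, 0 < Z t w.
Hypothesis h_ge0 : forall t w, 0 <= h t w.
Hypothesis h_bdd : forall w, exists B, forall t, h t w <= B.
Implicit Types nu : R -> Omega -> R.

Local Notation adm := (admissible P T Ft).
Local Notation Acc := (invested T h).
Local Notation U := (`]0, +oo[%classic : set R).

Let dl_ge0 t w : 0 <= dl t w.
Proof. exact: le_trans (ltW d0_gt0) (dl_ge t w). Qed.

Definition reduced_capacity nu s w := Z s w * (y + invested T h nu s w).
Local Notation Cap := reduced_capacity.

(** The derivative of the discounted revenue rate with respect to the accumulated investment; the
    chain rule contributes the factor Z. *)
Definition reduced_density nu s w := dl s w * Z s w * derive1 F (reduced_capacity nu s w).
Local Notation mrg := reduced_density.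

Definition reduced_revenue nu := double_integral P T (fun s w => (dl s w * F (reduced_capacity nu s w))%:E).
Local Notation Rev := reduced_revenue.

Definition reduced_cost nu : \bar R :=
  (\int[P]_w \int[stieltjes T (nu ^~ w)]_(t in `[0%R, T[) (dl t w)%:E)%E.
Local Notation Cost := reduced_cost.

(** The pairing of the marginal revenue at [nu1] with d [nu2], written over time; [reduced_pairingE]
    rewrites it over levels. *)
Definition reduced_pairing nu1 nu2 :=
  double_integral P T (fun s w => (reduced_density nu1 s w * invested T h nu2 s w)%:E).
Local Notation L := reduced_pairing.

Definition reduced_gain nu t w : \bar R :=
  (\int[lebesgue_measure]_(s in `[t, T]) (h t w * reduced_density nu s w)%:E)%E.
Local Notation Phi := reduced_gain.

Lemma reduced_capacity_gt0 nu s w : 0 < Cap nu s w.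
Proof. by rewrite mulr_gt0// ltr_wpDr// invested_ge0. Qed.

Lemma measurable_reduced_capacity nu : adm nu ->
  measurable_fun (strip (Omega := Omega) T) (fun sw => Cap nu sw.1 sw.2).
Proof.
move=> A; apply: measurable_funM; first exact: measurable_funTS.
apply: measurable_funD => //.
exact: (measurable_invested T_gt0 uFt).
Qed.

Lemma reduced_density_ge0 nu s w : 0 <= mrg nu s w.
Proof.
apply: mulr_ge0; first by rewrite mulr_ge0// ltW.
exact: (production_derive_ge0 F_production (reduced_capacity_gt0 _ _ _)).
Qed.

Lemma measurable_reduced_density nu : adm nu ->
  measurable_fun (strip (Omega := Omega) T) (fun sw => mrg nu sw.1 sw.2).
Proof.
move=> A; apply: measurable_funM.
  by apply: measurable_funM; exact: measurable_funTS.
apply: (production_derive_measurable_comp F_production (g := fun sw : R * Omega => Cap nu sw.1 sw.2)).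
  by move=> sw; exact: reduced_capacity_gt0.
exact: measurable_reduced_capacity.
Qed.

Lemma measurable_reduced_revenue nu : adm nu ->
  strip_measurable (Omega := Omega) T (fun s w => (dl s w * F (Cap nu s w))%:E).
Proof.
move=> A; apply/measurable_EFinP; apply: measurable_funM; first exact: measurable_funTS.
apply: (production_measurable_comp F_production (g := fun sw : R * Omega => Cap nu sw.1 sw.2)).
  by move=> sw; exact: reduced_capacity_gt0.
exact: measurable_reduced_capacity.
Qed.

Lemma reduced_revenue_ge0 nu : strip_ge0 T (fun s w => (dl s w * F (Cap nu s w))%:E).
Proof.
move=> s w _; rewrite lee_fin mulr_ge0//.
exact: (production_ge0 F_production (reduced_capacity_gt0 _ _ _)).
Qed.

Lemma measurable_reduced_pairing nu1 nu2 : adm nu1 -> adm nu2 ->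
  strip_measurable (Omega := Omega) T (fun s w => (mrg nu1 s w * Acc nu2 s w)%:E).
Proof.
move=> A1 A2; apply/measurable_EFinP; apply: measurable_funM; first exact: measurable_reduced_density.
exact: (measurable_invested T_gt0 uFt).
Qed.

Lemma reduced_pairing_ge0 nu1 nu2 : strip_ge0 T (fun s w => (mrg nu1 s w * Acc nu2 s w)%:E).
Proof.
by move=> s w _; rewrite lee_fin mulr_ge0// ?reduced_density_ge0// invested_ge0.
Qed.

(** The tangent to F at the capacity of [nu1], weighted by the discount. Both plans start from the
    same y, so only the accumulated investments remain; the additive form allows infinite terms. *)
Lemma reduced_revenue_tangent nu1 nu2 : adm nu1 -> adm nu2 ->
  (Rev nu2 + L nu1 nu1 <= Rev nu1 + L nu1 nu2)%E.
Proof.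
move=> A1 A2.
apply: double_integralD_le; try exact: reduced_revenue_ge0; try exact: reduced_pairing_ge0.
- exact: measurable_reduced_revenue.
- exact: measurable_reduced_pairing.
- exact: measurable_reduced_revenue.
- exact: measurable_reduced_pairing.
move=> s w sT; apply: lee_finD2; rewrite /reduced_density.
have := production_tangent F_production (reduced_capacity_gt0 nu1 s w) (reduced_capacity_gt0 nu2 s w).
move=> /(ler_wpM2l (dl_ge0 s w)); rewrite /reduced_capacity.
exact: tangent_scaling.
Qed.

(** The tangent at the capacity of nu, evaluated at the capacity Z y without investment, where F >=
    0. In the necessity part this is the source of finite pairings. *)
Lemma reduced_pairing_le_revenue nu : adm nu -> (L nu nu <= Rev nu)%E.
Proof.
move=> A; apply: double_integral_le.
- exact: measurable_reduced_pairing.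
- exact: measurable_reduced_revenue.
- exact: reduced_pairing_ge0.
move=> s w sT; rewrite lee_fin.
have Zy : 0 < Z s w * y by rewrite mulr_gt0.
have := production_tangent F_production (reduced_capacity_gt0 nu s w) Zy.
have := production_ge0 F_production Zy.
move=> a b; move: (ler_wpM2l (dl_ge0 s w) (le_trans a b)).
rewrite /reduced_density /reduced_capacity; exact: tangent_at0.
Qed.

(** The lower limit of integration becomes an indicator on a fixed domain; the end point s = t that
    is lost is Lebesgue null. *)
Lemma reduced_gainE nu t w : adm nu -> 0 <= t -> Phi nu t w =
  (\int[lebesgue_measure]_(s in `[0%R, T]) (if (t < s)%R then h t w * mrg nu s w else 0)%:E)%E.
Proof.
move=> A t0; rewrite /reduced_gain.
have sub : `]t, T]%classic `<=` `[0, T]%classic.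
  by move=> s /=; rewrite !in_itv/= => /andP[ts ->]; rewrite (le_trans t0 (ltW ts)).
have mm : measurable_fun `[0, T] (fun s => (mrg nu s w)%:E).
  apply: (strip_section (f := fun s w => (mrg nu s w)%:E)).
  by apply/measurable_EFinP; exact: measurable_reduced_density.
rewrite -integral_itv_obnd_cbnd; last first.
  have := measurable_funeM (h t w)%:E (measurable_funS (measurable_itv _) sub mm).
  by apply: eq_measurable_fun => s _; rewrite EFinM.
rewrite [LHS]integral_mkcond [RHS]integral_mkcond; apply: eq_integral => s _.
rewrite /patch !mem_setE !in_itv/=; case: (ltP t s) => ts /=; last by case: ifP.
by rewrite (le_trans t0 (ltW ts)).
Qed.

Lemma measurable_at_time (g : R -> Omega -> \bar R) (tau : R -> Omega -> R) :
  strip_measurable T g -> measurable_fun setT (fun uw : R * Omega => tau uw.1 uw.2) ->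
  (forall u w, 0 <= tau u w <= T) ->
  measurable_fun setT (fun uw : R * Omega => g (tau uw.1 uw.2) uw.2).
Proof.
move=> mg mt tT.
apply: (measurable_comp (F := strip T) (f := fun sw => g sw.1 sw.2) _ _ mg
  (measurable_fun_pair mt measurable_snd)).
  exact: measurable_strip.
by move=> _ [uw _ <-]; rewrite /strip/= in_itv/=.
Qed.

Lemma reduced_pairing_hit (I : set R) nu1 nu2 : adm nu1 -> adm nu2 -> measurable I ->
  double_integral P T (fun s w => (mrg nu1 s w)%:E * \int[lebesgue_measure]_(u in I)
    (if (hit T nu2 u w < s)%R then h (hit T nu2 u w) w else 0)%:E)%E =
  (\int[lebesgue_measure]_(u in I) \int[P]_w Phi nu1 (hit T nu2 u w) w)%E.
Proof.
move=> A1 A2 mI; rewrite /double_integral.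
rewrite (tonelli_invested P mI (admissible_measurable_hit T_gt0 uFt A2) h_meas h_ge0).
- apply: eq_integral => u _; apply: eq_integral => w _; rewrite reduced_gainE//.
  by case/andP: (hit_itv T_gt0 nu2 u w).
- exact: measurable_reduced_density.
- by move=> s w _; exact: reduced_density_ge0.
Qed.

Lemma measurable_reduced_gain nu1 (tau : R -> Omega -> R) : adm nu1 ->
  measurable_fun setT (fun uw : R * Omega => tau uw.1 uw.2) ->
  (forall u w, 0 <= tau u w <= T) ->
  measurable_fun setT (fun uw : R * Omega => Phi nu1 (tau uw.1 uw.2) uw.2).
Proof.
move=> A1 mt tT.
have := measurable_invested_time mt h_meas h_ge0 (measurable_reduced_density A1)
  (fun s w _ => reduced_density_ge0 nu1 s w).
by apply: eq_measurable_fun => -[u w] _; rewrite /= reduced_gainE//; case/andP: (tT u w).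
Qed.

Lemma reduced_gain_ge0 nu t w : (0 <= Phi nu t w)%E.
Proof. by apply: integral_ge0 => s _; rewrite lee_fin mulr_ge0// reduced_density_ge0. Qed.

Lemma reduced_gainT nu w : Phi nu T w = 0%E.
Proof. by rewrite /Phi /reduced_gain set_itv1 integral_set1. Qed.

Lemma reduced_pairingE nu1 nu2 : adm nu1 -> adm nu2 ->
  L nu1 nu2 = (\int[lebesgue_measure]_(u in U) \int[P]_w Phi nu1 (hit T nu2 u w) w)%E.
Proof.
move=> A1 A2; rewrite -(reduced_pairing_hit A1 A2 (measurable_itv _)).
apply: eq_double_integral => s w; rewrite in_itv/= => /andP[_ sT].
by rewrite EFinM (investedE T_gt0 uFt).
Qed.

Lemma stieltjes_hit nu (g : R -> Omega -> \bar R) : adm nu ->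
  strip_measurable T g -> strip_ge0 T g ->
  (\int[P]_w \int[stieltjes T (nu ^~ w)]_(t in `[0%R, T[) g t w =
   \int[lebesgue_measure]_(u in U) \int[P]_w
     (if (hit T nu u w < T)%R then g (hit T nu u w) w else 0))%E.
Proof.
move=> A mg g0.
have hT u w := hit_itv T_gt0 nu u w.
rewrite -tonelli_random_time.
- apply: eq_integral => w _; apply: (integral_hit T_gt0 w A (lexx T)).
    apply: measurable_funS (strip_section w mg) => // t /=.
    by rewrite !in_itv/= => /andP[-> /ltW].
  by move=> t; rewrite in_itv/= => /andP[t0 tT]; rewrite g0// in_itv/= t0 ltW.
- exact: measurable_itv.
- apply: measurable_fun_ifT.
  + apply: measurable_fun_ltr; last exact: measurable_cst.
    exact: (admissible_measurable_hit T_gt0 uFt A).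
  + by apply: measurable_at_time => //; exact: (admissible_measurable_hit T_gt0 uFt A).
  + exact: measurable_cst.
- by move=> u w; case: ifP => // _; rewrite g0// in_itv/= hT.
Qed.

Lemma measurable_stieltjes_integral nu (g : R -> Omega -> \bar R) : adm nu ->
  strip_measurable T g -> strip_ge0 T g ->
  measurable_fun setT (fun w => \int[stieltjes T (nu ^~ w)]_(t in `[0%R, T[) g t w)%E.
Proof.
move=> A mg g0.
have hT u w := hit_itv T_gt0 nu u w.
have mhit := admissible_measurable_hit T_gt0 uFt A.
pose k (z : Omega * measurableTypeR R) : \bar R :=
  if (0 < z.2)%R then if (hit T nu z.2 z.1 < T)%R then g (hit T nu z.2 z.1) z.1 else 0%E else 0%E.
have mk : measurable_fun setT k.
  have sw : measurable_fun setT (fun z : Omega * measurableTypeR R => (z.2 : R, z.1)).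
    by apply: measurable_fun_pair; [exact: measurable_snd|exact: measurable_fst].
  apply: measurable_fun_ifT => //; first by apply: measurable_fun_ltr => //; exact: measurable_snd.
  apply: measurable_fun_ifT => //.
    by apply: measurable_fun_ltr => //; exact: (measurableT_comp mhit sw).
  exact: (measurableT_comp (measurable_at_time mg mhit hT) sw).
have k0 z : (0 <= k z)%E.
  by rewrite /k; case: ifP => // _; case: ifP => // _; rewrite g0// in_itv/= hT.
have := measurable_fun_fubini_tonelli_F (m2 := lebesgue_measure) k mk k0.
apply: eq_measurable_fun => w _; rewrite /fubini_F.
rewrite (integral_hit T_gt0 w A (lexx T)).
- rewrite [RHS]integral_mkcond; apply: eq_integral => u _.
  by rewrite /k /patch/= mem_setE in_itv/= andbT.
- apply: measurable_funS (strip_section w mg) => // t /=.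
  by rewrite !in_itv/= => /andP[-> /ltW].
- by move=> t; rewrite in_itv/= => /andP[t0 tT]; rewrite g0// in_itv/= t0 ltW.
Qed.

Lemma measurable_reduced_gain_at nu (tau : Omega -> R) : adm nu ->
  measurable_fun setT tau -> (forall w, 0 <= tau w <= T) ->
  measurable_fun setT (fun w => Phi nu (tau w) w).
Proof.
move=> A mt tT.
have mt2 : measurable_fun setT (fun uw : R * Omega => tau uw.2).
  exact: (measurableT_comp mt measurable_snd).
exact: (measurable_section_at (0 : R) (measurable_reduced_gain A (tau := fun _ => tau) mt2 (fun _ => tT))).
Qed.

Lemma reduced_costE nu : adm nu -> Cost nu = (\int[lebesgue_measure]_(u in U) \int[P]_w
  (dl (hit T nu u w) w * (hit T nu u w < T)%R%:R)%:E)%E.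
Proof.
move=> A; have mdl : strip_measurable (Omega := Omega) T (fun t w => (dl t w)%:E).
  by apply/measurable_EFinP; exact: measurable_funTS.
have dl0 : strip_ge0 (Omega := Omega) T (fun t w => (dl t w)%:E).
  by move=> t w _; rewrite lee_fin.
rewrite /reduced_cost (stieltjes_hit A mdl dl0).
apply: eq_integral => u _; apply: eq_integral => w _.
by case: ifP; rewrite ?mulr1 ?mulr0.
Qed.

Variable Kst : R.
(** [Z s w * h (tau w) w] is the capacity at time s produced by one unit invested at tau; the bound
    is uniform in tau and s. *)
Hypothesis stopped_bound : forall (tau : Omega -> R) (s : R), stopping_time P T Ft tau ->
  (forall w, 0 <= tau w <= T) -> s \in `[0, T] ->
  (\int[P]_(w in [set w | (tau w < s)%R]) (Z s w * h (tau w) w)%:E <=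
   Kst%:E * P [set w | (tau w < s)%R])%E.
Hypothesis dl_stopped : forall (tau : Omega -> R) (B : set R), stopping_time P T Ft tau ->
  (forall w, 0 <= tau w <= T) -> measurable B ->
  stopped_sigma_algebra T Ft tau [set w | B (dl (tau w) w)].

Definition reduced_supergradient nu (G : R -> Omega -> \bar R) :=
  strip_measurable T G /\ forall tau : Omega -> R, stopping_time P T Ft tau ->
  (forall w, 0 <= tau w <= T) -> exists2 Y : Omega -> \bar R,
    cond_expectation P (stopped_sigma_algebra T Ft tau) (fun w => Phi nu (tau w) w) Y &
    {ae P, forall w, G (tau w) w = (Y w - (dl (tau w) w * (tau w < T)%R%:R)%:E)%E}.

(** The sign of G is known almost surely at each stopping time separately. This negative part is
    nonnegative everywhere, so Tonelli applies to it without exceptional sets. *)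
Definition reduced_loss (G : R -> Omega -> \bar R) t w : \bar R := maxe (- G t w)%E 0%E.

(** * Consequences of the sign condition *)

Section supergradient_theory.
Variables (nu : R -> Omega -> R) (G : R -> Omega -> \bar R).
Hypothesis nuA : adm nu.
Hypothesis G_super : reduced_supergradient nu G.

Let G_nonpositive := forall tau : Omega -> R, stopping_time P T Ft tau ->
  (forall w, 0 <= tau w <= T) -> {ae P, forall w, (G (tau w) w <= 0)%E}.

Local Notation loss := (reduced_loss G).

Let mloss : strip_measurable T loss.
Proof.
by apply: measurable_maxe => //; apply: measurableT_comp => //; case: G_super.
Qed.

Lemma reduced_loss_ge0 t w : (0 <= loss t w)%E. Proof. by rewrite le_max lexx orbT. Qed.

Lemma measurable_discount_at (tau : Omega -> R) : measurable_fun setT tau ->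
  measurable_fun setT (fun w => dl (tau w) w * (tau w < T)%R%:R).
Proof.
move=> mt; apply: measurable_funM.
  by apply: (measurableT_comp dl_meas (g := fun w => (tau w, w))); exact: measurable_fun_pair.
have -> : (fun w => (tau w < T)%R%:R) = (fun w => if tau w < T then 1 else 0) :> (Omega -> R).
  by apply/funext => w; case: ifP.
by apply: measurable_fun_ifT => //; exact: measurable_fun_ltr.
Qed.

Lemma reduced_decomposition (tau : Omega -> R) : stopping_time P T Ft tau ->
  (forall w, 0 <= tau w <= T) -> {ae P, forall w, (G (tau w) w <= 0)%E} ->
  (\int[P]_w Phi nu (tau w) w + \int[P]_w (if (tau w < T)%R then loss (tau w) w else 0) =
   \int[P]_w (dl (tau w) w * (tau w < T)%R%:R)%:E)%E.
Proof.
move=> st tT g0; case: G_super => mG /(_ _ st tT)[Y Yc GE].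
have mt := stopping_measurable uFt st tT.
apply: (cond_expectation_decomposition (stopped_sigma_algebraP uFt st) _ _ Yc _ _ _ _ _ _ _ GE g0).
- exact: (stopped_sub uFt).
- by move=> w; exact: reduced_gain_ge0.
- exact: measurable_reduced_gain_at.
- exact: (stopped_ltT T_gt0 uFt st tT).
- move=> w Tt; have -> : tau w = T by apply/eqP; rewrite eq_le Tt andbT; case/andP: (tT w).
  exact: reduced_gainT.
- exact: measurable_discount_at.
- by move=> w; rewrite mulr_ge0.
- by move=> w; rewrite leNgt => /negbTE ->; rewrite mulr0.
- have mt2 : measurable_fun setT (fun uw : R * Omega => tau uw.2).
    exact: (measurableT_comp mt measurable_snd).
  exact: (measurable_section_at (0 : R) (measurable_at_time mG (tau := fun _ => tau) mt2 (fun _ => tT))).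
Qed.

(** [reduced_decomposition] at each hitting time of [nu'], integrated over the levels in I. It is
    applied to nu itself, to competitors, and to bounded windows while the cost is not yet known to
    be finite. *)
Lemma reduced_window nu' (I : set R) : adm nu' -> G_nonpositive -> measurable I ->
  (\int[lebesgue_measure]_(u in I) \int[P]_w Phi nu (hit T nu' u w) w +
   \int[lebesgue_measure]_(u in I) \int[P]_w
     (if (hit T nu' u w < T)%R then loss (hit T nu' u w) w else 0) =
   \int[lebesgue_measure]_(u in I) \int[P]_w
     (dl (hit T nu' u w) w * (hit T nu' u w < T)%R%:R)%:E)%E.
Proof.
move=> A' G0 mI.
have hT u w := hit_itv T_gt0 nu' u w.
have mhit := admissible_measurable_hit T_gt0 uFt A'.
have st u := admissible_hit_stopping T_gt0 uFt u A'.
rewrite -ge0_integralD//.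
- by apply: eq_integral => u _; apply: reduced_decomposition => //; exact: G0.
- by move=> u _; apply: integral_ge0 => w _; exact: reduced_gain_ge0.
- apply: measurable_funTS.
  apply: (measurable_expectation P (f := fun u w => Phi nu (hit T nu' u w) w)).
    exact: (measurable_reduced_gain nuA mhit hT).
  by move=> u w; exact: reduced_gain_ge0.
- by move=> u _; apply: integral_ge0 => w _; case: ifP => // _; exact: reduced_loss_ge0.
- apply: measurable_funTS.
  apply: (measurable_expectation P
      (f := fun u w => if (hit T nu' u w < T)%R then loss (hit T nu' u w) w else 0%E)).
    apply: measurable_fun_ifT => //; first by apply: measurable_fun_ltr.
    by apply: measurable_at_time.
  by move=> u w; case: ifP => // _; exact: reduced_loss_ge0.
Qed.

(** At the hitting times of nu the positive part of G vanishes almost surely. By Tonelli its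
    integral against d nu is 0 for almost every w, and only the loss remains. *)
Lemma reduced_supergradient_integral : G_nonpositive ->
  (\int[P]_w \int[stieltjes T (nu ^~ w)]_(t in `[0%R, T[) G t w =
   - \int[lebesgue_measure]_(u in U) \int[P]_w
     (if (hit T nu u w < T)%R then loss (hit T nu u w) w else 0))%E.
Proof.
move=> G0; case: (G_super) => mG _.
pose gp t w : \bar R := maxe (G t w) 0%E.
have mgp : strip_measurable T gp by exact: measurable_maxe.
have gp0 : strip_ge0 T gp by move=> t w _; rewrite le_max lexx orbT.
have l0 : strip_ge0 T loss by move=> t w _; exact: reduced_loss_ge0.
have mip := measurable_stieltjes_integral nuA mgp gp0.
have mil := measurable_stieltjes_integral nuA mloss l0.
have ip0 : (\int[P]_w \int[stieltjes T (nu ^~ w)]_(t in `[0%R, T[) gp t w = 0)%E.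
  rewrite stieltjes_hit//; apply: integral0_eq => u _.
  have st := admissible_hit_stopping T_gt0 uFt u nuA.
  have hT w := hit_itv T_gt0 nu u w.
  have mt := stopping_measurable uFt st hT.
  have mt2 : measurable_fun setT (fun uw : R * Omega => hit T nu u uw.2).
    exact: (measurableT_comp mt measurable_snd).
  transitivity (\int[P]_(w in setT) (cst 0 w : \bar R))%E; last by rewrite integral0.
  apply: ae_eq_integral => //.
    apply: measurable_fun_ifT => //; first exact: measurable_fun_ltr.
    exact: (measurable_section_at (0 : R)
      (measurable_at_time mgp (tau := fun _ => hit T nu u) mt2 (fun _ => hT))).
  move: (G0 _ st hT); apply: filterS => w gw _; case: ifP => // _.
  by apply/max_idPr.
rewrite -(stieltjes_hit nuA mloss l0) -integral_ge0N; last first.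
  by move=> w _; apply: integral_ge0 => t _; exact: reduced_loss_ge0.
apply: ae_eq_integral => //.
- rewrite (_ : (fun w => _) = (fun w => \int[stieltjes T (nu ^~ w)]_(t in `[0%R, T[) gp t w -
    \int[stieltjes T (nu ^~ w)]_(t in `[0%R, T[) loss t w)%E); first exact: emeasurable_funB.
  apply/funext => w; rewrite integralE; congr (_ - _)%E; apply: eq_integral => t _.
    by rewrite funeposE.
  by rewrite funenegE.
- exact: measurableT_comp.
have : ae_eq P setT (fun w => \int[stieltjes T (nu ^~ w)]_(t in `[0%R, T[) gp t w)%E (cst 0%E).
  apply/(ae_eq_integral_abs _ measurableT mip); rewrite -[RHS]ip0; apply: eq_integral => w _.
  by rewrite gee0_abs//; apply: integral_ge0 => t _; rewrite /gp le_max lexx orbT.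
apply: filterS => w /(_ I) e _; rewrite integralE.
rewrite (_ : \int[_]_(t in _) _ = 0)%E; last first.
  by rewrite -[RHS]e; apply: eq_integral => t _; rewrite funeposE.
by rewrite add0e; congr (- _)%E; apply: eq_integral => t _; rewrite funenegE.
Qed.

End supergradient_theory.

Hypothesis Kst_gt0 : 0 < Kst.

(** [stopped_bound] integrated over s in [0, T], after enlarging the event tau < s to tau < T. *)
Lemma stopped_double_integral (tau : Omega -> R) : stopping_time P T Ft tau ->
  (forall w, 0 <= tau w <= T) ->
  (\int[P]_w \int[lebesgue_measure]_(s in `[0%R, T])
     (if (tau w < s)%R then h (tau w) w * Z s w else 0)%:E <=
   (Kst * T)%:E * P [set w | (tau w < T)%R])%E.
Proof.
move=> st tT; have mt := stopping_measurable uFt st tT.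
pose k (z : Omega * measurableTypeR R) : \bar R :=
  (if tau z.1 < z.2 then h (tau z.1) z.1 * Z z.2 z.1 else 0)%:E.
have mk : measurable_fun setT k.
  have mt1 : measurable_fun setT (fun z : Omega * measurableTypeR R => tau z.1).
    exact: (measurableT_comp mt measurable_fst).
  have ms : measurable_fun setT (fun z : Omega * measurableTypeR R => z.2 : R) by exact: measurable_snd.
  apply/measurable_EFinP; apply: measurable_fun_ifT => //; first exact: measurable_fun_ltr.
  apply: measurable_funM.
    exact: (measurableT_comp h_meas (measurable_fun_pair mt1 measurable_fst)).
  exact: (measurableT_comp Z_meas (measurable_fun_pair ms measurable_fst)).
have k0 z : (0 <= k z)%E.
  by rewrite lee_fin; case: ifP => // _; rewrite mulr_ge0// ltW.
have -> := @tonelli_in _ _ _ _ _ P lebesgue_measure setT (`[0, T]%classic : set R) k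
   measurableT (measurable_itv _) mk k0.
have mltT s : measurable [set w | tau w < s].
  by rewrite -[X in measurable X]setTI; apply: measurable_fun_ltr.
pose c := (Kst%:E * P [set w | (tau w < T)%R])%E.
have le_c : (\int[lebesgue_measure]_(s in `[0%R, T]) \int[P]_w k (w, s) <=
    \int[lebesgue_measure]_(s in `[0%R, T]) (cst c s))%E.
  apply: ge0_le_integral => //.
  - by move=> s _; apply: integral_ge0.
  - by apply: measurable_funTS; exact: (measurable_fun_fubini_tonelli_G _ mk k0).
  move=> s /= sT; have sT' := sT; move: sT'; rewrite in_itv/= => /andP[s0 s1].
  apply: (@le_trans _ _ (Kst%:E * P [set w | (tau w < s)%R])%E).
    have := stopped_bound st tT sT; apply: le_trans.
    rewrite [leRHS]integral_mkcond le_eqVlt; apply/orP; left; apply/eqP.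
    apply: eq_integral => w _; rewrite /k /patch/=; case: (ltP (tau w) s) => hs.
      by rewrite mem_set//= mulrC.
    by rewrite memNset//= ltNge hs.
  apply: lee_wpmul2l; first by rewrite lee_fin ltW.
  by apply: le_measure; rewrite ?inE// => w /= h1; exact: lt_le_trans s1.
apply: le_trans le_c _; rewrite integral_cst//.
rewrite [X in (_ * X <= _)%E](_ : _ = T%:E).
  by rewrite /c EFinM muleAC.
transitivity (lebesgue_measure (`[0, T]%classic : set R)) => //.
by rewrite lebesgue_measure_itv/= lte_fin T_gt0 -EFinD subr0.
Qed.

Let N nu u := P [set w | (hit T nu u w < T)%R].

Let measurable_hit_lt nu u : adm nu -> measurable [set w | (hit T nu u w < T)%R].
Proof.
move=> A; rewrite -[X in measurable X]setTI; apply: measurable_fun_ltr => //.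
exact: (measurable_section_at u (admissible_measurable_hit T_gt0 uFt A)).
Qed.

Let mN nu : adm nu -> measurable_fun setT (N nu : measurableTypeR R -> \bar R).
Proof.
move=> A; have mhit := admissible_measurable_hit T_gt0 uFt A.
have : measurable_fun setT (fun uw : R * Omega => (if hit T nu uw.1 uw.2 < T then 1 else 0 : R)%:E).
  by apply/measurable_EFinP; apply: measurable_fun_ifT => //; exact: measurable_fun_ltr.
move=> /(measurable_expectation P (f := fun u w => (if hit T nu u w < T then 1 else 0 : R)%:E)).
move=> /(_ _)/wrap[]; first by move=> u w; rewrite lee_fin; case: ifP.
apply: eq_measurable_fun => u _; rewrite /N.
rewrite -[in RHS](setIT [set w | (hit T nu u w < T)%R]) -integral_indic//; last exact: measurable_hit_lt.
apply: eq_integral => w _; rewrite indicE; case: ifP => hh; first by rewrite mem_set.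
by rewrite memNset//= hh.
Qed.

(** Two regimes. Where the capacity C is at least c, F'(C) <= e. Where C is below c, the tangent at
    C evaluated at Z y gives F'(C) Z a <= F(C) <= F(c), however large F'(C) is. *)
Let density_affine_le nu (e c a : R) s w : 0 < e -> 0 < c ->
  (forall x, c <= x -> derive1 F x <= e) -> 0 <= a -> a <= Acc nu s w ->
  mrg nu s w * a <= F c + e * (Z s w * a).
Proof.
move=> e0 c0 Fe a0 aA; have Fc0 : 0 <= F c by exact: (production_ge0 F_production).
have d1 : mrg nu s w * a <= Z s w * derive1 F (Cap nu s w) * a.
  rewrite ler_wpM2r// ler_wpM2r//; last by rewrite ler_piMl// ltW.
  exact: (production_derive_ge0 F_production (reduced_capacity_gt0 _ _ _)).
apply: le_trans d1 _; have [cC|Cc] := leP c (Cap nu s w).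
  have h1 : Z s w * derive1 F (Cap nu s w) * a <= e * (Z s w * a).
    by rewrite mulrA (mulrC e) ler_wpM2r// ler_wpM2l ?Fe// ltW.
  by apply: le_trans h1 _; rewrite lerDr.
have h2 : Z s w * derive1 F (Cap nu s w) * a <= F (Cap nu s w).
  have Zy : 0 < Z s w * y by rewrite mulr_gt0.
  have := production_tangent F_production (reduced_capacity_gt0 nu s w) Zy.
  have := production_ge0 F_production Zy.
  move=> b1 b2.
  apply: (@le_trans _ _ (Z s w * derive1 F (Cap nu s w) * Acc nu s w)).
    rewrite ler_wpM2l// mulr_ge0//; first exact: ltW.
    exact: (production_derive_ge0 F_production (reduced_capacity_gt0 _ _ _)).
  have := @tangent_at0 R (F (Cap nu s w)) (derive1 F (Cap nu s w)) 1 (Z s w) y (Acc nu s w).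
  by rewrite !mul1r; apply; exact: le_trans b1 b2.
apply: le_trans h2 _; apply: (@le_trans _ _ (F c)).
  exact: (ltW (production_increasing F_production (reduced_capacity_gt0 _ _ _) Cc)).
by rewrite lerDl !mulr_ge0// ltW.
Qed.

(** [density_affine_le] for the investment made at levels in I, followed by
    [stopped_double_integral] at each level. *)
Lemma reduced_window_bound nu (I : set R) (e c : R) : adm nu -> measurable I -> I `<=` U ->
  0 < e -> 0 < c -> (forall a, c <= a -> derive1 F a <= e) ->
  (\int[lebesgue_measure]_(u in I) \int[P]_w Phi nu (hit T nu u w) w <=
   (F c * T)%:E + (e * (Kst * T))%:E *
     \int[lebesgue_measure]_(u in I) P [set w | (hit T nu u w < T)%R])%E.
Proof.
move=> A mI IU e0 c0 Fe; rewrite -reduced_pairing_hit//.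
have hT u w := hit_itv T_gt0 nu u w.
have mhit := admissible_measurable_hit T_gt0 uFt A.
have st u := admissible_hit_stopping T_gt0 uFt u A.
pose W s w := (\int[lebesgue_measure]_(u in I)
    (if (hit T nu u w < s)%R then h (hit T nu u w) w else 0)%:E)%E.
have mW : strip_measurable T W.
  apply: measurable_funTS; exact: (measurable_window mI mhit h_meas h_ge0).
have W0 s w : (0 <= W s w)%E.
  by apply: integral_ge0 => u _; rewrite lee_fin; case: ifP.
have W_le s w : s \in `[0, T] -> (W s w <= (Acc nu s w)%:E)%E.
  rewrite in_itv/= => /andP[s0 sT]; rewrite (investedE T_gt0 uFt)//.
  apply: ge0_subset_integral => //; last by move=> u _; rewrite lee_fin; case: ifP.
  apply/measurable_EFinP/measurable_funTS.
  have mhw := measurableT_comp mhit (measurable_pair2 w : measurable_fun setT (fun u : R => (u, w))).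
  apply: measurable_fun_ifT => //; first exact: measurable_fun_ltr.
  by apply: (measurableT_comp h_meas (g := fun u => (hit T nu u w, w))); exact: measurable_fun_pair.
have Fc0 : 0 <= F c by exact: (production_ge0 F_production).
have mZW : strip_measurable T (fun s w => (Z s w)%:E * W s w)%E.
  by apply: emeasurable_funM => //; apply/measurable_EFinP; exact: measurable_funTS.
have ZW0 : strip_ge0 T (fun s w => (Z s w)%:E * W s w)%E.
  by move=> s w _; rewrite mule_ge0// lee_fin ltW.
apply: (@le_trans _ _ (double_integral P T (fun s w => (F c)%:E + e%:E * ((Z s w)%:E * W s w))%E)).
  apply: double_integral_le.
  - apply: emeasurable_funM => //; apply/measurable_EFinP; exact: measurable_reduced_density.
  - by apply: emeasurable_funD => //; apply: measurable_funeM.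
  - move=> s w _; apply: mule_ge0; last exact: W0.
    by rewrite lee_fin reduced_density_ge0.
  move=> s w sT; rewrite -/(W s w); have := W_le s w sT; have := W0 s w.
  case: (W s w) => [a| |]; rewrite ?lee_fin// => a0 aA.
  exact: density_affine_le.
rewrite double_integralD//; first last.
- by move=> s w sT; rewrite mule_ge0// ?ZW0// lee_fin ltW.
- by apply: measurable_funeM.
- exact: measurable_cst.
rewrite double_integralZl//; last exact: ltW.
apply: leeD.
  rewrite /double_integral.
  have lebT : lebesgue_measure (`[0, T]%classic : set R) = T%:E.
    by rewrite lebesgue_measure_itv/= lte_fin T_gt0 -EFinD subr0.
  rewrite (eq_integral (cst (F c * T)%:E)); last first.
    by move=> w _; rewrite integral_cst// EFinM -lebT.
  rewrite integral_cst// [X in (_ * X)%E](_ : _ = 1%E) ?mule1//.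
  exact: (@probability_setT _ _ _ P).
rewrite EFinM -muleA; apply: lee_wpmul2l; first by rewrite lee_fin ltW.
rewrite /double_integral (tonelli_invested P mI mhit h_meas h_ge0); first last.
- by move=> s w _; exact: ltW.
- exact: measurable_funTS.
rewrite -ge0_integralZl//.
- apply: ge0_le_integral => //.
  + move=> u _; apply: integral_ge0 => w _; apply: integral_ge0 => s _.
    by rewrite lee_fin; case: ifP => // _; rewrite mulr_ge0// ltW.
  + apply: measurable_funTS.
    have mZ : measurable_fun (strip (Omega := Omega) T) (fun sw => Z sw.1 sw.2).
      exact: measurable_funTS.
    apply: (measurable_expectation P (f := fun u w => \int[lebesgue_measure]_(s in `[0%R, T])
       (if (hit T nu u w < s)%R then h (hit T nu u w) w * Z s w else 0)%:E)%E).
      exact: (measurable_invested_time mhit h_meas h_ge0 mZ (fun s w _ => ltW (Z_gt0 s w))).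
    by move=> u w; apply: integral_ge0 => s _; rewrite lee_fin; case: ifP => // _; rewrite mulr_ge0// ltW.
  + by apply: measurable_funTS; apply: measurable_funeM; exact: mN A.
  + by move=> u _; exact: stopped_double_integral.
- by apply: measurable_funTS; exact: mN A.
- by rewrite lee_fin mulr_ge0// ltW.
Qed.

Definition reduced_net nu : \bar R := (reduced_revenue nu - reduced_cost nu)%E.
Definition reduced_value : \bar R := ereal_sup [set reduced_net nu | nu in admissible P T Ft].

Lemma reduced_cost_ge0 nu : (0 <= Cost nu)%E.
Proof. by apply: integral_ge0 => w _; apply: integral_ge0 => t _; rewrite lee_fin. Qed.

Lemma reduced_net_le_value nu : adm nu -> (reduced_net nu <= reduced_value)%E.
Proof. by move=> A; apply: ereal_sup_ubound; exists nu. Qed.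

Let q nu u := (\int[P]_w (dl (hit T nu u w) w * (hit T nu u w < T)%R%:R)%:E)%E.

Let mq nu : adm nu -> measurable_fun setT (q nu : measurableTypeR R -> \bar R).
Proof.
move=> A; have mhit := admissible_measurable_hit T_gt0 uFt A.
apply: measurable_expectation; last by move=> u w; rewrite lee_fin mulr_ge0.
apply/measurable_EFinP; apply: measurable_funM.
  exact: (measurableT_comp dl_meas (measurable_fun_pair mhit measurable_snd)).
rewrite (_ : (fun x => _) = (fun uw : R * Omega => if hit T nu uw.1 uw.2 < T then 1 else 0)).
  by apply: measurable_fun_ifT => //; exact: measurable_fun_ltr.
by apply/funext => uw; case: ifP.
Qed.

Let q_ge nu u : adm nu -> (d0%:E * N nu u <= q nu u)%E.
Proof.
move=> A; have mA := measurable_hit_lt u A.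
rewrite /N -[X in (_ * P X)%E]setIT -integral_indic// -ge0_integralZl//; try by
  [rewrite lee_fin ltW|apply/measurable_EFinP].
apply: ge0_le_integral => //.
- by move=> w _; rewrite mule_ge0// lee_fin// ltW.
- by apply: measurable_funeM; apply/measurable_EFinP.
- apply/measurable_EFinP; apply: measurable_discount_at.
  exact: (measurable_section_at u (admissible_measurable_hit T_gt0 uFt A)).
move=> w _; rewrite -EFinM lee_fin indicE.
case: (ltP (hit T nu u w) T) => hh; first by rewrite mem_set// !mulr1.
by rewrite memNset ?mulr0//= ltNge hh.
Qed.

Lemma reduced_cost_finite nu G : adm nu -> reduced_supergradient nu G ->
  (forall tau : Omega -> R, stopping_time P T Ft tau ->
    (forall w, 0 <= tau w <= T) -> {ae P, forall w, (G (tau w) w <= 0)%E}) ->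
  (\int[P]_w \int[stieltjes T (nu ^~ w)]_(t in `[0%R, T[) G t w = 0)%E ->
  (Cost nu < +oo)%E.
Proof.
move=> A sG G0; rewrite (reduced_supergradient_integral A sG)// => /eqP.
rewrite oppe_eq0 => /eqP r0.
(* Chosen so that e Kst T = d0 / 2. A level costs at least d0 times its probability of being hit
   before T, so half of the cost absorbs the linear term. *)
pose e := d0 / 2 / (Kst * T).
have KT0 : 0 < Kst * T by rewrite mulr_gt0.
have e0 : 0 < e by rewrite !divr_gt0.
have [c c0 Fe] := production_derive_small F_production e0.
have Fc0 : 0 <= F c by exact: (production_ge0 F_production).
have eE : e * (Kst * T) = d0 / 2 by rewrite /e divfK// gt_eqF.
pose I (n : nat) : set R := `]0, n%:R]%classic.
have mI n : measurable (I n) by exact: measurable_itv.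
have IU n : I n `<=` U by move=> u; rewrite /I/= !in_itv/= andbT => /andP[].
have pq n : (\int[lebesgue_measure]_(u in I n) \int[P]_w Phi nu (hit T nu u w) w =
   \int[lebesgue_measure]_(u in I n) q nu u)%E.
  rewrite -(reduced_window A sG A G0 (mI n)) [X in (_ + X)%E](_ : _ = 0%E) ?adde0//.
  apply/eqP; rewrite eq_le; apply/andP; split; last first.
    by apply: integral_ge0 => u _; apply: integral_ge0 => w _; case: ifP => // _; exact: reduced_loss_ge0.
  rewrite -[leRHS]r0; apply: (@ge0_subset_integral _ _ _ lebesgue_measure (I n) U
    (mI n) (measurable_itv _) _ _ _ (IU n)).
  - apply: measurable_funTS; apply: measurable_expectation.
      have mhit := admissible_measurable_hit T_gt0 uFt A.
      apply: measurable_fun_ifT => //; first by apply: measurable_fun_ltr.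
      apply: (@measurable_at_time (reduced_loss G)) => //.
        by apply: measurable_maxe => //; apply: measurableT_comp => //; case: sG.
      by move=> u w; exact: hit_itv.
    by move=> u w; case: ifP => // _; exact: reduced_loss_ge0.
  - by move=> u _; apply: integral_ge0 => w _; case: ifP => // _; exact: reduced_loss_ge0.
(* If x is the integral of [N nu] over the window, then d0 x <= F c T + (d0 / 2) x, hence x <= 2 F c
   T / d0. Inserted into the bound, this gives B, which is the same for every window. *)
pose B := F c * T + d0 / 2 * (2 * (F c * T) / d0).
have qB n : (\int[lebesgue_measure]_(u in I n) q nu u <= B%:E)%E.
  have h1 := reduced_window_bound A (mI n) (@IU n) e0 c0 Fe; rewrite pq eE in h1.
  have h2 : (d0%:E * \int[lebesgue_measure]_(u in I n) N nu u <=
      \int[lebesgue_measure]_(u in I n) q nu u)%E.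
    rewrite -ge0_integralZl//.
    - apply: ge0_le_integral => //.
      + exact: mI.
      + by move=> u _; rewrite mule_ge0// lee_fin ltW.
      + by apply: measurable_funTS; apply: measurable_funeM; exact: mN.
      + by apply: measurable_funTS; exact: mq.
      + by move=> u _; exact: q_ge.
    - exact: mI.
    - by apply: measurable_funTS; exact: mN.
    - by rewrite lee_fin ltW.
  have N0 : (0 <= \int[lebesgue_measure]_(u in I n) N nu u)%E by apply: integral_ge0.
  (* The absorption needs a finite quantity, and here the window ]0, n] enters: its length bounds
     the integral of a probability. *)
  have Nfin : (\int[lebesgue_measure]_(u in I n) N nu u < +oo)%E.
    apply: (@le_lt_trans _ _ (\int[lebesgue_measure]_(u in I n) (cst 1%E u))%E).
      apply: ge0_le_integral => //; [exact: mI|by apply: measurable_funTS; exact: mN|].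
      by move=> u _; apply: probability_le1; exact: measurable_hit_lt.
    rewrite integral_cst ?mul1e; last exact: mI.
    apply: (@le_lt_trans _ _ (lebesgue_measure (I n))) => //.
    by rewrite /I lebesgue_measure_itv/=; case: ifP => _; rewrite ?ltry// -EFinD ltry.
  move: h1 (le_trans h2 h1) N0 Nfin; rewrite -/(N nu _).
  case: (\int[lebesgue_measure]_(u in I n) N nu u)%E => // x h1 h3 x0 _.
  apply: le_trans h1 _; rewrite -EFinM -EFinD lee_fin /B lerD2l ler_wpM2l//.
    by rewrite divr_ge0// ltW.
  rewrite ler_pdivlMr//; move: h3; rewrite -!EFinM -EFinD lee_fin => h3.
  by rewrite mulrC -subr_ge0; move: h3; rewrite -subr_ge0; lra.
apply: (@le_lt_trans _ _ B%:E); last exact: ltry.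
rewrite reduced_costE// [leLHS]integral_mkcond.
apply: (@integral_cvg_le _ _ _ lebesgue_measure setT (fun n => (q nu) \_ (I n))) => //.
- by move=> n; apply/(measurable_restrictT _ (mI n)); apply: measurable_funTS; exact: mq.
- move=> n u _; rewrite /patch; case: ifP => // _.
  by apply: integral_ge0 => w _; rewrite lee_fin mulr_ge0.
- move=> u _; apply: cvg_near_cst; near=> n; rewrite /patch !mem_setE !in_itv/= andbT.
  have -> : u <= n%:R.
    by apply: le_trans (ler_norm _) _; near: n; exact: nbhs_infty_ger.
  by rewrite andbT.
- by move=> n; rewrite -integral_mkcond.
Unshelve. all: end_near. Qed.

Lemma reduced_sufficiency nu G : adm nu -> reduced_supergradient nu G ->
  (forall tau : Omega -> R, stopping_time P T Ft tau ->
    (forall w, 0 <= tau w <= T) -> {ae P, forall w, (G (tau w) w <= 0)%E}) ->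
  (\int[P]_w \int[stieltjes T (nu ^~ w)]_(t in `[0%R, T[) G t w = 0)%E ->
  (reduced_value < +oo)%E -> reduced_net nu = reduced_value.
Proof.
move=> A sG G0 iG0 vfin.
have costfin := reduced_cost_finite A sG G0 iG0.
have r0 : (\int[lebesgue_measure]_(u in U) \int[P]_w
    (if (hit T nu u w < T)%R then reduced_loss G (hit T nu u w) w else 0) = 0)%E.
  by move: iG0; rewrite (reduced_supergradient_integral A sG)// => /eqP; rewrite oppe_eq0 => /eqP.
have LC : L nu nu = Cost nu.
  by rewrite (reduced_pairingE A A) (reduced_costE A) -(reduced_window A sG A G0 (measurable_itv _)) r0 adde0.
have revfin : (Rev nu < +oo)%E.
  exact: ereal_minuend_lty (reduced_cost_ge0 nu) costfin (le_lt_trans (reduced_net_le_value A) vfin).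
have rev0 nu' : (0 <= Rev nu')%E by apply: double_integral_ge0; exact: reduced_revenue_ge0.
suff dn : (reduced_value <= reduced_net nu)%E.
  exact: (le_anti (introT andP (conj (reduced_net_le_value A) dn))).
apply: ge_ereal_sup => _ [nu' A' <-].
apply: (ereal_exchange (rev0 _) (rev0 _) (reduced_cost_ge0 _) (reduced_cost_ge0 _) revfin costfin).
rewrite -LC; apply: le_trans (reduced_revenue_tangent A A') _; apply: leeD2l.
rewrite (reduced_pairingE A A') (reduced_costE A') -(reduced_window A sG A' G0 (measurable_itv _)).
apply: leeDl; apply: integral_ge0 => u _; apply: integral_ge0 => w _.
by case: ifP => _; [exact: reduced_loss_ge0|exact: lexx].
Qed.

(** * Necessity: perturbations of an optimal plan *)

Section necessity.
Variable nu : R -> Omega -> R.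
Hypothesis nuA : adm nu.
Hypothesis nu_optimal : reduced_net nu = reduced_value.
Hypothesis value_finite : reduced_value \is a fin_num.

Lemma reduced_revenue_nonneg nu' : (0 <= Rev nu')%E.
Proof. by apply: double_integral_ge0; exact: reduced_revenue_ge0. Qed.

Lemma reduced_optimal_finite : (Rev nu < +oo)%E /\ (Cost nu < +oo)%E.
Proof.
apply: ereal_diff_finite (reduced_revenue_nonneg nu) (reduced_cost_ge0 nu) _.
by have := value_finite; rewrite -nu_optimal.
Qed.

Lemma reduced_optimal_le nu' : adm nu' -> (Cost nu' < +oo)%E ->
  (Rev nu' + Cost nu <= Rev nu + Cost nu')%E.
Proof.
move=> A' C'; have [R0 C0] := reduced_optimal_finite.
have := reduced_net_le_value A'; rewrite -nu_optimal.
exact: ereal_unexchange (reduced_revenue_nonneg _) (reduced_revenue_nonneg _)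
  (reduced_cost_ge0 _) (reduced_cost_ge0 _) R0 C0 C'.
Qed.

(** At finite cost, infinite revenue would exceed the finite value. Perturbed plans can therefore
    serve as points of tangency. *)
Lemma reduced_optimal_revenue_lty nu' : adm nu' -> (Cost nu' < +oo)%E -> (Rev nu' < +oo)%E.
Proof.
move=> A' C'; have [R0 C0] := reduced_optimal_finite.
apply: le_lt_trans (leeDl _ (reduced_cost_ge0 nu)) _.
apply: le_lt_trans (reduced_optimal_le A' C') _.
exact: (lte_add_pinfty R0 C').
Qed.

(** The marginal revenue at [nu'] paired with a unit jump at tau; [reduced_gain_jump] identifies it
    with the expected gain at tau. *)
Let J nu' (tau : Omega -> R) := double_integral P T (fun s w =>
  (if (tau w < s)%R then h (tau w) w * mrg nu' s w else 0)%:E).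

Let J_ge0 nu' tau : strip_ge0 T (fun s w => (if (tau w < s)%R then h (tau w) w * mrg nu' s w else 0)%:E).
Proof. by move=> s w _; rewrite lee_fin; case: ifP => // _; rewrite mulr_ge0// reduced_density_ge0. Qed.

Let mJ nu' (tau : Omega -> R) : adm nu' -> measurable_fun setT tau ->
  strip_measurable T (fun s w => (if (tau w < s)%R then h (tau w) w * mrg nu' s w else 0)%:E).
Proof.
move=> A mt; apply/measurable_EFinP.
have mt2 : measurable_fun setT (fun sw : R * Omega => tau sw.2).
  exact: (measurableT_comp mt measurable_snd).
have mlt : measurable_fun setT (fun sw : R * Omega => if tau sw.2 < sw.1 then h (tau sw.2) sw.2 else 0).
  apply: measurable_fun_ifT => //; first by apply: measurable_fun_ltr => //; exact: measurable_fst.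
  exact: (measurableT_comp h_meas (measurable_fun_pair mt2 measurable_snd)).
have := measurable_funM (measurable_funTS mlt) (measurable_reduced_density A).
apply: eq_measurable_fun => -[s w] _ /=; case: ifP => //; by rewrite mul0r.
Qed.

Lemma reduced_cost_jump (tau : Omega -> R) (e : {nonneg R}) : stopping_time P T Ft tau ->
  (forall w, 0 <= tau w <= T) ->
  Cost (fun t w => nu t w + e%:num * jump (tau w) t) =
  (Cost nu + e%:num%:E * \int[P]_w (dl (tau w) w * (tau w < T)%R%:R)%:E)%E.
Proof.
move=> st tT; have mt := stopping_measurable uFt st tT.
have mdl : strip_measurable (Omega := Omega) T (fun t w => (dl t w)%:E).
  by apply/measurable_EFinP; exact: measurable_funTS.
have dl0 : strip_ge0 (Omega := Omega) T (fun t w => (dl t w)%:E).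
  by move=> t w _; rewrite lee_fin.
have mdlw w : measurable_fun (`[0, T[%classic : set R) (fun t => (dl t w)%:E).
  apply: measurable_funS (strip_section w mdl) => // t /=.
  by rewrite !in_itv/= => /andP[-> /ltW].
have mq' : measurable_fun setT (fun w => (dl (tau w) w * (tau w < T)%R%:R)%:E).
  by apply/measurable_EFinP; exact: measurable_discount_at.
rewrite /reduced_cost -ge0_integralZl//; last by move=> w _; rewrite lee_fin mulr_ge0.
rewrite -ge0_integralD//; first last.
- by apply: measurable_funeM.
- by move=> w _; rewrite mule_ge0// lee_fin mulr_ge0.
- exact: measurable_stieltjes_integral.
- by move=> w _; apply: integral_ge0 => t _; rewrite lee_fin.
apply: eq_integral => w _; rewrite (integral_stieltjesD T_gt0 e _ _ _ (mdlw w)).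
- rewrite integral_jump//; first last.
  congr (_ + _ * _)%E; rewrite indicE mem_setE in_itv/=; case/andP: (tT w) => -> _ /=.
  by rewrite -EFinM mulrC.
- exact: (admissible_nd nuA).
- by move=> x z _ _; exact: jump_nd.
- exact: measurable_itv.
- by move=> t _; rewrite lee_fin.
Qed.

Let jumped (tau : Omega -> R) (e : {nonneg R}) t w := nu t w + e%:num * jump (tau w) t.

Lemma reduced_discount_at_lty (tau : Omega -> R) : measurable_fun setT tau ->
  (\int[P]_w (dl (tau w) w * (tau w < T)%R%:R)%:E < +oo)%E.
Proof.
move=> mt; apply: (@le_lt_trans _ _ (\int[P]_w (cst 1%E w))%E).
  apply: ge0_le_integral => //.
  - by move=> w _; rewrite lee_fin mulr_ge0.
  - by apply/measurable_EFinP; exact: measurable_discount_at.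
  - by move=> w _; rewrite lee_fin; case: (tau w < T); rewrite ?mulr1// mulr0.
rewrite integral_cst// [X in (_ * X)%E](_ : _ = 1%E) ?mule1 ?ltry//.
exact: (@probability_setT _ _ _ P).
Qed.

(** The tangent is taken at the jumped plan, where the pairing is bounded by a finite revenue and
    terms can be cancelled. The price is a derivative at the perturbed plan, removed in
    [reduced_jump_le]. *)
Let jump_step (tau : Omega -> R) (e : {nonneg R}) : stopping_time P T Ft tau ->
  (forall w, 0 <= tau w <= T) -> 0 < e%:num ->
  (J (jumped tau e) tau <= \int[P]_w (dl (tau w) w * (tau w < T)%R%:R)%:E)%E.
Proof.
move=> st tT e0; have mt := stopping_measurable uFt st tT.
have A : adm (jumped tau e) by exact: admissible_jump.
have [R0 C0] := reduced_optimal_finite.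
have Dfin := reduced_discount_at_lty mt.
have D0 : (0 <= \int[P]_w (dl (tau w) w * (tau w < T)%R%:R)%:E)%E.
  by apply: integral_ge0 => w _; rewrite lee_fin mulr_ge0.
have CE : Cost (jumped tau e) = _ := reduced_cost_jump e st tT.
have C' : (Cost (jumped tau e) < +oo)%E.
  rewrite CE; apply: (lte_add_pinfty C0).
  by rewrite lte_mul_pinfty ?lee_fin.
have K := reduced_optimal_le A C'.
have R' := reduced_optimal_revenue_lty A C'.
have Tg := reduced_revenue_tangent A nuA.
have LE : L (jumped tau e) (jumped tau e) =
    (L (jumped tau e) nu + e%:num%:E * J (jumped tau e) tau)%E.
  have ke0 : 0 <= e%:num by [].
  rewrite -(double_integralZl P ke0 (mJ A mt) (@J_ge0 _ _)).
  have eJ0 : strip_ge0 T (fun s w => e%:num%:E *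
      (if (tau w < s)%R then h (tau w) w * mrg (jumped tau e) s w else 0)%:E)%E.
    by move=> s w sT; apply: mule_ge0; [rewrite lee_fin|exact: J_ge0].
  have meJ : strip_measurable T (fun s w => e%:num%:E *
      (if (tau w < s)%R then h (tau w) w * mrg (jumped tau e) s w else 0)%:E)%E.
    exact: (measurable_funeM _ (mJ A mt)).
  rewrite -(double_integralD P (measurable_reduced_pairing A nuA) meJ (@reduced_pairing_ge0 _ _) eJ0).
  apply: eq_double_integral => s w; rewrite in_itv/= => /andP[_ sT].
  rewrite /jumped (invested_jump T_gt0 uFt)// -EFinM -EFinD; congr (_%:E).
  by rewrite -/(jumped tau e) mulrDr; congr (_ + _); case: ifP => _; ring.
have Jn0 : (0 <= J (jumped tau e) tau)%E by apply: double_integral_ge0; exact: J_ge0.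
have L0 : (0 <= L (jumped tau e) nu)%E by apply: double_integral_ge0; exact: reduced_pairing_ge0.
have LR := reduced_pairing_le_revenue A.
move: K Tg LR; rewrite LE CE.
exact: ereal_jump_step e0 (reduced_revenue_nonneg _) (reduced_cost_ge0 _) D0 L0 Jn0 R0 C0 Dfin R'.
Qed.

Lemma reduced_gain_jump nu' (tau : Omega -> R) : adm nu' -> (forall w, 0 <= tau w <= T) ->
  (\int[P]_w Phi nu' (tau w) w = J nu' tau)%E.
Proof.
move=> A tT; apply: eq_integral => w _.
by rewrite reduced_gainE//; case/andP: (tT w).
Qed.

(** Fatou's lemma along jumps of size 1 / (n + 1): the capacity after the jump tends to that of nu,
    and F' is continuous there. *)
Lemma reduced_jump_le (tau : Omega -> R) : stopping_time P T Ft tau ->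
  (forall w, 0 <= tau w <= T) ->
  (\int[P]_w Phi nu (tau w) w <= \int[P]_w (dl (tau w) w * (tau w < T)%R%:R)%:E)%E.
Proof.
move=> st tT; have mt := stopping_measurable uFt st tT.
rewrite (reduced_gain_jump nuA tT).
have e0 n : 0 <= n.+1%:R^-1 :> R by rewrite invr_ge0.
pose e n : {nonneg R} := NngNum (e0 n).
apply: (double_integral_cvg_le _ _ _ _ _ (fun n => jump_step (e := e n) st tT _)).
- by move=> n; apply: mJ => //; exact: admissible_jump.
- by move=> n; exact: J_ge0.
- exact: mJ.
- exact: J_ge0.
- move=> s w sT'; have sT : s <= T by move: sT'; rewrite in_itv/= => /andP[].
  case: (tau w < s); last exact: cvg_cst.
  apply: cvg_EFin_real; apply: cvgMr; rewrite /reduced_density; apply: cvgMr.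
  apply: (@cvg_comp _ _ _ (fun n => reduced_capacity (jumped tau (e n)) s w) (derive1 F) _
    (nbhs (reduced_capacity nu s w))); last first.
    exact: (production_derive_continuous F_production (reduced_capacity_gt0 _ _ _)).
  rewrite /reduced_capacity; apply: cvgMr; apply: cvgD; first exact: cvg_cst.
  set c := if tau w < s then h (tau w) w else 0.
  have -> : (fun n => Acc (jumped tau (e n)) s w) = (fun n => Acc nu s w + n.+1%:R^-1 * c).
    by apply/funext => n; rewrite /jumped (invested_jump T_gt0 uFt).
  have : Acc nu s w + n.+1%:R^-1 * c @[n --> \oo] --> Acc nu s w + 0 * c.
    by apply: cvgD; [exact: cvg_cst|apply: cvgMl; exact: cvg_harmonic].
  by rewrite mul0r addr0.
- by move=> n; rewrite /= invr_gt0.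
Qed.

(** [reduced_jump_le] for tau restricted to each event of its sigma-algebra is an inequality between
    integrals over that event, hence one between conditional expectations. *)
Lemma reduced_optimal_nonpositive G : reduced_supergradient nu G ->
  forall tau : Omega -> R, stopping_time P T Ft tau ->
  (forall w, 0 <= tau w <= T) -> {ae P, forall w, (G (tau w) w <= 0)%E}.
Proof.
move=> [mG sG] tau st tT; have [Y Yc GE] := sG tau st tT.
have mt := stopping_measurable uFt st tT.
have sA := stopped_sigma_algebraP uFt st.
have YQ : {ae P, forall w, (Y w <= (dl (tau w) w * (tau w < T)%R%:R)%:E)%E}.
  apply: (cond_expectation_le sA (@stopped_sub _ _ _ _ _ _ uFt tau) Yc
    (Q := fun w => dl (tau w) w * (tau w < T)%R%:R)).
  - by move=> w; case: (tau w < T); rewrite ?mulr1 ?mulr0 ?dl_ge0 ?dl_le1 ?lexx ?ler01.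
  - move=> B mB; have FB := dl_stopped st tT mB; have FT := stopped_ltT T_gt0 uFt st tT.
    (* The variable is 0 where tau = T, so whether 0 lies in B decides if that event belongs to the
       preimage. *)
    have [B0|B0] := pselect (B 0).
      rewrite (_ : _ @^-1` _ = ~` (~` [set w | B (dl (tau w) w)] `&` [set w | tau w < T])).
        by apply: (stopped_C uFt st); apply: (stopped_I uFt) => //; exact: (stopped_C uFt st).
      apply/seteqP; split => w /=; case: (ltP (tau w) T) => lt; rewrite ?mulr1 ?mulr0.
      + by move=> Bw [].
      + by move=> _ [].
      + by move=> nB; apply: contrapT => nBw; exact: nB.
      + by [].
    rewrite (_ : _ @^-1` _ = [set w | B (dl (tau w) w)] `&` [set w | tau w < T]).
      exact: (stopped_I uFt).
    apply/seteqP; split => w /=; case: (ltP (tau w) T) => lt; rewrite ?mulr1 ?mulr0 //.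
    + by case.
    + by case.
  - move=> B FB.
    have stB := stopping_restrict T_gt0 uFt tT FB.
    have tBT w : 0 <= restrict_time T tau B w <= T.
      by rewrite /restrict_time; case: ifP => // _; rewrite lexx ltW.
    have E1 : (\int[P]_w Phi nu (restrict_time T tau B w) w = \int[P]_(w in B) Phi nu (tau w) w)%E.
      rewrite [RHS]integral_mkcond; apply: eq_integral => w _; rewrite /patch /restrict_time.
      by case: (w \in B) => //; exact: reduced_gainT.
    have E2 : (\int[P]_w (dl (restrict_time T tau B w) w * (restrict_time T tau B w < T)%R%:R)%:E =
        \int[P]_(w in B) (dl (tau w) w * (tau w < T)%R%:R)%:E)%E.
      rewrite [RHS]integral_mkcond; apply: eq_integral => w _; rewrite /patch /restrict_time.
      by case: (w \in B) => //; rewrite ltxx mulr0.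
    rewrite -E1 -E2; exact: reduced_jump_le.
move: GE YQ; apply: filterS2 => w -> h1.
by rewrite leeBlDr// add0e.
Qed.

(** For 0 < l < 1, the tangent at l nu and optimality against l nu bound the cost by the pairing at
    l nu with nu. F' at the capacity of l nu decreases in l, so the pairing at l = 1/2 dominates as
    l -> 1. *)
Lemma reduced_cost_le_pairing : (Cost nu <= L nu nu)%E.
Proof.
have [R0 C0] := reduced_optimal_finite.
have mdl : strip_measurable (Omega := Omega) T (fun t w => (dl t w)%:E).
  by apply/measurable_EFinP; exact: measurable_funTS.
have dl0 : strip_ge0 (Omega := Omega) T (fun t w => (dl t w)%:E).
  by move=> t w _; rewrite lee_fin.
have CZ (l : {nonneg R}) : Cost (fun t w => l%:num * nu t w) = (l%:num%:E * Cost nu)%E.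
  rewrite /reduced_cost -ge0_integralZl//; first last.
  - by move=> w _; apply: integral_ge0 => t _; rewrite lee_fin.
  - exact: measurable_stieltjes_integral.
  apply: eq_integral => w _; rewrite integral_stieltjesZ//.
  - exact: (admissible_nd nuA).
  - apply: measurable_funS (strip_section w mdl) => // t /=.
    by rewrite !in_itv/= => /andP[-> /ltW].
  - by move=> t _; rewrite lee_fin.
have CZfin (l : {nonneg R}) : (Cost (fun t w => (l%:num * nu t w)%R) < +oo)%E.
  by rewrite CZ lte_mul_pinfty ?lee_fin.
have A (l : {nonneg R}) : adm (fun t w => l%:num * nu t w) by exact: admissibleZ.
have LZ (l : {nonneg R}) : L (fun t w => l%:num * nu t w) (fun t w => l%:num * nu t w) =
    (l%:num%:E * L (fun t w => (l%:num * nu t w)%R) nu)%E.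
  have l0 : 0 <= l%:num by [].
  rewrite -(double_integralZl P l0 (measurable_reduced_pairing (A l) nuA) (@reduced_pairing_ge0 _ _)).
  apply: eq_double_integral => s w; rewrite in_itv/= => /andP[_ sT].
  by rewrite (investedZ T_gt0 uFt)// -EFinM mulrCA.
have L0 nu1 nu2 : (0 <= L nu1 nu2)%E by apply: double_integral_ge0; exact: reduced_pairing_ge0.
(* l times this pairing is the pairing of l nu with itself, which is at most the finite revenue of l
   nu. *)
have Lfin (l : {nonneg R}) : 0 < l%:num -> (L (fun t w => (l%:num * nu t w)%R) nu < +oo)%E.
  move=> l0; have := le_lt_trans (reduced_pairing_le_revenue (A l)) (reduced_optimal_revenue_lty (A l) (CZfin l)).
  rewrite LZ; exact: ereal_scale_lty.
have step (l : {nonneg R}) : 0 < l%:num -> l%:num < 1 ->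
    (Cost nu <= L (fun t w => (l%:num * nu t w)%R) nu)%E.
  move=> l0 l1.
  have := reduced_optimal_le (A l) (CZfin l); have := reduced_revenue_tangent (A l) nuA.
  rewrite LZ CZ.
  exact: ereal_scaling_step l0 l1 (reduced_revenue_nonneg _) (reduced_revenue_nonneg _) (reduced_cost_ge0 _)
    (L0 _ _) R0 C0 (reduced_optimal_revenue_lty (A l) (CZfin l)) (Lfin l l0).
(* [n.+2] makes the scalings increase from 1/2 to 1, so that l = 1/2 dominates all of them. *)
have l_ge0 n : 0 <= 1 - n.+2%:R^-1 :> R by rewrite subr_ge0 invf_le1// ler1n.
pose l n : {nonneg R} := NngNum (l_ge0 n).
have half0 : 0 <= 2^-1 :> R by rewrite invr_ge0.
pose half : {nonneg R} := NngNum half0.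
apply: (@double_integral_dominated_ge _ _ _ P T
  (fun n s w => (mrg (fun t w => (l n)%:num * nu t w) s w * Acc nu s w)%:E) _
  (fun s w => (mrg (fun t w => half%:num * nu t w) s w * Acc nu s w)%:E)).
- by move=> n; exact: measurable_reduced_pairing.
- by move=> n; exact: reduced_pairing_ge0.
- exact: measurable_reduced_pairing.
- exact: reduced_pairing_ge0.
- exact: measurable_reduced_pairing.
- exact: reduced_pairing_ge0.
- move=> s w; rewrite in_itv/= => /andP[_ sT].
  apply: cvg_EFin_real; apply: cvgMl; rewrite /reduced_density; apply: cvgMr.
  apply: (@cvg_comp _ _ _ (fun n => reduced_capacity (fun t w => (l n)%:num * nu t w) s w) (derive1 F) _
    (nbhs (reduced_capacity nu s w))); last first.
    exact: (production_derive_continuous F_production (reduced_capacity_gt0 _ _ _)).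
  rewrite /reduced_capacity; apply: cvgMr; apply: cvgD; first exact: cvg_cst.
  have -> : (fun n => Acc (fun t w => (l n)%:num * nu t w) s w) =
      (fun n => (1 - n.+2%:R^-1) * Acc nu s w).
    by apply/funext => n; rewrite (investedZ T_gt0 uFt).
  have : (1 - n.+2%:R^-1) * Acc nu s w @[n --> \oo] --> (1 - 0) * Acc nu s w.
    apply: cvgMl; apply: cvgB; first exact: cvg_cst.
    by have := @cvg_harmonic R; rewrite -(cvg_shiftS (harmonic : nat -> R^o)); exact.
  by rewrite subr0 mul1r.
- move=> n s w; rewrite in_itv/= => /andP[_ sT].
  rewrite lee_fin; apply: ler_wpM2r; first exact: invested_ge0.
  rewrite /reduced_density; apply: ler_wpM2l.
    by apply: mulr_ge0; [exact: dl_ge0|exact: ltW].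
  apply: (production_derive_ni F_production); first exact: reduced_capacity_gt0.
  rewrite /reduced_capacity; apply: ler_wpM2l; first exact: ltW.
  have E (r : {nonneg R}) : Acc (fun t w => r%:num * nu t w) s w = r%:num * Acc nu s w.
    exact: (investedZ T_gt0 uFt).
  rewrite lerD2l (E half) (E (l n)); apply: ler_wpM2r; first exact: invested_ge0.
  rewrite /= lerBrDr -lerBrDl.
  have -> : 1 - 2^-1 = 2^-1 :> R by field.
  by rewrite lef_pV2 ?posrE// ler_nat.
- by apply: Lfin; rewrite /= invr_gt0.
- move=> n; apply: step => /=; first by rewrite subr_gt0 invf_lt1// ltr1n.
  by rewrite ltrBlDr ltrDl invr_gt0.
Qed.

(** Along nu the cost is the pairing plus the loss. As the cost is at most the pairing, which is
    finite, the loss is 0. *)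
Lemma reduced_necessity G : reduced_supergradient nu G ->
  (\int[P]_w \int[stieltjes T (nu ^~ w)]_(t in `[0%R, T[) G t w = 0)%E.
Proof.
move=> sG; have G0 := reduced_optimal_nonpositive sG.
have [R0 C0] := reduced_optimal_finite.
rewrite (reduced_supergradient_integral nuA sG G0); apply/eqP; rewrite oppe_eq0; apply/eqP.
have W := reduced_window nuA sG nuA G0 (measurable_itv `]0, +oo[).
have := reduced_cost_le_pairing; rewrite (reduced_costE nuA) -W (reduced_pairingE nuA nuA).
apply: ereal_add_le_cancel.
- apply: integral_ge0 => u _; apply: integral_ge0 => w _.
  by case: ifP => _; [exact: reduced_loss_ge0|exact: lexx].
- by apply: integral_ge0 => u _; apply: integral_ge0 => w _; exact: reduced_gain_ge0.
- by rewrite -(reduced_pairingE nuA nuA); exact: le_lt_trans (reduced_pairing_le_revenue nuA) R0.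
Qed.

End necessity.

Theorem reduced_optimality nu G : adm nu -> reduced_supergradient nu G -> reduced_value \is a fin_num ->
  reduced_net nu = reduced_value <->
  (forall tau : Omega -> R, stopping_time P T Ft tau ->
    (forall w, 0 <= tau w <= T) -> {ae P, forall w, (G (tau w) w <= 0)%E}) /\
  (\int[P]_w \int[stieltjes T (nu ^~ w)]_(t in `[0%R, T[) G t w = 0)%E.
Proof.
move=> A sG vfin; split=> [opt|[G0 iG0]].
  split; first exact: reduced_optimal_nonpositive A opt vfin G sG.
  exact: reduced_necessity A opt vfin G sG.
apply: reduced_sufficiency A sG G0 iG0 _.
by case/fin_numPlt/andP: vfin.
Qed.

End reduced_problem.

(** * Regularization *)

Section primitive.
Context {R : realType} (T K : R) (X : R -> R).
Hypothesis X_meas : measurable_fun (`[0, T] : set R) X.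
Hypothesis X_bounds : forall t, t \in `[0, T] -> 0 <= X t <= K.

Let primitive_ext_le (t : R) : 0 <= t -> t <= T ->
  (\int[lebesgue_measure]_(r in `[0%R, t]) (X r)%:E <= (K * t)%:E)%E.
Proof.
move=> t0 tT; have sub : `[0, t]%classic `<=` `[0, T]%classic.
  by move=> r /=; rewrite !in_itv/= => /andP[-> /le_trans]; apply.
apply: (@le_trans _ _ (\int[lebesgue_measure]_(r in `[0%R, t]) (cst K%:E r))%E).
  apply: ge0_le_integral => //.
  - by move=> r /sub /X_bounds /andP[].
  - by apply/measurable_EFinP; exact: measurable_funS sub X_meas.
  - by move=> r /sub /X_bounds /andP[]; rewrite lee_fin.
rewrite integral_cst// [X in (_ * X <= _)%E](_ : _ = t%:E) ?EFinM//.
transitivity (lebesgue_measure (`[0, t]%classic : set R)) => //.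
rewrite lebesgue_measure_itv/= lte_fin; case: ltP => [_|]; first by rewrite -EFinD subr0.
by move=> t0'; congr (_%:E); apply/eqP; rewrite eq_le t0 t0'.
Qed.

Lemma primitive_nd (s t : R) : 0 <= s -> s <= t -> t <= T ->
  \int[lebesgue_measure]_(r in `[0, s]) X r <= \int[lebesgue_measure]_(r in `[0, t]) X r.
Proof.
move=> s0 st tT; have t0 := le_trans s0 st.
have sub : `[0, t]%classic `<=` `[0, T]%classic.
  by move=> r /=; rewrite !in_itv/= => /andP[-> /le_trans]; apply.
have fin (r : R) : 0 <= r -> r <= T -> (\int[lebesgue_measure]_(x in `[0%R, r]) (X x)%:E \is a fin_num)%E.
  move=> r0 rT; rewrite ge0_fin_numE; first exact: le_lt_trans (primitive_ext_le r0 rT) (ltry _).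
  apply: integral_ge0 => x /=; rewrite in_itv/= => /andP[x0 xr]; rewrite lee_fin.
  have xT : x \in `[0, T] by rewrite in_itv/= x0 (le_trans xr).
  by case/andP: (X_bounds xT).
rewrite /Rintegral fine_le ?fin ?(le_trans st)//.
apply: ge0_subset_integral => //.
- by apply/measurable_EFinP; exact: measurable_funS sub X_meas.
- by move=> r /sub /X_bounds /andP[]; rewrite lee_fin.
- by move=> r /=; rewrite !in_itv/= => /andP[-> /le_trans]; apply.
Qed.

Lemma primitive_le (t : R) : 0 <= K -> 0 <= t -> t <= T ->
  \int[lebesgue_measure]_(r in `[0, t]) X r <= K * T.
Proof.
move=> K0 t0 tT; have le1 := primitive_ext_le t0 tT.
have ge0 : (0 <= \int[lebesgue_measure]_(r in `[0%R, t]) (X r)%:E)%E.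
  apply: integral_ge0 => x /=; rewrite in_itv/= => /andP[x0 xr]; rewrite lee_fin.
  have xT : x \in `[0, T] by rewrite in_itv/= x0 (le_trans xr).
  by case/andP: (X_bounds xT).
apply: (@le_trans _ _ (K * t)); last by rewrite ler_wpM2l.
rewrite -lee_fin /Rintegral fineK//.
by rewrite ge0_fin_numE//; exact: le_lt_trans le1 (ltry _).
Qed.

End primitive.

Section progressive_at_stopping.
Context d (Omega : measurableType d) (R : realType).
Variables (P : probability Omega R) (T : R) (Ft : R -> set (set Omega)).
Hypothesis T_gt0 : 0 < T.
Hypothesis uFt : usual_conditions P T Ft.

(** On the event tau <= t the primitive at tau is the primitive at min(tau, t), and this is
    [Ft t]-measurable because X is progressive. *)
Lemma stopped_primitive (X : R -> Omega -> R) (tau : Omega -> R) (B : set R) :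
  progressive T Ft X -> (forall t w, t \in `[0, T] -> 0 <= X t w) ->
  stopping_time P T Ft tau -> (forall w, 0 <= tau w <= T) -> measurable B ->
  stopped_sigma_algebra T Ft tau
    [set w | B (\int[lebesgue_measure]_(r in `[0, tau w]) X r w)].
Proof.
move=> pX X0 st tT mB.
have key t : t \in `[0, T] ->
    Ft t ([set w | B (\int[lebesgue_measure]_(r in `[0, tau w]) X r w)] `&` [set w | tau w <= t]).
  move=> t0T; have := t0T; rewrite in_itv/= => /andP[t0 tT'].
  have mt : measurable_fun setT ((fun w => Num.min (tau w) t) : filtered Ft t -> R).
    apply: (measurability (@RGenOInfty.G R)) => [|/= _ [_] [r] -> <-].
      exact: RGenOInfty.measurableE.
    rewrite setTI; have [r0|r0] := ltP r 0.
      rewrite (_ : _ @^-1` _ = setT)//; apply/seteqP; split => // w _ /=.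
      by rewrite in_itv/= andbT lt_min !(lt_le_trans r0)//; case/andP: (tT w).
    have [rt|tr] := ltP r t; last first.
      rewrite (_ : _ @^-1` _ = set0)//; apply/seteqP; split => // w /=.
      by rewrite in_itv/= andbT lt_min (ltNge r t) tr andbF.
    rewrite (_ : _ @^-1` _ = ~` [set w | tau w <= r]); last first.
      by apply/seteqP; split => w /=; rewrite in_itv/= andbT lt_min rt andbT ltNge => /negP.
    rewrite (usual_measurableE uFt); apply: (usual_C uFt).
    apply: (usual_mono uFt (ltW rt)); apply: st.1.
    by rewrite in_itv/= r0 (le_trans (ltW rt)).
  have mp := measurable_primitive (Omega := filtered Ft t) (X := X) (a := t) _ (pX t t0T).
  have {}mp := mp _; move: mp => /(_ _)/wrap[].
    move=> r w; rewrite in_itv/= => /andP[r0 rt]; apply: X0.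
    by rewrite in_itv/= r0 (le_trans rt).
  move=> mp.
  have mS : measurable [set sw : R * filtered Ft t | sw.1 \in `[0, t]].
    rewrite (_ : [set _ | _] = `[0, t] `*` setT); first exact: measurableX.
    by apply/seteqP; split => -[s w] //= [].
  have mc : measurable_fun setT ((fun w => \int[lebesgue_measure]_(r in `[0, Num.min (tau w) t]) X r w)
      : filtered Ft t -> R).
    apply: (measurable_comp (g := fun w : filtered Ft t => (Num.min (tau w) t, w)) mS _ mp).
      move=> _ [w _ <-] /=; rewrite in_itv/= le_min t0 ge_min lexx orbT !andbT.
      by case/andP: (tT w).
    exact: measurable_fun_pair.
  have FtB : Ft t [set w | B (\int[lebesgue_measure]_(r in `[0, Num.min (tau w) t]) X r w)].
    rewrite -(usual_measurableE uFt) -[X in measurable X]setTI; exact: mc.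
  rewrite (_ : _ `&` _ =
     [set w | B (\int[lebesgue_measure]_(r in `[0, Num.min (tau w) t]) X r w)] `&` [set w | tau w <= t]).
    by apply: (usual_I uFt) => //; exact: st.1.
  by apply/seteqP; split => w /= -[Bw le]; split; move: Bw; rewrite // (min_idPl le).
split => //; have := key T; rewrite setIidl; last by move=> w _ /=; case/andP: (tT w).
by apply; rewrite in_itv/= lexx ltW.
Qed.

End progressive_at_stopping.

Section reduction.
Context d (Omega : measurableType d) (R : realType).
Variables (P : probability Omega R) (T : R) (Ft : R -> set (set Omega)).
Variables (muC sigmaC fC muF M : R -> Omega -> R) (F : R -> R) (y kappaf K K1 K2 : R).
Hypothesis T_gt0 : 0 < T.
Hypothesis P_complete : measure_is_complete P.
Hypothesis uFt : usual_conditions P T Ft.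
Hypothesis muC_meas : measurable_fun (strip (Omega := Omega) T) (fun sw => muC sw.1 sw.2).
Hypothesis sigmaC_meas : measurable_fun (strip (Omega := Omega) T) (fun sw => sigmaC sw.1 sw.2).
Hypothesis fC_meas : measurable_fun (strip (Omega := Omega) T) (fun sw => fC sw.1 sw.2).
Hypothesis muF_progressive : progressive T Ft muF.
Hypothesis drift_bounds : forall t w, t \in `[0, T] ->
  0 <= muC t w + sigmaC t w ^+ 2 / 2 <= K1.
Hypothesis muF_bounds : forall t w, t \in `[0, T] -> 0 <= muF t w <= K2.
Hypothesis fC_bounds : forall t w, t \in `[0, T] -> 0 < fC t w <= kappaf.
Hypothesis F_production : production_function F.
Hypothesis M_adapted : adapted T Ft M.
Hypothesis M_continuous : {ae P, forall w, {within `[0, T], continuous (M ^~ w)}}.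
Hypothesis M_exponential : forall (t s : R) (A : set Omega), 0 <= t -> t <= s -> s <= T ->
  Ft t A -> (\int[P]_(w in A) (expR (M s w - M t w))%:E <= K%:E * P A)%E.
Hypothesis K_gt0 : 0 < K.
Hypothesis y_gt0 : 0 < y.

Definition clamp_time (t : R) := Num.max 0 (Num.min t T).
Local Notation clamp := clamp_time.

Lemma clamp_time_itv t : clamp t \in `[0, T].
Proof. by rewrite in_itv/= le_max lexx/= ge_max (ltW T_gt0)/= ge_min lexx orbT. Qed.

Lemma clamp_timeE t : t \in `[0, T] -> clamp t = t.
Proof. by rewrite in_itv/= => /andP[t0 tT]; rewrite /clamp (min_idPl tT) (max_idPr t0). Qed.

Lemma measurable_clamp (X : R -> Omega -> R) :
  measurable_fun (strip (Omega := Omega) T) (fun sw => X sw.1 sw.2) ->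
  measurable_fun setT (fun sw : R * Omega => X (clamp sw.1) sw.2).
Proof.
move=> mX; have mc : measurable_fun setT (fun sw : R * Omega => (clamp sw.1, sw.2)).
  apply: measurable_fun_pair; last exact: measurable_snd.
  apply: measurable_maxr => //; apply: measurable_minr => //; exact: measurable_fst.
apply: (measurable_comp (F := strip T) _ _ mX mc); first exact: measurable_strip.
by move=> _ [sw _ <-]; exact: clamp_time_itv.
Qed.

Definition continuous_paths : set Omega := [set w | {within `[0, T], continuous (M ^~ w)}].
Local Notation good := continuous_paths.

(* The paths of M are continuous only almost surely; P being complete, changing
   the other ones preserves measurability. *)
Definition regular_path t w : R := if w \in good then M t w else 0.
Local Notation regular := regular_path.

Definition capacity_drift (t : R) (w : Omega) : R :=
  \int[lebesgue_measure]_(s in `[0, t]) (muC s w + sigmaC s w ^+ 2 / 2).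
Local Notation drift := capacity_drift.

Definition reduced_discount t w := discount muF (clamp t) w.
Local Notation dl := reduced_discount.
Definition reduced_unit t w := expR (regular (clamp t) w - drift (clamp t) w).
Local Notation Z := reduced_unit.
Definition reduced_rate t w := fC (clamp t) w / Z t w.
Local Notation h := reduced_rate.

Lemma continuous_paths_ae : {ae P, forall w, good w}. Proof. exact: M_continuous. Qed.

Lemma measurable_continuous_paths : measurable good.
Proof.
rewrite -(setCK good); apply: measurableC; apply: P_complete.
exact: continuous_paths_ae.
Qed.

Lemma regular_path_continuous w : {within `[0, T], continuous (regular ^~ w)}.
Proof.
have [gw|gw] := pselect (good w).
  have -> : regular ^~ w = M ^~ w by apply/funext => t; rewrite /regular mem_set.
  exact: gw.
have -> : regular ^~ w = cst 0 by apply/funext => t; rewrite /regular memNset.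
by apply: continuous_subspaceT => t; exact: cst_continuous.
Qed.

Lemma regular_path_meas t : t \in `[0, T] -> measurable_fun setT (regular t).
Proof.
move=> tT; apply: measurable_fun_if => //.
- apply: (measurable_fun_bool true) => //.
  rewrite setTI (_ : _ @^-1` _ = good).
    exact: measurable_continuous_paths.
  by apply/seteqP; split => w; [exact: set_mem|exact: mem_set].
- by apply: measurable_funTS; exact: (adapted_measurableT uFt M_adapted tT).
Qed.

Lemma regular_path_strip : measurable_fun (strip (Omega := Omega) T) (fun sw => regular sw.1 sw.2).
Proof.
apply: (measurable_right_continuous (X := regular) T_gt0); first exact: regular_path_meas.
move=> w t; rewrite in_itv/= => /andP[t0 tT].
exact: within_continuous_right (@regular_path_continuous w) t0 tT.
Qed.

Lemma capacity_drift_strip : measurable_fun (strip (Omega := Omega) T) (fun sw => drift sw.1 sw.2).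
Proof.
apply: (measurable_primitive (X := fun s w => muC s w + sigmaC s w ^+ 2 / 2)).
  by move=> t w tT; case/andP: (drift_bounds w tT).
apply: measurable_funD => //; apply: measurable_funM => //.
exact: measurable_funX.
Qed.

Lemma strip_section_real (X : R -> Omega -> R) w :
  measurable_fun (strip (Omega := Omega) T) (fun sw => X sw.1 sw.2) ->
  measurable_fun (`[0, T] : set R) (X ^~ w).
Proof.
move=> mX; apply/measurable_EFinP.
by apply: (strip_section (f := fun t w => (X t w)%:E)); exact/measurable_EFinP.
Qed.

Lemma capacity_drift_integrand : measurable_fun (strip (Omega := Omega) T)
  (fun sw => muC sw.1 sw.2 + sigmaC sw.1 sw.2 ^+ 2 / 2).
Proof.
apply: measurable_funD => //; apply: measurable_funM => //.
exact: measurable_funX.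
Qed.

Lemma capacity_drift_nd w s t : 0 <= s -> s <= t -> t <= T -> drift s w <= drift t w.
Proof.
apply: (primitive_nd (T := T) (K := K1) (X := fun r => muC r w + sigmaC r w ^+ 2 / 2)).
  exact: (strip_section_real (X := fun r w => muC r w + sigmaC r w ^+ 2 / 2) w capacity_drift_integrand).
by move=> r rT; exact: drift_bounds.
Qed.

Lemma muF_strip_measurable : measurable_fun (strip (Omega := Omega) T) (fun sw => muF sw.1 sw.2).
Proof. exact: (progressive_measurable T_gt0 uFt). Qed.

Lemma discount_strip_measurable : measurable_fun (strip (Omega := Omega) T) (fun sw => discount muF sw.1 sw.2).
Proof.
have mN : measurable_fun setT (fun x : R => expR (- x)) by apply: measurableT_comp.
apply: (measurableT_comp mN); apply: (measurable_primitive (X := muF)); last exact: muF_strip_measurable.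
by move=> t w tT; case/andP: (muF_bounds w tT).
Qed.

Lemma K2_ge0 : 0 <= K2.
Proof.
have /andP[a b] := muF_bounds point (clamp_time_itv 0); exact: le_trans a b.
Qed.

Lemma reduced_discount_meas : measurable_fun setT (fun tw : R * Omega => dl tw.1 tw.2).
Proof. exact: (measurable_clamp discount_strip_measurable). Qed.

Lemma reduced_unit_meas : measurable_fun setT (fun tw : R * Omega => Z tw.1 tw.2).
Proof.
apply: measurableT_comp => //; apply: measurable_funB.
  exact: (measurable_clamp regular_path_strip).
exact: (measurable_clamp capacity_drift_strip).
Qed.

Lemma reduced_unit_gt0 t w : 0 < Z t w. Proof. exact: expR_gt0. Qed.

Lemma reduced_rate_meas : measurable_fun setT (fun tw : R * Omega => h tw.1 tw.2).
Proof.
rewrite (_ : (fun _ => _) = (fun tw : R * Omega => fC (clamp tw.1) tw.2 *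
    expR (drift (clamp tw.1) tw.2 - regular (clamp tw.1) tw.2))).
  apply: measurable_funM; first exact: (measurable_clamp fC_meas).
  apply: measurableT_comp => //; apply: measurable_funB.
    exact: (measurable_clamp capacity_drift_strip).
  exact: (measurable_clamp regular_path_strip).
by apply/funext => tw; rewrite /h /Z -expRN opprB.
Qed.

Lemma reduced_rate_ge0 t w : 0 <= h t w.
Proof.
apply: divr_ge0; apply: ltW; last exact: reduced_unit_gt0.
by case/andP: (fC_bounds w (clamp_time_itv t)).
Qed.

(** The discount at the maximal rate [K2] over the whole horizon. *)
Definition discount_min := expR (- (K2 * T)).
Local Notation d0 := discount_min.

Lemma reduced_discount_ge t w : d0 <= dl t w.
Proof.
rewrite ler_expR lerN2; have := clamp_time_itv t; rewrite in_itv/= => /andP[c0 cT].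
apply: (primitive_le (strip_section_real w muF_strip_measurable)) => //; last exact: K2_ge0.
by move=> r rT; exact: muF_bounds.
Qed.

Lemma reduced_discount_le1 t w : dl t w <= 1.
Proof.
rewrite -expR0 ler_expR oppr_le0; apply: Rintegral_ge0 => r /=; rewrite in_itv/= => /andP[r0 rt].
have := clamp_time_itv t; rewrite in_itv/= => /andP[c0 cT].
have rT : r \in `[0, T] by rewrite in_itv/= r0 (le_trans rt).
by case/andP: (muF_bounds w rT).
Qed.

(** A bound for each path: the continuous regular path attains its minimum on [0, T], and the drift
    is largest at T. *)
Lemma reduced_rate_bdd w : exists B, forall t, h t w <= B.
Proof.
have [c cT cmin] := EVT_min (ltW T_gt0) (@regular_path_continuous w).
exists (kappaf * expR (drift T w - regular c w)) => t.
rewrite /h /Z -expRN opprB ler_pM//.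
- by case/andP: (fC_bounds w (clamp_time_itv t)) => /ltW.
- by case/andP: (fC_bounds w (clamp_time_itv t)).
rewrite ler_expR lerB//; last by apply: cmin; exact: clamp_time_itv.
by have := clamp_time_itv t; rewrite in_itv/= => /andP[c0 cT']; exact: capacity_drift_nd.
Qed.

Lemma regular_path_exponential (t s : R) (A : set Omega) : 0 <= t -> t <= s -> s <= T ->
  Ft t A -> (\int[P]_(w in A) (expR (regular s w - regular t w))%:E <= K%:E * P A)%E.
Proof.
move=> t0 ts sT FA; apply: le_trans (M_exponential t0 ts sT FA).
have tT : t \in `[0, T] by rewrite in_itv/= t0 (le_trans ts).
have sT' : s \in `[0, T] by rewrite in_itv/= sT (le_trans t0).
have mA := usual_measurable uFt FA.
rewrite le_eqVlt; apply/orP; left; apply/eqP; apply: ae_eq_integral => //.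
- apply/measurable_EFinP/measurable_funTS; apply: measurableT_comp => //.
  by apply: measurable_funB; exact: regular_path_meas.
- apply/measurable_EFinP/measurable_funTS; apply: measurableT_comp => //.
  by apply: measurable_funB; exact: (adapted_measurableT uFt M_adapted).
by move: continuous_paths_ae; apply: filterS => w gw _; rewrite /regular mem_set.
Qed.

(** The drift is nondecreasing, so the capacity at s produced by one unit invested at tau is at most
    kappaf exp(M_s - M_tau), with the regularized M; [stopped_exponential] supplies the factor K. *)
Lemma reduced_stopped_bound (tau : Omega -> R) (s : R) : stopping_time P T Ft tau ->
  (forall w, 0 <= tau w <= T) -> s \in `[0, T] ->
  (\int[P]_(w in [set w | (tau w < s)%R]) (Z s w * h (tau w) w)%:E <=
   (kappaf * K)%:E * P [set w | (tau w < s)%R])%E.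
Proof.
move=> st tT sT.
have mt := stopping_measurable uFt st tT.
have mA : measurable [set w | tau w < s].
  by rewrite -[X in measurable X]setTI; apply: measurable_fun_ltr.
have k0 : 0 <= kappaf.
  have /andP[a b] := fC_bounds point (clamp_time_itv 0); exact: ltW (lt_le_trans a b).
have s0T : 0 <= s <= T by move: sT; rewrite in_itv.
have mtau (X : R -> Omega -> R) : measurable_fun setT (fun sw : R * Omega => X sw.1 sw.2) ->
    measurable_fun setT (fun w => X (tau w) w).
  move=> mX; apply: (measurableT_comp mX (g := fun w => (tau w, w))).
  exact: measurable_fun_pair.
have tauE w : clamp (tau w) = tau w by apply: clamp_timeE; rewrite in_itv/= tT.
have mM : measurable_fun setT (fun w => regular s w - regular (tau w) w).
  apply: measurable_funB; first exact: regular_path_meas.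
  have := mtau (fun t w => regular (clamp t) w) (measurable_clamp regular_path_strip).
  apply: eq_measurable_fun => w _.
  by rewrite /= tauE.
rewrite EFinM -muleA.
apply: (@le_trans _ _ (kappaf%:E * \int[P]_(w in [set w | (tau w < s)%R])
   (expR (regular s w - regular (tau w) w))%:E)%E); last first.
  apply: lee_wpmul2l; first by rewrite lee_fin.
  exact: (stopped_exponential T_gt0 uFt regular_path_meas regular_path_continuous regular_path_exponential).
rewrite -ge0_integralZl//; last by apply/measurable_EFinP/measurable_funTS; apply: measurableT_comp.
apply: ge0_le_integral => //.
- by move=> w _; rewrite lee_fin; apply: mulr_ge0; [exact: ltW (reduced_unit_gt0 _ _)|exact: reduced_rate_ge0].
- apply/measurable_EFinP/measurable_funTS; apply: measurable_funM.
    exact: (measurable_section_at s reduced_unit_meas).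
  exact: (mtau h reduced_rate_meas).
- apply: measurable_funeM; apply/measurable_EFinP/measurable_funTS; exact: measurableT_comp.
move=> w /= lt; rewrite -EFinM lee_fin /h /Z -expRN opprB (clamp_timeE sT) tauE.
rewrite mulrCA -expRD ler_pM ?expR_ge0//.
- by have := fC_bounds w (clamp_time_itv (tau w)); rewrite tauE => /andP[/ltW].
- by have := fC_bounds w (clamp_time_itv (tau w)); rewrite tauE => /andP[].
rewrite ler_expR.
have : drift (tau w) w <= drift s w.
  by apply: capacity_drift_nd; [case/andP: (tT w)|exact: ltW|case/andP: s0T].
lra.
Qed.

Lemma reduced_discount_stopped (tau : Omega -> R) (B : set R) : stopping_time P T Ft tau ->
  (forall w, 0 <= tau w <= T) -> measurable B ->
  stopped_sigma_algebra T Ft tau [set w | B (dl (tau w) w)].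
Proof.
move=> st tT mB.
have mB' : measurable ((fun x : R => expR (- x)) @^-1` B).
  by rewrite -[X in measurable X]setTI; apply: measurableT_comp.
have mF0 t w : t \in `[0, T] -> 0 <= muF t w by move=> tT'; case/andP: (muF_bounds w tT').
have := stopped_primitive T_gt0 uFt muF_progressive mF0 st tT mB'.
move=> H; apply: (eq_ind _ (stopped_sigma_algebra T Ft tau) H).
apply/seteqP; split => w /=; rewrite /reduced_discount /discount clamp_timeE ?in_itv ?tT//=.
Qed.

Lemma unit_capacityE t w : good w -> t \in `[0, T] -> unit_capacity muC sigmaC M t w = Z t w.
Proof. by move=> gw tT; rewrite /unit_capacity /Z /regular (clamp_timeE tT) mem_set. Qed.

Lemma capacityE nu t w : good w -> t \in `[0, T] ->
  capacity T muC sigmaC fC M y nu t w = reduced_capacity T y Z h nu t w.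
Proof.
move=> gw tT; rewrite /capacity /reduced_capacity (unit_capacityE gw tT).
suff -> : \int[stieltjes T (nu ^~ w)]_(s in `[0, t[) (fC s w / unit_capacity muC sigmaC M s w) =
    invested T h nu t w by [].
apply: eq_Rintegral => s; rewrite inE/= in_itv/= => /andP[s0 st].
have sT : s \in `[0, T].
  by move: tT; rewrite !in_itv/= s0 => /andP[_ tT]; rewrite (ltW (lt_le_trans st tT)).
by rewrite unit_capacityE// /h clamp_timeE.
Qed.

Lemma discountE t w : t \in `[0, T] -> discount muF t w = dl t w.
Proof. by move=> tT; rewrite /dl clamp_timeE. Qed.

(** Revenues agree where the path of M is continuous, that is almost surely, and completeness of P
    transfers measurability to the original revenue. Costs agree at every w. *)
Lemma net_profitE nu : admissible P T Ft nu ->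
  net_profit P T muC sigmaC fC muF M F y nu = reduced_net P T F y dl Z h nu.
Proof.
move=> A; rewrite /net_profit /reduced_net.
have E1 : (\int[P]_w revenue T muC sigmaC fC muF M F y nu w = reduced_revenue P T F y dl Z h nu)%E.
  apply: esym.
  have E : ae_eq P setT (fun w => \int[lebesgue_measure]_(s in `[0%R, T])
       (dl s w * F (reduced_capacity T y Z h nu s w))%:E)%E (revenue T muC sigmaC fC muF M F y nu).
    move: continuous_paths_ae; apply: filterS => w gw _; apply: eq_integral => s; rewrite inE => sT.
    by rewrite (discountE w sT) (capacityE nu gw sT).
  have m1 : measurable_fun setT (fun w => \int[lebesgue_measure]_(s in `[0%R, T])
       (dl s w * F (reduced_capacity T y Z h nu s w))%:E)%E.
    apply: measurable_inner.
      exact: (measurable_reduced_revenue T_gt0 uFt F_production y_gt0 reduced_discount_meas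
        reduced_unit_meas reduced_rate_meas reduced_unit_gt0 reduced_rate_ge0 reduced_rate_bdd A).
    exact: (reduced_revenue_ge0 F_production y_gt0 (expR_gt0 _)
      reduced_discount_ge reduced_unit_gt0 reduced_rate_ge0).
  exact: (ae_eq_integral _ _ measurableT m1 (ae_measurable_fun P_complete E m1) E).
have E2 : (\int[P]_w cost T muF nu w = reduced_cost P T dl nu)%E.
  apply: eq_integral => w _; apply: eq_integral => t; rewrite inE/= in_itv/= => /andP[t0 tT].
  have tT' : t \in `[0, T] by rewrite in_itv/= t0 ltW.
  exact: (congr1 EFin (discountE w tT')).
exact: (congr2 (fun a b : \bar R => a - b)%E E1 E2).
Qed.

Lemma valueE : value P T Ft muC sigmaC fC muF M F y = reduced_value P T Ft F y dl Z h.
Proof.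
rewrite /value /reduced_value.
exact: (congr1 (fun S => ereal_sup S) (eq_imagel net_profitE)).
Qed.

(** The same Y serves: the two marginal revenues agree almost surely, so they have the same integral
    over every event. *)
Lemma reduced_supergradientE nu G : admissible P T Ft nu ->
  supergradient P T Ft muC sigmaC fC muF M F y nu G ->
  reduced_supergradient P T Ft F y dl Z h nu G.
Proof.
move=> A [oG sG]; split; first exact: (optional_measurable T_gt0 uFt oG).
move=> tau st tT; have [Y [Ym Yc] GE] := sG tau st.
have tT' w : tau w \in `[0, T] by rewrite in_itv/=.
have mt := stopping_measurable uFt st tT.
exists Y; last by move: GE; apply: filterS => w ->; rewrite discountE.
split; first exact: Ym.
move=> B FB; rewrite (Yc _ FB).
have mB := stopped_sub uFt FB.
have E : ae_eq P setT (fun w => reduced_gain T F y dl Z h nu (tau w) w)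
    (marginal_revenue T muC sigmaC fC muF M F y nu tau).
  move: continuous_paths_ae; apply: filterS => w gw _.
  apply: eq_integral => s; rewrite inE/= in_itv/= => /andP[s0 s1].
  have sT : s \in `[0, T].
    by rewrite in_itv/= s1 andbT; apply: le_trans s0; case/andP: (tT w).
  rewrite discountE// !unit_capacityE// capacityE// /reduced_density; congr (_%:E).
  by rewrite /h (clamp_timeE (tT' w)); ring.
have m1 : measurable_fun setT (fun w => reduced_gain T F y dl Z h nu (tau w) w).
  exact: (measurable_reduced_gain_at T_gt0 uFt F_production y_gt0 reduced_discount_meas
    reduced_unit_meas reduced_rate_meas (expR_gt0 _) reduced_discount_ge
    reduced_unit_gt0 reduced_rate_ge0 reduced_rate_bdd A mt tT).
apply: ae_eq_integral => //.
- by apply: measurable_funTS; exact: (ae_measurable_fun P_complete E m1).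
- exact: measurable_funTS.
by move: E; apply: filterS => w e _; rewrite e.
Qed.

Lemma optimality_reduced nu G : value P T Ft muC sigmaC fC muF M F y \is a fin_num ->
  admissible P T Ft nu -> supergradient P T Ft muC sigmaC fC muF M F y nu G ->
  optimal P T Ft muC sigmaC fC muF M F y nu <->
  (forall tau, stopping_time P T Ft tau -> {ae P, forall w, (G (tau w) w <= 0)%E}) /\
  (\int[P]_w \int[stieltjes T (nu ^~ w)]_(t in `[0%R, T[) G t w = 0)%E.
Proof.
rewrite valueE => vfin A sG.
have sG' := reduced_supergradientE A sG.
have k0 : 0 < kappaf.
  have /andP[a b] := fC_bounds point (clamp_time_itv 0); exact: lt_le_trans a b.
have Kst0 : 0 < kappaf * K by rewrite mulr_gt0.
have := reduced_optimality T_gt0 uFt F_production y_gt0 reduced_discount_meas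
  reduced_unit_meas reduced_rate_meas (expR_gt0 _)
  reduced_discount_ge reduced_discount_le1 reduced_unit_gt0 reduced_rate_ge0 reduced_rate_bdd
  reduced_stopped_bound reduced_discount_stopped Kst0 A sG' vfin.
move=> opt; split.
  move=> [_ e]; have e' := etrans (esym (net_profitE A)) (etrans e valueE).
  have [G0 iG0] := opt.1 e'; split => // tau st.
  (* The reduced statement asks for times in [0, T] at every w; clipping changes tau on a null set
     only. *)
  have st' := stopping_clip T_gt0 uFt st.
  have tT w : 0 <= clamp (tau w) <= T by have := clamp_time_itv (tau w); rewrite in_itv.
  have := G0 _ st' tT; case: st => _; apply: filterS2 => w wT.
  by rewrite -/(clamp (tau w)) clamp_timeE// in_itv.
move=> [G0 iG0]; split; first exact: A.
rewrite (net_profitE A) valueE; apply: (opt.2 _).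
by split; [move=> tau st _; exact: G0|exact: iG0].
Qed.

End reduction.

Theorem theorem3p2 (d : measure_display) (Omega : measurableType d)
    (R : realType) (P : probability Omega R) (T : R)
    (W muC sigmaC fC muF M : R -> Omega -> R) (F : R -> R) (y kf kappaf : R)
    (T_gt0 : 0 < T)
    (P_complete : measure_is_complete P)
    (W_brownian : brownian_motion P T W)
    (Ft := augmented_filtration P T W)
    (muC_progressive : progressive T Ft muC)
    (sigmaC_progressive : progressive T Ft sigmaC)
    (fC_progressive : progressive T Ft fC)
    (muF_progressive : progressive T Ft muF)
    (muC_bounded : uniformly_bounded T muC)
    (sigmaC_bounded : uniformly_bounded T sigmaC)
    (fC_bounded : uniformly_bounded T fC)
    (muF_bounded : uniformly_bounded T muF)
    (muC_ge0 : forall (t : R) (w : Omega), t \in `[0, T] -> 0 <= muC t w)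
    (muF_ge0 : forall (t : R) (w : Omega), t \in `[0, T] -> 0 <= muF t w)
    (fC_continuous : forall w, {within `[0, T], continuous (fC ^~ w)})
    (kf_gt0 : 0 < kf)
    (fC_bounds : forall (t : R) (w : Omega), t \in `[0, T] -> kf <= fC t w <= kappaf)
    (F_production : production_function F)
    (M_ito : ito_integral P T Ft W sigmaC M)
    (y_gt0 : 0 < y)
    (value_finite : value P T Ft muC sigmaC fC muF M F y \is a fin_num)
    (nu : R -> Omega -> R)
    (nu_admissible : admissible P T Ft nu)
    (G : R -> Omega -> \bar R)
    (G_supergradient :
       supergradient P T Ft muC sigmaC fC muF M F y nu G) :
  optimal P T Ft muC sigmaC fC muF M F y nu <->
  (forall tau, stopping_time P T Ft tau ->
     {ae P, forall w, (G (tau w) w <= 0)%E}) /\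
  (\int[P]_w \int[stieltjes T (nu ^~ w)]_(t in `[0%R, T[) G t w = 0)%E.
Proof.
have mW t : t \in `[0, T] -> measurable_fun setT (W t).
  by move=> tT; exact: (brownian_measurable W_brownian tT).
have uFt : usual_conditions P T Ft by exact: augmented_filtration_usual P_complete mW.
have [a a_le] := muC_bounded.
have [b b_le] := sigmaC_bounded.
have [c c_le] := muF_bounded.
have sigmaC_meas := progressive_measurable T_gt0 uFt sigmaC_progressive.
(* With a, b, c the bounds on |muC|, |sigmaC| and |muF|: [K] is the constant of [ito_exponential],
   [K1] bounds the drift integrand muC + sigmaC^2 / 2, and [K2] the discount rate. *)
apply: (optimality_reduced (kappaf := kappaf) (K := expR (b ^+ 2 * T))
  (K1 := a + b ^+ 2 / 2) (K2 := c) T_gt0 P_complete uFt) => //.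
- exact: (progressive_measurable T_gt0 uFt).
- exact: (progressive_measurable T_gt0 uFt).
- move=> t w tT; rewrite addr_ge0 ?muC_ge0 ?divr_ge0 ?sqr_ge0//=.
  rewrite lerD//; first exact: le_trans (ler_norm _) (a_le t w tT).
  rewrite ler_wpM2r// -real_normK ?num_real// ler_sqr ?nnegrE//; first exact: b_le.
  exact: le_trans (normr_ge0 _) (b_le t w tT).
- by move=> t w tT; rewrite muF_ge0//= (le_trans (ler_norm _) (c_le t w tT)).
- by move=> t w tT; case/andP: (fC_bounds t w tT) => /(lt_le_trans kf_gt0) -> ->.
- by case: M_ito.
- by case: M_ito.
- move=> t s A t0 ts sT; exact: (ito_exponential T_gt0 P_complete W_brownian sigmaC_meas b_le M_ito).
- exact: expR_gt0.
Qed.
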